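(* The threshold probability $p^\ast=p^\ast(n)$ for the property that Connector has a winning strategy in the $(2:2)$ Connector-Breaker connectivity game played on the edge set of $G\sim G_{n,p}$ satisfies $p^\ast = n^{-2/3+o(1)}$ as $n\to\infty$.
   Context: $G_{n,p}$ is the binomial random graph on $n$ vertices in which each edge is present independently with probability $p$. In the $(2:2)$ Connector-Breaker game on a graph $G$, the two players alternately take turns, Connector moving first; in each turn a player claims up to two previously unclaimed edges of $G$, with the restriction that Connector must choose her edges so that the graph formed by her claimed edges is connected throughout the game. In the connectivity game Connector wins if she claims all edges of a spanning tree of $G$; otherwise Breaker wins. A function $p^\ast=p^\ast(n)$ is a threshold probability for a graph property $\mathcal F$ if $\Pr(G\sim G_{n,p}\text{ satisfies }\mathcal F)\to 0$ whenever $p=o(p^\ast)$ and $\Pr(G\sim G_{n,p}\text{ satisfies }\mathcal F)\to 1$ whenever $p=\omega(p^\ast)$. *)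

(* Defs.v *)
From mathcomp Require Import all_boot all_order all_algebra.
From mathcomp Require Import all_classical all_reals all_analysis.
Import Order.TTheory GRing.Theory Num.Theory numFieldNormedType.Exports.

Set Implicit Arguments.
Unset Strict Implicit.
Unset Printing Implicit Defensive.

Local Open Scope ring_scope.

(** * Graphs on the vertex set ['I_n] *)

(* A graph is identified with its set of edges, which are 2-subsets of ['I_n];
   sets of claimed edges have the same type. *)
Notation edges n := {set {set 'I_n}}.

Definition complete_graph (n : nat) : edges n := [set e : {set 'I_n} | #|e| == 2]%SET.

Definition adj (n : nat) (E : edges n) : rel 'I_n :=
  fun x y => [set x; y]%SET \in E.

(* Connectedness of the graph formed by the edges of [E], whose vertices are
   the endpoints of these edges only.  The empty edge set is connected. *)
Definition edges_connected (n : nat) (E : edges n) : Prop :=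
  forall x y : 'I_n,
    x \in finset.cover E -> y \in finset.cover E -> connect (adj E) x y.

Definition acyclic (n : nat) (E : edges n) : Prop :=
  forall c : seq 'I_n, (2 < size c)%N -> ~ ucycle (adj E) c.

Definition spanning_tree (n : nat) (G T : edges n) : Prop :=
  [/\ T \subset G, forall x y : 'I_n, connect (adj T) x y & acyclic T].

(** * The (m : b) Connector-Breaker connectivity game *)

(* A round consists of Connector's move followed by Breaker's move; a history
   lists the completed rounds in chronological order. *)
Definition history (n : nat) := seq (edges n * edges n).

Definition connector_edges (n : nat) (h : history n) : edges n :=
  (\bigcup_(r <- h) r.1)%SET.

Definition breaker_edges (n : nat) (h : history n) : edges n :=
  (\bigcup_(r <- h) r.2)%SET.

Definition unclaimed (n : nat) (G : edges n) (h : history n) : edges n :=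
  (G :\: (connector_edges h :|: breaker_edges h))%SET.

(* "Up to [m] edges" includes claiming none.  Since [connector_edges h] is
   connected before the move, connectedness after the whole move [X] amounts to
   the edges of [X] being claimable one at a time, in a suitable order, with
   the graph connected after each of them. *)
Definition connector_legal (n m : nat) (G : edges n) (h : history n)
    (X : edges n) : Prop :=
  [/\ X \subset unclaimed G h, (#|X| <= m)%N
    & edges_connected (connector_edges h :|: X)%SET].

Definition breaker_legal (n b : nat) (G : edges n) (h : history n)
    (X Y : edges n) : Prop :=
  Y \subset (unclaimed G h :\: X)%SET /\ (#|Y| <= b)%N.

Definition strategy (n : nat) := history n -> edges n.

(* The history after [k] rounds when Connector follows [s] and Breaker claims
   [B i] in round [i]. *)
Fixpoint play (n : nat) (s : strategy n) (B : nat -> edges n) (k : nat) :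
    history n :=
  if k is i.+1 then rcons (play s B i) (s (play s B i), B i) else [::].

(* Breaker may always pass, so every finite legal play extends to an infinite
   one, and it suffices to quantify over infinite sequences of Breaker moves. *)
Definition winning_strategy (n m b : nat) (G : edges n) (s : strategy n) : Prop :=
  forall B : nat -> edges n,
    (forall i, breaker_legal b G (play s B i) (s (play s B i)) (B i)) ->
    (forall i, connector_legal m G (play s B i) (s (play s B i))) /\
    (exists k, exists2 T : edges n,
       spanning_tree G T & T \subset connector_edges (play s B k)).

Definition connector_wins (m b n : nat) (G : edges n) : Prop :=
  exists s : strategy n, winning_strategy m b G s.

(** * Binomial random graphs and thresholds *)

Definition Gnp_weight (R : realType) (n : nat) (p : R) (G : edges n) : R :=
  \prod_(e in complete_graph n) (if e \in G then p else 1 - p).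

Definition Gnp_prob (R : realType) (n : nat) (p : R) (F : edges n -> Prop) : R :=
  \sum_(G : edges n | (G \subset complete_graph n) && `[< F G >]) Gnp_weight p G.

Definition probability_sequence (R : realType) (p : nat -> R) : Prop :=
  forall n, 0 <= p n <= 1.

Local Open Scope classical_set_scope.

(* [p = omega(pstar)] is written [pstar = o(p)]. *)
Definition is_threshold (R : realType) (F : forall n, edges n -> Prop)
    (pstar : nat -> R) : Prop :=
  [/\ probability_sequence pstar,
      forall p : nat -> R, probability_sequence p -> p =o_\oo pstar ->
        Gnp_prob (p n) (@F n) @[n --> \oo] --> (0 : R)
    & forall p : nat -> R, probability_sequence p -> pstar =o_\oo p ->
        Gnp_prob (p n) (@F n) @[n --> \oo] --> (1 : R)].

(* [f n = n ^ (a + o(1))] *)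
Definition power_growth (R : realType) (f : nat -> R) (a : R) : Prop :=
  exists2 eps : nat -> R, eps n @[n --> \oo] --> (0 : R)
    & \forall n \near \oo, f n = n%:R `^ (a + eps n).

(* Main.v *)
(* Below the threshold, fix three root vertices.  A bounded set of further
   vertices spans with the roots fewer than 3/2 edges per vertex.  For a root [v]
   let [D] be the closure of its neighbourhood under adding vertices with at least
   two neighbours in [D].  Every vertex of [D] lies in a small subset of [D] that
   meets the edge bound almost with equality, so by supermodularity of the edge
   count every vertex has at most two edges to earlier vertices of [D], and every
   vertex outside [D] at most one edge to [D].  Whenever Connector reaches a
   vertex, Breaker claims its edges towards earlier vertices of [D]: each edge of
   Connector creates at most one such demand, so two edges per turn suffice, and
   [v] is never reached.  Connector's first vertex is harmless for one of the three
   roots, since otherwise the three structures together would be too dense.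

   Above the threshold, Connector brings in one vertex after the other, each in
   boundedly many rounds, and always the one with the largest Breaker degree; by a
   potential argument these degrees stay logarithmic outside her tree.  To reach
   [v] she uses binary trees: starting from disjoint parts of the neighbourhood of
   [v], the common neighbours of two parts form a larger part whose vertices are
   roots of binary trees with leaves next to [v].  If Connector can step onto two
   disjoint such trees at once, she creates four threats in each turn, of which
   Breaker stops only two, and she reaches [v].  If not, the parts stay away from
   her tree and grow until almost every vertex has a neighbour in each of them;
   walking to such a vertex then creates more threats than Breaker can stop.

   Existence of a threshold is the Bollobas--Thomason argument, comparing [G(n,p)]
   with a union of independent sparser graphs. *)


Require Import Defs.
From mathcomp Require Import all_boot all_order all_algebra boolp zify ring lra.
Import Order.TTheory GRing.Theory Num.Theory.

Set Implicit Arguments.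
Unset Strict Implicit.
Unset Printing Implicit Defensive.

(** * Traps: orientations that let Breaker isolate a vertex *)

(** Both sides use one integer scale: for fixed [J] put [q = floor_root J n], about n^(1/(6J)). The
    two densities are q^-(4J+2) and q^-(4J-2), about n^(-2/3-1/(3J)) and n^(-2/3+1/(3J)); set sizes
    are powers of [q], and a spare factor [q] absorbs logarithmic losses. The ratio 3/2 is critical
    because the expected number of k-sets with m edges is about n^k p^m, which at p = n^(-2/3) turns
    at m = 3k/2. Breaker's obstacle is that Connector may step onto a neighbour of the root and then
    onto the root within one turn. Hence every edge at a neighbour of the root must be oriented,
    which keeps the first edge of a turn away from these neighbours. Connector's obstacle is that
    she cannot prepare threats away from her tree. So her binary trees are only found, in a frozen
    position, and she moves once they suffice to win. *)

Definition simple_graph (V : finType) (G : {set {set V}}) : Prop :=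
  forall e, e \in G -> #|e| = 2.

Lemma disjoint_notin (T : finType) (A B : {set T}) :
  (forall x, x \in A -> x \notin B) -> [disjoint A & B].
Proof.
by move=> AB; rewrite disjoints_subset; apply/subsetP => x /AB; rewrite inE.
Qed.

(** An element of [Y] lies in at most one of the disjoint sets, so deleting a witness for the first
    set from [Y] costs the other sets nothing. *)
Lemma count_meeting (T : finType) (s : seq {set T}) (Y : {set T}) :
  pairwise (fun A B : {set T} => [disjoint A & B]) s ->
  count (fun A : {set T} => ~~ [disjoint Y & A]) s <= #|Y|.
Proof.
elim: s Y => [|A s IH] Y //= /andP[As ps].
have [dA|] := boolP [disjoint Y & A]; first by rewrite add0n IH.
case/pred0Pn => y /= /andP[yY yA]; rewrite (cardsD1 y) yY add1n ltnS.
apply: leq_trans (IH (Y :\ y) ps).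
rewrite leq_eqVlt; apply/orP; left; apply/eqP; apply: eq_in_count => B Bs; congr (~~ _).
have yB : y \notin B by rewrite (disjointFr (allP As _ Bs) yA).
rewrite -!setI_eq0 setIDAC; congr (_ == _); apply/esym/setDidPl.
by rewrite disjoint_sym disjoints1 inE negb_and yB orbT.
Qed.

Lemma simple_edge (V : finType) (G : {set {set V}}) (e : {set V}) x :
  simple_graph G -> e \in G -> x \in e -> exists2 y, y != x & e = [set x; y].
Proof.
move=> G2 eG xe; have /eqP/cards2P[a [b [ab ee]]] := G2 _ eG.
move: xe; rewrite ee !inE => /orP[/eqP->|/eqP->].
  by exists b; rewrite // eq_sym.
by exists a; rewrite // finset.setUC.
Qed.

Lemma simple_loop (V : finType) (G : {set {set V}}) x y :
  simple_graph G -> [set x; y] \in G -> x != y.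
Proof. by move=> G2 /G2; rewrite cards2; case: (x =P y). Qed.

Section Trap.
Variables (V : finType) (G : {set {set V}}) (v : V) (out : V -> {set V}).
Hypothesis G2 : simple_graph G.

(* [y \in out x] means that the edge [xy] is directed from [x] to [y].  Breaker
   claims [xy] as soon as Connector reaches [x]. *)
Definition trap : Prop :=
  [/\ forall x y, y \in out x -> [set x; y] \in G,
      forall x, #|out x| <= 2,
      forall x y, #|out y| = 2 -> [set x; y] \in G -> x \in out y \/ y \in out x,
      forall x, [set x; v] \in G -> out x = [set v]
    & forall w x, [set w; v] \in G -> [set x; w] \in G ->
        w \in out x \/ x \in out w].

(** The arcs that Breaker still has to claim. [C] is Connector's vertex set and [F] contains the
    edges of both players, so an arc whose edge Connector took herself is settled too. *)
Definition debt (C : {set V}) (F : {set {set V}}) : {set V * V} :=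
  [set a | [&& a.1 \in C, a.2 \in out a.1 & [set a.1; a.2] \notin F]].

Hypothesis trapv : trap.

Lemma debtS (C : {set V}) (F F' : {set {set V}}) :
  F \subset F' -> debt C F' \subset debt C F.
Proof.
move=> FF; apply/subsetP => -[x y]; rewrite !inE /= => /and3P[-> ->] /=.
by apply: contra => /(subsetP FF).
Qed.

(** A new vertex [y] brings at most two arcs. If [e] is oriented, claiming it settles one of these
    or an old arc; if it is not, [y] has at most one arc. *)
Lemma debt_step (C : {set V}) (F : {set {set V}}) (e : {set V}) :
  e \in G -> e \notin F -> ~~ [disjoint e & C] ->
  #|debt (C :|: e) (e |: F)| <= #|debt C F|.+1.
Proof.
move=> eG eF; rewrite disjoint_sym => /pred0Pn[x /= /andP[xC xe]].
have [y yx eE] := simple_edge G2 eG xe; rewrite {xe}eE in eG eF *.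
case: trapv => _ out2 orient _ _.
have [yC|yC] := boolP (y \in C).
  have -> : C :|: [set x; y] = C by apply/setUidPl; rewrite subUset !sub1set xC.
  by apply: leqW; apply/subset_leq_card/debtS/subsetUr.
have -> : C :|: [set x; y] = y |: C.
  apply/setP => z; rewrite !inE; case: (z =P x) => [->|_]; rewrite ?xC ?orbT //=.
  by rewrite orbC.
have sub (B : {set V * V}) (D : {set V}) : (forall z, (x, z) \in debt C F -> z != y -> (x, z) \in B) ->
    (forall u z, u != x -> (u, z) \in debt C F -> (u, z) \in B) ->
    (forall z, z \in out y -> z != x -> z \in D) ->
    debt (y |: C) ([set x; y] |: F) \subset B :|: [set (y, z) | z in D].
  move=> B1 B2 BD; apply/subsetP => -[u z]; rewrite !inE /= negb_or.
  case/and3P => /orP[/eqP->|uC] zu /andP[zxy zF]; apply/orP.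
    right; apply/imsetP; exists z => //; apply: BD => //.
    by apply: contraNneq zxy => ->; rewrite finset.setUC.
  left; have [ux|ux] := eqVneq u x; last by apply: B2; rewrite // !inE uC zu.
  rewrite ux in uC zu zxy zF *; apply: B1; first by rewrite !inE uC zu.
  by apply: contraNneq zxy => ->.
have [yo|yo] := boolP (y \in out x).
  have xyd : (x, y) \in debt C F by rewrite !inE /= xC yo.
  apply: (@leq_trans #|debt C F :\ (x, y) :|: [set (y, z) | z in out y]|).
    apply/subset_leq_card/sub => // [z zd zy|u z ux zd].
      by rewrite in_setD1 zd andbT xpair_eqE negb_and zy orbT.
    by rewrite in_setD1 zd andbT xpair_eqE negb_and ux.
  apply: (leq_trans (leq_card_setU _ _).1).
  rewrite (cardsD1 (x, y) (debt C F)) xyd -addSn addnC leq_add2r //.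
  by rewrite (leq_trans (leq_imset_card _ _)).
apply: (@leq_trans #|debt C F :|: [set (y, z) | z in out y :\ x]|).
  by apply/subset_leq_card/sub => // z zo zx; rewrite !inE zx.
apply: (leq_trans (leq_card_setU _ _).1); rewrite -addn1 leq_add2l.
apply: (leq_trans (leq_imset_card _ _)).
have := out2 y; rewrite (cardsD1 x (out y)) leq_eqVlt => /orP[/eqP o2|].
  have [|xo|] := orient x y _ eG; first by rewrite (cardsD1 x (out y)).
    by move: o2; rewrite xo add1n => -[->].
  by rewrite (negPf yo).
by rewrite ltnS; apply: leq_trans; apply: leq_addl.
Qed.

(** This is the property that survives the first edge of a turn, when the debt need no longer be
    empty. *)
Definition guarded (C : {set V}) (F : {set {set V}}) : Prop :=
  v \notin C /\ forall x, x \in C -> [set x; v] \in G -> [set x; v] \in F.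

Lemma guarded_avoid (C : {set V}) (F : {set {set V}}) (e : {set V}) :
  guarded C F -> e \in G -> e \notin F -> ~~ [disjoint e & C] -> v \notin C :|: e.
Proof.
move=> [vC gd] eG eF; rewrite disjoint_sym => /pred0Pn[x /= /andP[xC xe]].
rewrite inE (negPf vC) /=; apply/negP => ve.
have [y yx eE] := simple_edge G2 eG xe; rewrite {xe}eE in eG eF ve.
move: ve; rewrite !inE => /orP[/eqP xv|/eqP yv]; first by rewrite -xv (negPf vC) in xC.
by rewrite -yv in eF eG; rewrite gd in eF.
Qed.

Lemma guarded0 (C : {set V}) (F : {set {set V}}) :
  v \notin C -> debt C F = set0 -> guarded C F.
Proof.
case: trapv => _ _ _ nv _ vC d0; split=> // x xC xv.
apply/negPn/negP => xF; suff : (x, v) \in (set0 : {set V * V}) by rewrite inE.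
by rewrite -d0 inE /= xC (nv _ xv) set11.
Qed.

(** Only a new vertex adjacent to [v] could do harm. Its edge to the old vertex [x] is oriented:
    directed away from [x] it would be an unpaid arc, and directed to [x] it would give [x = v],
    since a neighbour of [v] has [v] as its only out-neighbour. *)
Lemma guarded_step (C : {set V}) (F : {set {set V}}) (e : {set V}) :
  v \notin C -> debt C F = set0 -> e \in G -> e \notin F -> ~~ [disjoint e & C] ->
  guarded (C :|: e) (e |: F).
Proof.
move=> vC d0 eG eF eC; have gd := guarded0 vC d0.
split; first exact: (guarded_avoid gd eG eF eC).
move: eC; rewrite disjoint_sym => /pred0Pn[x /= /andP[xC xe]] w.
have [y yx eE] := simple_edge G2 eG xe; rewrite {xe}eE in eG eF *.
case: trapv => _ _ _ nv orient.
rewrite !inE => /orP[wC|/orP[/eqP wx|/eqP wy]] wv.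
- by rewrite (gd.2 _ wC wv) orbT.
- by rewrite wx in wv *; rewrite (gd.2 _ xC wv) orbT.
rewrite {}wy in wv *; have [yo|] := orient _ _ wv eG.
  suff : (x, y) \in (set0 : {set V * V}) by rewrite inE.
  by rewrite -d0 inE /= xC yo.
by rewrite (nv _ wv) inE => /eqP xv; rewrite xv (negPf vC) in xC.
Qed.

(** Two steps create a debt of at most two, just what Breaker can claim in reply. The case [e2 = e1]
    covers a turn with a single edge. *)
Lemma trap_turn (C : {set V}) (F : {set {set V}}) (e1 e2 : {set V}) :
  v \notin C -> debt C F = set0 -> e1 \in G :\: F -> e2 \in G :\: F ->
  ~~ [disjoint e1 & C] -> ~~ [disjoint e2 & C :|: e1] ->
  v \notin C :|: e1 :|: e2 /\
  #|debt (C :|: e1 :|: e2) ([set e1; e2] :|: F)| <= 2.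
Proof.
move=> vC d0 /setDP[e1G e1F] /setDP[e2G e2F] e1C e2C.
have gd := guarded_step vC d0 e1G e1F e1C.
have d1 := debt_step e1G e1F e1C; rewrite d0 cards0 in d1.
have [->|e12] := eqVneq e2 e1.
  rewrite -(finset.setUA C) !finset.setUid; split; first exact: gd.1.
  by apply: leq_trans d1 _.
have e2F1 : e2 \notin e1 |: F by rewrite !inE negb_or e12.
split; first exact: (guarded_avoid gd e2G e2F1 e2C).
have := debt_step e2G e2F1 e2C; rewrite finset.setUA (finset.setUC [set e2]).
by move=> /leq_trans; apply; rewrite ltnS.
Qed.

End Trap.

(** * Supermodularity of edge counts *)

Section EdgesIn.
Variables (V : finType) (G : {set {set V}}).

Definition edges_in (X : {set V}) : {set {set V}} := [set e in G | e \subset X].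

Definition edge_count (X : {set V}) : nat := #|edges_in X|.

Definition nbrs (x : V) : {set V} := [set y | [set x; y] \in G].

Lemma edges_inS (X Y : {set V}) : X \subset Y -> edges_in X \subset edges_in Y.
Proof.
by move=> XY; apply/subsetP => e; rewrite !inE => /andP[-> /subset_trans]; apply.
Qed.

(** The edges of [E] run across, so they are counted in the union and in neither summand. *)
Lemma edges_in_supermodular (X Y : {set V}) (k : nat) (E : {set {set V}}) :
  E \subset edges_in (X :|: Y) -> k <= #|E| ->
  (forall e, e \in E -> ~~ (e \subset X) && ~~ (e \subset Y)) ->
  edge_count X + edge_count Y + k <= edge_count (X :|: Y) + edge_count (X :&: Y).
Proof.
move=> EXY kE Ecross; rewrite /edge_count -cardsUI.
have -> : edges_in X :&: edges_in Y = edges_in (X :&: Y).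
  by apply/setP => e; rewrite !inE subsetI; case: (e \in G).
rewrite addnAC leq_add2r; apply: (leq_trans (leq_add (leqnn _) kE)).
have d : [disjoint edges_in X :|: edges_in Y & E].
  rewrite disjoint_sym; apply: disjoint_notin => e /Ecross/andP[eX eY].
  by rewrite !inE (negPf eX) (negPf eY) !andbF.
move: d; rewrite -(leq_card_setU (edges_in X :|: edges_in Y) E).2 => /eqP <-.
apply/subset_leq_card; rewrite !subUset EXY andbT.
by rewrite !edges_inS ?subsetUl ?subsetUr.
Qed.

End EdgesIn.

(* In a graph of edge density below [n^(-2/3)], a set of boundedly many vertices
   besides the roots [R] spans with [R] less than 3/2 edges per non-root, with a
   margin once it is large. *)
Definition sparse (V : finType) (G : {set {set V}}) (R : {set V}) (s : nat) : Prop :=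
  [/\ edges_in G R = set0,
      forall S : {set V}, [disjoint S & R] -> S != set0 -> #|S| <= 3 * s ->
        2 * edge_count G (S :|: R) < 3 * #|S|
    & forall S : {set V}, [disjoint S & R] -> s <= #|S| <= 3 * s ->
        2 * edge_count G (S :|: R) + 1 < 3 * #|S|].

(** * The closure of the neighbourhood of a root *)

Section Closure.
Variables (V : finType) (G : {set {set V}}) (R : {set V}) (s : nat).
Hypothesis G2 : simple_graph G.
Hypothesis Gs : sparse G R s.
Local Notation ein := (edges_in G).
Local Notation ne := (edge_count G).
Local Notation nbr := (nbrs G).

Lemma nbrsC x y : (x \in nbr y) = (y \in nbr x).
Proof. by rewrite !inE setUC. Qed.

Lemma nbrs_irr x : x \notin nbr x.
Proof. by rewrite inE; apply/negP => /(simple_loop G2); rewrite eqxx. Qed.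

Lemma s_gt0 : 0 < s.
Proof.
case: Gs => _ _ B; rewrite lt0n; apply/eqP => s0.
by have := B set0; rewrite s0 cards0 disjoints_subset sub0set => /(_ isT isT).
Qed.

Variable v : V.
Hypothesis vR : v \in R.

(** [T] together with the root [v] falls short of 3/2 edges per vertex of [T] by at most [c] halves
    of an edge. *)
Definition deficient (c : nat) (T : {set V}) : bool :=
  3 * #|T| <= 2 * ne (v |: T) + c.

(** The roots in [T] are handed over to [R]. Each of them lowers the bound on the edges by three
    halves, so a nearly tight set contains none, and the margin in [sparse] excludes nearly tight
    sets of size [s] or more. *)
Lemma ein_split (T : {set V}) : v \notin T -> T != set0 -> #|T| <= 3 * s ->
  2 * ne (v |: T) < 3 * #|T| /\
  (3 * #|T| <= 2 * ne (v |: T) + 1 -> #|T| < s /\ [disjoint T & R]).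
Proof.
move=> vT T0 Ts; case: Gs => R0 A B.
have sub : ein (v |: T) \subset ein (T :\: R :|: R).
  apply/edges_inS/subsetP => x; rewrite !inE => /orP[/eqP->|->]; first by rewrite vR orbT.
  by case: (x \in R).
have le : ne (v |: T) <= ne (T :\: R :|: R) := subset_leq_card sub.
have dR : [disjoint T :\: R & R] by apply: disjoint_notin => x /setDP[].
have [TR|TR] := eqVneq (T :\: R) set0.
  have e0 : ne (v |: T) = 0.
    by apply/eqP; rewrite -leqn0 -(cards0 {set V}) -R0 (leq_trans le) // TR set0U.
  rewrite e0 muln0; have T1 : 0 < #|T| by rewrite card_gt0.
  by split; lia.
have TDs : #|T :\: R| <= #|T| by apply/subset_leq_card/subsetDl.
have := A _ dR TR (leq_trans TDs Ts) => lt.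
split; first by lia.
move=> tight; have [TRd|TRd] := boolP [disjoint T & R]; last first.
  have : #|T :\: R| < #|T|.
    by apply/proper_card; rewrite properEneq subsetDl andbT; apply: contraNneq TRd => <-.
  by lia.
split=> //; have TDR : T :\: R = T by apply/setDidPl.
rewrite TDR in le; rewrite ltnNge; apply/negP => sT.
by have := B _ TRd; rewrite sT Ts => /(_ isT); lia.
Qed.

(** The intersection together with [v] has at most 3/2 edges per vertex. Hence, by supermodularity,
    the deficiencies add up, and every crossing edge lowers the sum by two. *)
Lemma deficientU (c1 c2 k : nat) (T1 T2 : {set V}) (E : {set {set V}}) :
  v \notin T1 -> v \notin T2 -> #|T1 :|: T2| <= 3 * s ->
  deficient c1 T1 -> deficient c2 T2 ->
  E \subset ein (v |: (T1 :|: T2)) -> k <= #|E| ->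
  (forall e, e \in E -> ~~ (e \subset v |: T1) && ~~ (e \subset v |: T2)) ->
  3 * #|T1 :|: T2| + 2 * k <= 2 * ne (v |: (T1 :|: T2)) + (c1 + c2).
Proof.
move=> v1 v2 Ts d1 d2 EU kE Ec.
have := @edges_in_supermodular _ G (v |: T1) (v |: T2) k E.
rewrite -setUUr -setUIr => /(_ EU kE Ec) sm.
have vI : v \notin T1 :&: T2 by rewrite inE (negPf v1).
have Is : #|T1 :&: T2| <= 3 * s.
  by apply: leq_trans Ts; apply/subset_leq_card; rewrite subIset // subsetUl.
have : 2 * ne (v |: (T1 :&: T2)) <= 3 * #|T1 :&: T2|.
  have [->|I0] := eqVneq (T1 :&: T2) set0; last exact: ltnW (ein_split vI I0 Is).1.
  rewrite setU0 cards0 muln0 leqn0 muln_eq0 /=; apply/eqP/eqP; rewrite cards_eq0.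
  case: Gs => R0 _ _; rewrite -subset0 -R0; apply: edges_inS; by rewrite sub1set.
have := cardsUI T1 T2; rewrite /deficient in d1 d2 *; lia.
Qed.

Lemma deficientU0 (c1 c2 : nat) (T1 T2 : {set V}) :
  v \notin T1 -> v \notin T2 -> #|T1 :|: T2| <= 3 * s ->
  deficient c1 T1 -> deficient c2 T2 -> deficient (c1 + c2) (T1 :|: T2).
Proof.
move=> v1 v2 Ts d1 d2.
have := @deficientU c1 c2 0 T1 T2 set0 v1 v2 Ts d1 d2 (sub0set _) (leq0n _).
by rewrite muln0 addn0; apply => e; rewrite inE.
Qed.

(** A new vertex costs three and each of its [k] edges pays back two. Two sets of deficiency one
    joined by a vertex with two neighbours thus give 1 + 1 + 3 - 4 = 1 again, while three sets and
    three neighbours give 3 + 3 - 6 = 0, which is impossible. *)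
Lemma deficient_add (c k : nat) (T B : {set V}) z :
  z \notin v |: T -> deficient c T -> B \subset nbr z :&: (v |: T) -> k <= #|B| ->
  3 * #|z |: T| + 2 * k <= 2 * ne (v |: (z |: T)) + (c + 3).
Proof.
move=> zT dT BT kB.
have zT' : z \notin T by apply: contra zT; rewrite inE => ->; rewrite orbT.
rewrite cardsU1 zT' add1n.
suff : ne (v |: T) + k <= ne (v |: (z |: T)) by rewrite /deficient in dT *; lia.
apply: leq_trans (leq_add (leqnn _) kB) _.
have inj : {in B &, injective (fun b => [set z; b])}.
  move=> b b' bB b'B /= /setP/(_ b); rewrite !inE eqxx orbT => /esym/orP[/eqP bz|/eqP //].
  by move: (subsetP BT _ bB); rewrite inE bz (negPf (nbrs_irr z)).
rewrite -(card_in_imset inj).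
have d : [disjoint ein (v |: T) & [set [set z; b] | b in B]].
  rewrite disjoint_sym; apply: disjoint_notin => _ /imsetP[b bB ->].
  rewrite !inE; apply/negP => /andP[_ /subsetP/(_ z)]; rewrite !inE eqxx => /(_ isT).
  by rewrite -in_setU1 (negPf zT).
move: d; rewrite -(leq_card_setU _ _).2 => /eqP <-.
apply/subset_leq_card; rewrite subUset edges_inS; last by rewrite setUS // subsetUr.
apply/subsetP => _ /imsetP[b bB ->].
move: (subsetP BT _ bB); rewrite !inE => /andP[-> bT] /=.
by rewrite subUset !sub1set !inE eqxx orbT /= orbCA bT orbT.
Qed.

(** [T] certifies that [z] belongs to the closure. Apart from [z] it consists of vertices of smaller
    rank, so that a set can later be glued to it along a single vertex. *)
Definition closure_state (D : {set V}) (out : V -> {set V}) (rk : V -> nat) : Prop :=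
  [/\ v \notin D /\ nbr v \subset D,
      forall x, x \in D -> [/\ out x \subset nbr x :&: (v |: D), #|out x| <= 2
                             & x \in nbr v -> out x = [set v]],
      forall x y, x \in D -> y \in D -> y \in nbr x -> y \in out x \/ x \in out y
    & forall z, z \in D -> exists T : {set V},
        [/\ z \in T, T \subset D, forall y, y \in T -> y != z -> rk y < rk z,
            deficient 1 T & #|T| < s]].

Lemma closure_init : closure_state (nbr v) (fun=> [set v]) (fun=> 0).
Proof.
have N3 w : w \in nbr v -> v \notin [set w] /\ w \notin [set v].
  by move=> wv; rewrite !inE eq_sym; split; apply: contraTneq wv => ->; rewrite nbrs_irr.
have s0 := s_gt0.
have s3 : 3 <= 3 * s by rewrite leq_pmulr.
have d1 w : w \in nbr v -> deficient 1 [set w].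
  move=> wv; have [vw wv'] := N3 w wv; rewrite /deficient cards1.
  suff : [set v; w] \in ein (v |: [set w]) by move=> h; rewrite /edge_count (cardsD1 [set v; w]) h; lia.
  by rewrite inE subxx andbT; move: wv; rewrite inE.
split.
- by rewrite nbrs_irr.
- move=> x xv; split=> //; rewrite ?cards1 //.
  by rewrite sub1set !inE eqxx andbT setUC; move: xv; rewrite inE.
(* Two adjacent neighbours of [v] would span with it a triangle, of deficiency 1 + 3 - 4 = 0. *)
- move=> x y xv yv xy; exfalso.
  have [vx xv'] := N3 x xv; have [vy yv'] := N3 y yv.
  have xney : y != x by apply: contraTneq xy => ->; rewrite nbrs_irr.
  have yvx : y \notin v |: [set x] by rewrite !inE negb_or xney andbT; move: yv'; rewrite inE.
  have vxy : v != x by move: vx; rewrite inE.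
  have := @deficient_add 1 2 [set x] [set v; x] y yvx (d1 x xv).
  rewrite cards2 vxy subUset !sub1set.
  rewrite !in_setI in_setU1 in_set1 eqxx /= in_setU1 in_set1 eqxx orbT !andbT.
  rewrite (nbrsC v) yv (nbrsC x) xy => /(_ isT isT).
  have vyx : v \notin y |: [set x].
    by rewrite !inE negb_or vxy andbT eq_sym; move: yv'; rewrite inE.
  have yx0 : y |: [set x] != set0 by rewrite -card_gt0 cards2.
  have yx2 : #|y |: [set x]| = 2 by rewrite cards2 xney.
  have := ein_split vyx yx0; rewrite yx2 => /(_ (ltnW s3))[] lt _ h.
  by clear -lt h; lia.
- move=> z zv; have [vz _] := N3 z zv; exists [set z]; split; rewrite ?set11 ?sub1set //.
  + by move=> y /set1P ->; rewrite eqxx.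
  + exact: d1.
  + have z0 : [set z] != set0 by rewrite -card_gt0 cards1.
    have := (ein_split vz z0); rewrite cards1 => /(_ (leq_trans _ s3))[] // _ /(_ _)[] //.
    by have := d1 z zv; rewrite /deficient cards1.
Qed.

Lemma closure_step D out rk z : closure_state D out rk ->
  z \notin D -> z != v -> 1 < #|nbr z :&: D| ->
  exists out' rk', closure_state (z |: D) out' rk'.
Proof.
move=> [[vD NvD] outP orD tD] zD zv N2; have s0 := s_gt0.
have Tv (T : {set V}) : T \subset D -> v \notin T by move=> TD; apply: contra vD => /(subsetP TD).
have Tz (T : {set V}) : T \subset D -> z \notin v |: T.
  by move=> TD; rewrite !inE negb_or zv; apply: contra zD => /(subsetP TD).
have vzT (T : {set V}) : T \subset D -> v \notin z |: T.
  by move=> TD; rewrite !inE negb_or eq_sym zv Tv.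
have zT0 (T : {set V}) : z |: T != set0 by apply/set0Pn; exists z; rewrite !inE eqxx.
have tri a b (T1 T2 : {set V}) : a \in T1 -> b \in T2 -> a \in nbr z -> b \in nbr z ->
    a != b -> [set a; b] \subset nbr z :&: (v |: (T1 :|: T2)).
  by move=> a1 b2 az bz ab; rewrite subUset !sub1set !in_setI az bz !in_setU a1 b2 !orbT.
have le2 : #|nbr z :&: D| <= 2.
  rewrite leqNgt; apply/negP => /card_gt2P[a [b [c [[]]]]].
  rewrite !inE => /andP[az aD] /andP[bz bD] /andP[cz cD] [ab bc ca].
  have [Ta [aTa TaD _ da sa]] := tD a aD.
  have [Tb [bTb TbD _ db sb]] := tD b bD.
  have [Tc [cTc TcD _ dc sc]] := tD c cD.
  have TabD : Ta :|: Tb \subset D by rewrite subUset TaD.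
  have TD : Ta :|: Tb :|: Tc \subset D by rewrite subUset TabD.
  have sab := (leq_card_setU Ta Tb).1; have sabc := (leq_card_setU (Ta :|: Tb) Tc).1.
  have dab : deficient (1 + 1) (Ta :|: Tb).
    by apply: deficientU0; rewrite ?Tv //; clear -sa sb sab s0; lia.
  have dabc : deficient (1 + 1 + 1) (Ta :|: Tb :|: Tc).
    by apply: deficientU0; rewrite ?Tv //; clear -sa sb sc sab sabc; lia.
  have := @deficient_add _ 3 _ [set a; b; c] z (Tz _ TD) dabc.
  have -> : [set a; b; c] \subset nbr z :&: (v |: (Ta :|: Tb :|: Tc)).
    by rewrite !subUset !sub1set !inE az bz cz aTa bTb cTc !orbT.
  rewrite setUC cardsU1 cards2 !inE negb_or ca ab eq_sym bc => /(_ isT isT) h.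
  have [|lt _] := ein_split (vzT _ TD) (zT0 (Ta :|: Tb :|: Tc)).
    by rewrite cardsU1; case: (_ \notin _); clear -sa sb sc sab sabc; lia.
  by clear -h lt; lia.
pose out' x := if x == z then nbr z :&: D else out x.
pose rk' x := if x == z then (\max_y rk y).+1 else rk x.
have out'D x : x \in D -> out' x = out x.
  by move=> xD; rewrite /out'; case: eqP xD => // ->; rewrite (negPf zD).
have rk'D x : x \in D -> rk' x = rk x.
  by move=> xD; rewrite /rk'; case: eqP xD => // ->; rewrite (negPf zD).
have out'z : out' z = nbr z :&: D by rewrite /out' eqxx.
exists out', rk'; split.
- split; first by rewrite !inE negb_or eq_sym zv.
  by apply: subset_trans NvD (subsetUr _ _).
- move=> x; rewrite in_setU1 => /orP[/eqP ->|xD].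
    rewrite out'z; split=> // [|znv]; first by rewrite setIS // setUA subsetUr.
    by rewrite (subsetP NvD) in zD.
  rewrite out'D //; have [o1 o2 o3] := outP x xD; split=> //.
  by apply: subset_trans o1 _; rewrite setIS // setUS // subsetUr.
- move=> x y; rewrite !in_setU1 => /orP[/eqP ->|xD] /orP[/eqP ->|yD] xy.
  + by rewrite (negPf (nbrs_irr z)) in xy.
  + by left; rewrite out'z in_setI xy.
  + by right; rewrite out'z in_setI nbrsC xy.
  + by rewrite !out'D //; apply: orD.
- move=> x; rewrite in_setU1 => /orP[/eqP ->|xD]; last first.
    have [T [xT TD rT dT sT]] := tD x xD; exists T; split=> //.
      exact: subset_trans TD (subsetUr _ _).
    by move=> y yT yx; rewrite !rk'D //; [apply: rT|apply: (subsetP TD)].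
  have /card_gt1P[a [b []]] := N2.
  rewrite !in_setI => /andP[az aD] /andP[bz bD] ab.
  have [Ta [aTa TaD _ da sa]] := tD a aD.
  have [Tb [bTb TbD _ db sb]] := tD b bD.
  have TD : Ta :|: Tb \subset D by rewrite subUset TaD.
  have sab := (leq_card_setU Ta Tb).1.
  have dab : deficient (1 + 1) (Ta :|: Tb).
    by apply: deficientU0; rewrite ?Tv //; clear -sa sb sab s0; lia.
  have := deficient_add (Tz _ TD) dab (tri _ _ _ _ aTa bTb az bz ab).
  rewrite cards2 ab => /(_ _ (leqnn _)) h.
  have dz : deficient 1 (z |: (Ta :|: Tb)) by rewrite /deficient; clear -h; lia.
  exists (z |: (Ta :|: Tb)); split=> //.
  + by rewrite !inE eqxx.
  + by rewrite setUS.
  + move=> y; rewrite in_setU1 => /orP[/eqP ->|yT _]; first by rewrite eqxx.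
    by rewrite rk'D ?(subsetP TD) // /rk' eqxx ltnS leq_bigmax.
  + have [|_] := ein_split (vzT _ TD) (zT0 (Ta :|: Tb)).
      by rewrite cardsU1; case: (_ \notin _); clear -sa sb sab s0; lia.
    by move=> /(_ dz)[].
Qed.

Lemma closure_exists : exists D out rk, closure_state D out rk /\
  forall z, z \notin D -> z != v -> #|nbr z :&: D| <= 1.
Proof.
suff H m D out rk : #|~: D| <= m -> closure_state D out rk ->
    exists D out rk, closure_state D out rk /\
      forall z, z \notin D -> z != v -> #|nbr z :&: D| <= 1.
  exact: H (leqnn _) closure_init.
elim: m D out rk => [|m IH] D out rk mD st.
  exists D, out, rk; split=> // z zD; move: mD; rewrite leqn0 cards_eq0 => /eqP D0.
  by move: zD; rewrite -in_setC D0 inE.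
have [/existsP[z /and3P[zD zv N2]]|no] :=
    boolP [exists z, [&& z \notin D, z != v & 1 < #|nbr z :&: D|]].
  have [out' [rk' st']] := closure_step st zD zv N2.
  apply: IH st'; rewrite -ltnS; apply: leq_trans mD; apply/proper_card.
  by rewrite setCU properE subsetIr subsetI subxx andbT /= -setCS !setCK sub1set zD.
exists D, out, rk; split=> // z zD zv; rewrite leqNgt; apply: contra no => N2.
by apply/existsP; exists z; rewrite zD zv.
Qed.

End Closure.

(** * Choosing a root that is harmless for Connector's first vertex *)

Section TrapExists.
Variables (V : finType) (G : {set {set V}}) (R : {set V}) (s : nat).
Hypothesis G2 : simple_graph G.
Hypothesis Gs : sparse G R s.
Local Notation ein := (edges_in G).
Local Notation ne := (edge_count G).
Local Notation nbr := (nbrs G).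

Section Root.
Variables (v : V) (D : {set V}) (out : V -> {set V}) (rk : V -> nat).
Hypothesis vR : v \in R.
Hypothesis st : closure_state G s v D out rk.

Lemma closure_tight z : z \in D -> exists T : {set V},
  [/\ z \in T, T \subset D, forall y, y \in T -> y != z -> rk y < rk z,
      3 * #|T| <= 2 * ne (v |: T) + 1 & #|T| < s /\ [disjoint T & R]].
Proof.
case: st => [[vD _] _ _ tD] /tD[T [zT TD rT dT sT]]; exists T; split=> //; split=> //.
have vT : v \notin T by apply: contra vD; apply: (subsetP TD).
have T0 : T != set0 by apply/set0Pn; exists z.
by have [|_ /(_ dT)[]] := ein_split Gs vR vT T0; first by clear -sT; lia.
Qed.

Definition trap_out (x : V) : {set V} :=
  if x \in D then out x else if x == v then set0 else nbr x :&: D.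

Lemma closure_trap :
  (forall z, z \notin D -> z != v -> #|nbr z :&: D| <= 1) -> trap G v trap_out.
Proof.
case: st => [[vD NvD] outP orD tD] maxD.
have vDP x : [set x; v] \in G -> x \in D.
  by move=> xv; apply: (subsetP NvD); rewrite inE setUC.
have tov x : [set x; v] \in G -> trap_out x = [set v].
  move=> xv; rewrite /trap_out vDP //; have [_ _] := outP x (vDP _ xv).
  by apply; rewrite inE setUC.
have orient x y : y \in D -> [set x; y] \in G -> x \in trap_out y \/ y \in trap_out x.
  move=> yD xy; have yx : y \in nbr x by rewrite inE.
  have [xD|xD] := boolP (x \in D).
    by rewrite /trap_out xD yD; case: (orD _ _ xD yD yx); [right|left].
  have [xv|xv] := eqVneq x v; first by left; rewrite xv in xy *; rewrite tov ?set11 // setUC.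
  by right; rewrite /trap_out (negPf xD) (negPf xv) inE yx.
split=> //.
- move=> x y; rewrite /trap_out; case: ifP => [xD|_].
    by have [/subsetP o _ _] := outP x xD => /o; rewrite !inE => /andP[].
  by case: eqP => _; rewrite !inE // => /andP[].
- move=> x; rewrite /trap_out; case: ifP => [xD|xD]; first by have [] := outP x xD.
  case: eqP => [_|/eqP xv]; first by rewrite cards0.
  by apply: leqW; rewrite maxD ?xD.
- move=> x y o2 xy; apply: orient xy; move: o2; rewrite /trap_out; case: ifP => // yD.
  case: eqP => [_|/eqP yv]; first by rewrite cards0.
  by have := maxD y (negbT yD) yv => h o2; rewrite o2 in h.
- move=> w x wv xw; case: (orient x w (vDP _ wv) xw); by [right|left].
Qed.

Lemma trap_out0 b : b \notin D -> [disjoint nbr b & D] -> trap_out b = set0.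
Proof.
by move=> bD nD; rewrite /trap_out (negPf bD); case: eqP => // _; apply: disjoint_setI0.
Qed.

(** If another root [b] had a neighbour [y] in [D], the edge [by] would turn the deficiency one of
    the certificate of [y] into an excess. *)
Lemma closure_root b : b \in R -> b != v -> b \notin D /\ [disjoint nbr b & D].
Proof.
move=> bR bv; have DR z : z \in D -> z \notin R.
  by move=> /closure_tight[T [zT _ _ _ [_ TR]]]; rewrite (disjointFr TR zT).
split; first by apply: contraL bR => /DR.
apply: disjoint_notin => y yb; apply/negP => yD.
have [T [yT TD _ dT [sT TR]]] := closure_tight yD.
have T0 : T != set0 by apply/set0Pn; exists y.
case: Gs => _ /(_ T TR T0) A _; have := A _; suff : ne (v |: T) + 1 <= ne (T :|: R).
  by move=> h /(_ _); clear -sT dT h => A; have := A ltac:(lia); lia.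
have bT : [set b; y] \notin ein (v |: T).
  rewrite inE negb_and; apply/orP; right; apply/subsetPn; exists b; first by rewrite !inE eqxx.
  by rewrite !inE negb_or bv (disjointFl TR bR).
rewrite addn1; apply: (@leq_trans #|[set b; y] |: ein (v |: T)|); first by rewrite cardsU1 bT.
apply/subset_leq_card; rewrite subUset sub1set edges_inS.
  by rewrite !inE subUset !sub1set !inE yT bR orbT !andbT; move: yb; rewrite inE.
by rewrite subUset sub1set inE vR orbT subsetUl.
Qed.

Lemma ne_small (X : {set V}) : #|X| <= 1 -> ne X = 0.
Proof.
move=> X1; apply/eqP; rewrite cards_eq0 -subset0; apply/subsetP => e; rewrite inE.
by move=> /andP[/G2 e2 /subset_leq_card]; rewrite e2 => /leq_trans/(_ X1).
Qed.

(* A tight set certifying the arc of [b] joins [H] to the root [v]; this lowers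
   the deficiency [c] by one. *)
Lemma blocked_grow (A H : {set V}) (c : nat) b :
  A \subset R -> v \notin A -> [disjoint H & R] -> b \in H ->
  ~~ ((b \notin D) && [disjoint nbr b & D]) ->
  3 * #|H| <= 2 * ne (A :|: H) + c ->
  exists H' : {set V}, [/\ H \subset H', [disjoint H' & R], #|H'| < #|H| + s
    & 3 * #|H'| + 1 <= 2 * ne ((v |: A) :|: H') + c].
Proof.
move=> AR vA HR bH blk dH; case: (st) => [[vD _] _ _ _].
have vH : v \notin H by rewrite (disjointFl HR vR).
have setE (T : {set V}) : (A :|: H) :|: (v |: T) = (v |: A) :|: (H :|: T).
  by apply/setP => x; rewrite !inE; do !case: (x \in _); rewrite ?orbT ?orbF.
have inter (T : {set V}) : T \subset D -> [disjoint T & R] ->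
    (A :|: H) :&: (v |: T) \subset H :&: T.
  move=> TD TR; apply/subsetP => x; rewrite !inE.
  have [->|_] := eqVneq x v; first by rewrite (negPf vA) (negPf vH).
  case/andP => /orP[/(subsetP AR) xR|->] //= xT; by rewrite (disjointFr TR xT) in xR.
have disjU (T : {set V}) : [disjoint T & R] -> [disjoint H :|: T & R].
  move=> TR; apply: disjoint_notin => x; rewrite inE => /orP[xH|xT].
    by rewrite (disjointFr HR xH).
  by rewrite (disjointFr TR xT).
have [/pred0Pn[x0 /= x0HD]|HD0] := boolP (~~ [disjoint H & D]).
  (* The other members of the certificate of [x] lie in [D] and have smaller rank, so by minimality
     the certificate meets [H] in [x] alone. *)
  pose x := [arg min_(x < x0 | (x \in H) && (x \in D)) rk x].
  have : (x \in H) && (x \in D) /\ forall y, y \in H -> y \in D -> rk x <= rk y.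
    rewrite /x; case: arg_minnP => // y yHD ymin; split=> // z zH zD.
    by apply: ymin; rewrite zH.
  case=> /andP[xH xD] xmin.
  have [T [xT TD rT dT [sT TR]]] := closure_tight xD.
  have HT : H :&: T = [set x].
    apply/setP => y; rewrite !inE; apply/andP/eqP => [[yH yT]|->] //.
    apply/eqP/negPn/negP => yx; have := rT y yT yx.
    by rewrite ltnNge xmin // (subsetP TD).
  have i0 : ne ((A :|: H) :&: (v |: T)) = 0.
    by apply: ne_small; rewrite (leq_trans (subset_leq_card (inter T TD TR))) // HT cards1.
  have := @edges_in_supermodular _ G (A :|: H) (v |: T) 0 set0 (sub0set _) (leq0n _).
  rewrite i0 setE => sm; have {}sm : ne (A :|: H) + ne (v |: T) + 0 <= ne (v |: A :|: (H :|: T)) + 0.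
    by apply: sm => e; rewrite inE.
  have := cardsUI H T; rewrite HT cards1 => cU.
  by exists (H :|: T); split; [exact: subsetUl|exact: disjU|clear -cU sT; lia|clear -cU sm dT dH; lia].
have bD : b \notin D by rewrite (disjointFr (negPn HD0) bH).
(* Now [H] misses [D] and hence the certificate of the neighbour [y] of [b]; the edge [by] serves as
   the crossing edge. *)
move: blk; rewrite bD /= => /pred0Pn[y /= /andP[yb yD]].
have [T [yT TD _ dT [sT TR]]] := closure_tight yD.
have HT : H :&: T = set0.
  apply: disjoint_setI0; apply: disjoint_notin => z zH; apply: contraFN (disjointFr (negPn HD0) zH).
  exact: (subsetP TD).
have i0 : ne ((A :|: H) :&: (v |: T)) = 0.
  by apply: ne_small; rewrite (leq_trans (subset_leq_card (inter T TD TR))) // HT cards0.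
have := @edges_in_supermodular _ G (A :|: H) (v |: T) 1 [set [set b; y]].
rewrite cards1 i0 setE sub1set => sm.
have {}sm : ne (A :|: H) + ne (v |: T) + 1 <= ne (v |: A :|: (H :|: T)) + 0.
  apply: sm => //.
    by move: yb; rewrite !inE subUset !sub1set !inE bH yT ?orbT => ->.
  move=> e /set1P ->; rewrite !subUset !sub1set !inE bH yT !orbT /= andbT.
  have -> : y \in H = false by apply: contraFF (in_set0 y) => yH; rewrite -HT inE yH.
  have -> : y \in A = false.
    by apply: contraFF (disjointFr TR yT); apply: (subsetP AR).
  have -> : b == v = false by apply: contraNF vH => /eqP <-.
  by rewrite /=; apply: contra bD; apply: (subsetP TD).
have := cardsUI H T; rewrite HT cards0 addn0 => cU.
by exists (H :|: T); split; [exact: subsetUl|exact: disjU|clear -cU sT; lia|clear -cU sm dT dH; lia].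
Qed.

End Root.

(** A single vertex [b] has deficiency three. If all three roots were blocked, gluing on three
    certificates would lower it to zero on a set of at most 1 + 3(s - 1) vertices, against [sparse];
    this explains the three roots and the size bound [3 * s]. If [b] is a root, any other root
    serves. *)
Lemma trap_exists r0 r1 r2 b : R = [set r0; r1; r2] ->
  r0 != r1 -> r0 != r2 -> r1 != r2 ->
  exists v out, [/\ b != v, trap G v out & out b = set0].
Proof.
move=> RE r01 r02 r12.
have [r0R r1R r2R] : [/\ r0 \in R, r1 \in R & r2 \in R] by rewrite RE !inE !eqxx !orbT.
have fin v D out rk : v \in R -> closure_state G s v D out rk ->
    (forall z, z \notin D -> z != v -> #|nbr z :&: D| <= 1) -> b != v ->
    (b \notin D) && [disjoint nbr b & D] ->
    exists v out, [/\ b != v, trap G v out & out b = set0].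
  move=> vR st maxD bv /andP[bD bn]; exists v, (trap_out v D out).
  by split; [|exact: (closure_trap st maxD)|exact: trap_out0].
have [D0 [o0 [k0 [st0 m0]]]] := closure_exists G2 Gs r0R.
have [D1 [o1 [k1 [st1 m1]]]] := closure_exists G2 Gs r1R.
have [D2 [o2 [k2 [st2 m2]]]] := closure_exists G2 Gs r2R.
have [bR|bR] := boolP (b \in R).
  have [br|br] := eqVneq b r0.
    have br1 : b != r1 by rewrite br.
    by apply: (fin _ _ _ _ r1R st1 m1 br1); have [-> ->] := closure_root r1R st1 bR br1.
  by apply: (fin _ _ _ _ r0R st0 m0 br); have [-> ->] := closure_root r0R st0 bR br.
have ne v : v \in R -> b != v by move=> vR; apply: contraNneq bR => ->.
have [|b0] := boolP ((b \notin D0) && [disjoint nbr b & D0]); first exact: fin st0 m0 (ne _ r0R).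
have [|b1] := boolP ((b \notin D1) && [disjoint nbr b & D1]); first exact: fin st1 m1 (ne _ r1R).
have [|b2] := boolP ((b \notin D2) && [disjoint nbr b & D2]); first exact: fin st2 m2 (ne _ r2R).
have [H0 [bH0 HR0 s0 d0]] := @blocked_grow _ _ _ _ r0R st0 set0 [set b] 3 b (sub0set _)
  (negbT (in_set0 _)) ltac:(by rewrite disjoints1) (set11 b) b0 ltac:(by rewrite cards1 leq_addl).
have [||||H1 [bH1 HR1 s1 d1]] := @blocked_grow _ _ _ _ r1R st1 (r0 |: set0) H0 2 b _ _ HR0 _ b1.
- by rewrite setU0 sub1set.
- by rewrite !inE orbF eq_sym.
- by apply: (subsetP bH0); rewrite inE.
- by clear -d0; lia.
have [||||H2 [bH2 HR2 s2 d2]] := @blocked_grow _ _ _ _ r2R st2 (r1 |: (r0 |: set0)) H1 1 b _ _ HR1 _ b2.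
- by rewrite setU0 subUset !sub1set r0R r1R.
- by rewrite !inE orbF negb_or eq_sym r12 eq_sym r02.
- by apply: (subsetP bH1); apply: (subsetP bH0); rewrite inE.
- by clear -d1; lia.
have s_gt := s_gt0 Gs; rewrite cards1 in s0.
have bH : b \in H2 by apply: (subsetP bH2); apply: (subsetP bH1); apply: (subsetP bH0); rewrite inE.
case: Gs => _ /(_ H2 HR2) A _; move: A d2.
have -> : r2 |: (r1 |: (r0 |: set0)) :|: H2 = H2 :|: R.
  rewrite RE; apply/setP => x; rewrite !inE.
  by case: (x == r0); case: (x == r1); case: (x == r2); case: (x \in H2).
move=> A d2; have H20 : H2 != set0 by apply/set0Pn; exists b.
have Hs : #|H2| <= 3 * s by clear -s0 s1 s2 s_gt; lia.
by have := A H20 Hs; clear -d2; lia.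
Qed.

End TrapExists.

(** * From traps to a win for Breaker *)

Lemma connector_edges_rcons n (h : history n) X Y :
  connector_edges (rcons h (X, Y)) = (connector_edges h :|: X)%SET.
Proof. by rewrite /connector_edges -cats1 big_cat big_seq1. Qed.

Lemma breaker_edges_rcons n (h : history n) X Y :
  breaker_edges (rcons h (X, Y)) = (breaker_edges h :|: Y)%SET.
Proof. by rewrite /breaker_edges -cats1 big_cat big_seq1. Qed.

Section BreakerInvariant.
Variables (n m b : nat) (G : edges n) (Inv : edges n -> edges n -> Prop).

Hypothesis Inv0 : Inv finset.set0 finset.set0.
Hypothesis InvS : forall CE BE X : edges n, Inv CE BE -> X \subset G :\: (CE :|: BE) ->
  #|X| <= m -> edges_connected (CE :|: X) ->
  exists Y : edges n, [/\ Y \subset G :\: (CE :|: BE) :\: X, #|Y| <= b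
                  & Inv (CE :|: X) (BE :|: Y)].
Hypothesis InvN : forall CE BE, Inv CE BE ->
  forall T : edges n, T \subset CE -> ~ spanning_tree G T.

(** The replies are chosen along the history. Claiming nothing by default makes them legal
    unconditionally, so [win] applies and yields the legality of Connector's moves, from which the
    invariant is then derived. *)
Lemma breaker_invariant : ~ connector_wins m b G.
Proof.
case=> s win.
pose good h Y := breaker_legal b G h (s h) Y /\
  Inv (connector_edges h :|: s h) (breaker_edges h :|: Y).
pose resp h : edges n := if pselect (exists Y, good h Y) is left e then projT1 (cid e) else finset.set0.
have resp_good h : (exists Y, good h Y) -> good h (resp h).
  by rewrite /resp; case: pselect => // e _; exact: (projT2 (cid e)).
have resp_legal h : breaker_legal b G h (s h) (resp h).
  rewrite /resp; case: pselect => [e|_]; first by case: (projT2 (cid e)).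
  by split; rewrite ?finset.sub0set ?cards0.
pose fix H k := if k is i.+1 then rcons (H i) (s (H i), resp (H i)) else [::].
pose B i := resp (H i).
have playE k : play s B k = H k by elim: k => //= k ->.
have [|legal [k [T spT TC]]] := win B.
  by move=> i; rewrite playE; apply: resp_legal.
have inv i : Inv (connector_edges (H i)) (breaker_edges (H i)).
  elim: i => [|i IH]; first by rewrite /connector_edges /breaker_edges !big_nil.
  have [|_] := resp_good (H i); last by rewrite connector_edges_rcons breaker_edges_rcons.
  have := legal i; rewrite playE => -[sG sm sc].
  have [Y [YG Yb YI]] := InvS IH sG sm sc.
  by exists Y; split.
by rewrite playE in TC; exact: (InvN (inv k) TC spT).
Qed.

End BreakerInvariant.

Lemma connected_closed n (F : edges n) (W : {set 'I_n}) x y :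
  edges_connected F -> (forall e, e \in F -> e \subset W \/ [disjoint e & W]) ->
  x \in finset.cover F -> x \in W -> y \in finset.cover F -> y \in W.
Proof.
move=> Fc FW xF xW yF; have /connectP[p] := Fc x y xF yF.
elim: p x xW {xF} => [|z p IH] x xW /= => [_ ->|/andP[xz pz] yl] //.
apply: IH pz yl; case: (FW _ xz); first by move/subsetP; apply; rewrite !inE eqxx orbT.
by move=> d; have := disjointFr d (finset.set21 x z); rewrite xW.
Qed.

Section BreakerTrap.
Variables (n : nat) (G : edges n).
Hypothesis G2 : simple_graph G.

Lemma cover_edgesU (E F : edges n) : finset.cover (E :|: F) = finset.cover E :|: finset.cover F.
Proof. exact: finset.bigcup_setU. Qed.

Lemma cover_set2 (a b : {set 'I_n}) : finset.cover [set a; b]%SET = a :|: b.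
Proof. by rewrite cover_edgesU /finset.cover !finset.big_set1. Qed.

Lemma edge_neq0 e : e \in G -> exists x, x \in e.
Proof. by move=> /G2 e2; apply/finset.set0Pn; rewrite -card_gt0 e2. Qed.

Lemma mem_cover (E : edges n) e x : e \in E -> x \in e -> x \in finset.cover E.
Proof. by move=> eE xe; apply/finset.bigcupP; exists e. Qed.

Lemma small_pair (X : edges n) : X != finset.set0 -> #|X| <= 2 -> exists a b, X = [set a; b]%SET.
Proof.
rewrite -card_gt0 => X0; rewrite leq_eqVlt => /orP[/cards2P[a [b [_ ->]]]|]; first by exists a, b.
rewrite ltnS => X1; have /cards1P[a ->] : #|X| == 1 by rewrite eqn_leq X1.
by exists a, a; rewrite finset.setUid.
Qed.

(** Connectedness is given for the whole move only. A vertex set that no edge leaves contains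
    everything connected to it, so some edge of [X] touches the old tree, and the other one touches
    the result. *)
Lemma ordered_turn (CE X : edges n) :
  CE :|: X \subset G -> CE != finset.set0 -> X != finset.set0 -> #|X| <= 2 ->
  edges_connected (CE :|: X) ->
  exists e1 e2, [/\ X = [set e1; e2]%SET, ~~ [disjoint e1 & finset.cover CE]
    & ~~ [disjoint e2 & finset.cover CE :|: e1]].
Proof.
move=> sG CE0 X0 X2 con.
have [a [b XE]] := small_pair X0 X2.
suff main e1 e2 : X = [set e1; e2]%SET -> ~~ [disjoint e1 & finset.cover CE] ->
    ~~ [disjoint e2 & finset.cover CE :|: e1].
  have [a0|a0] := boolP [disjoint a & finset.cover CE]; last first.
    by exists a, b; split=> //; apply: main.
  have [b0|b0] := boolP [disjoint b & finset.cover CE]; last first.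
    by have XE' : X = [set b; a]%SET; [rewrite XE finset.setUC|exists b, a; split=> //; apply: main].
  case/finset.set0Pn: CE0 => e eCE.
  have eG : e \in G by apply: (subsetP sG); rewrite inE eCE.
  have aG : a \in G by apply: (subsetP sG); rewrite !inE XE !inE eqxx orbT.
  have [x xe] := edge_neq0 eG; have [y ya] := edge_neq0 aG.
  suff : y \in (finset.cover CE) by rewrite (disjointFr a0 ya).
  apply: (@connected_closed _ _ (finset.cover CE) x y con).
  - move=> f; rewrite inE => /orP[fC|]; last by rewrite XE !inE => /orP[] /eqP ->; right.
    by left; apply: (bigcup_sup f).
  - by rewrite cover_edgesU inE (mem_cover eCE xe).
  - exact: mem_cover eCE xe.
  - by rewrite cover_edgesU inE XE cover_set2 !inE ya orbT.
move=> {}XE e1C; apply/negP => d.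
have e2G : e2 \in G by apply: (subsetP sG); rewrite !inE XE !inE eqxx !orbT.
have [y ye] := edge_neq0 e2G.
case/pred0Pn: e1C => x /= /andP[xe xC].
suff : y \in (finset.cover CE :|: e1) by rewrite (disjointFr d ye).
  apply: (@connected_closed _ _ (finset.cover CE :|: e1) x y con).
- move=> f; rewrite inE => /orP[fC|].
    by left; apply: subset_trans (subsetUl _ _); apply: (bigcup_sup f).
  by rewrite XE !inE => /orP[] /eqP ->; [left; apply: subsetUr|right].
- by rewrite cover_edgesU inE xC.
- by rewrite inE xC.
- by rewrite cover_edgesU inE XE cover_set2 !inE ye !orbT.
Qed.

Lemma first_turn (X : edges n) : X \subset G -> X != finset.set0 -> #|X| <= 2 ->
  edges_connected X -> exists b e1 e2, [/\ X = [set e1; e2]%SET, b \in e1 & b \in e2].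
Proof.
move=> sG X0 X2 con; have [e1 [e2 XE]] := small_pair X0 X2.
have e1X : e1 \in X by rewrite XE !inE eqxx.
have e2X : e2 \in X by rewrite XE !inE eqxx orbT.
have [d|] := boolP [disjoint e2 & e1]; last first.
  by case/pred0Pn => b /= /andP[b2 b1]; exists b, e1, e2.
have [x xe] := edge_neq0 (subsetP sG _ e1X); have [y ye] := edge_neq0 (subsetP sG _ e2X).
suff : y \in e1 by rewrite (disjointFr d ye).
  apply: (@connected_closed _ _ e1 x y con).
- by move=> f; rewrite XE !inE => /orP[] /eqP ->; [left|right].
- exact: mem_cover e1X xe.
- exact: xe.
- exact: mem_cover e2X ye.
Qed.

(** The invariant from Connector's first nonempty move on. Before it no root is fixed, since the
    root depends on her first vertex. *)
Definition trapped (CE BE : edges n) : Prop := exists v out,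
  [/\ trap G v out, CE != finset.set0, CE :|: BE \subset G, v \notin finset.cover CE
    & debt out (finset.cover CE) (CE :|: BE) = finset.set0].

(** [C] is separate from [finset.cover CE] because on the first turn no edge is claimed yet and [C]
    is one vertex common to her edges. Breaker claims the edges of the entire debt. *)
Lemma trapped_turn v out (C : {set 'I_n}) (CE BE X : edges n) e1 e2 :
  trap G v out -> CE :|: BE \subset G -> v \notin C ->
  debt out C (CE :|: BE) = finset.set0 -> X = [set e1; e2]%SET ->
  X \subset G :\: (CE :|: BE) ->
  ~~ [disjoint e1 & C] -> ~~ [disjoint e2 & C :|: e1] ->
  finset.cover (CE :|: X) = C :|: e1 :|: e2 ->
  exists Y : edges n, [/\ Y \subset G :\: (CE :|: BE) :\: X, #|Y| <= 2
                  & trapped (CE :|: X) (BE :|: Y)].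
Proof.
move=> tr sG vC d0 XE XG e1C e2C cE; set F := CE :|: BE.
have XFG : [set e1; e2]%SET :|: F \subset G.
  by rewrite finset.subUset sG -XE (subset_trans XG) // finset.subsetDl.
have e1G : e1 \in G :\: F by apply: (subsetP XG); rewrite XE !inE eqxx.
have e2G : e2 \in G :\: F by apply: (subsetP XG); rewrite XE !inE eqxx orbT.
have [vC' D2] := trap_turn G2 tr vC d0 e1G e2G e1C e2C.
rewrite -XE in D2; set D := debt _ _ _ in D2.
pose Y : edges n := [set [set a.1; a.2]%SET | a in D]%SET.
have YG : Y \subset G :\: F :\: X.
  apply/subsetP => _ /imsetP[[x y] + ->].
  rewrite !inE => /and3P[_ /= yx]; rewrite !negb_or => /and3P[-> -> ->].
  by case: tr => /(_ _ _ yx) ->.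
have E : CE :|: X :|: (BE :|: Y) = Y :|: (X :|: F).
  by apply/finset.setP => e; rewrite !inE; do !case: (e \in _).
exists Y; split=> //; first exact: leq_trans (leq_imset_card _ _) D2.
exists v, out; split=> //.
- by apply/finset.set0Pn; exists e1; rewrite !inE XE !inE eqxx orbT.
- rewrite E finset.subUset XE XFG andbT; apply: subset_trans YG _.
  by rewrite (subset_trans (finset.subsetDl _ _)) // finset.subsetDl.
- by rewrite cE.
rewrite cE E; apply/finset.setP => -[x y]; rewrite !inE /=; apply/negP.
case/and3P=> xC yx; rewrite !negb_or => /and4P[xyY xyX xyC xyB]; move/negP: xyY; apply.
apply/imsetP; exists (x, y) => //; rewrite !inE /= in xC *.
by rewrite xC yx !negb_or xyX xyC.
Qed.

Lemma trap_breaker_wins : 0 < n ->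
  (forall b, exists v out, [/\ b != v, trap G v out & out b = finset.set0]) ->
  ~ connector_wins 2 2 G.
Proof.
move=> n0 traps.
apply: (@breaker_invariant _ _ _ _ (fun CE BE =>
   (CE = finset.set0 /\ BE = finset.set0) \/ trapped CE BE)); first by left.
- move=> CE BE X [[-> ->]|[v [out [tr CE0 sG vC d0]]]] XG X2.
    rewrite finset.setU0 finset.set0U in XG *; rewrite finset.setD0 in XG * => con.
    have [X0|X0] := eqVneq X finset.set0.
      exists finset.set0; rewrite X0; split; rewrite ?finset.sub0set ?cards0 //.
      by left; rewrite finset.setU0.
    have [b [e1 [e2 [XE b1 b2]]]] := first_turn XG X0 X2 con.
    have [v [out [bv tr ob]]] := traps b.
    have := @trapped_turn v out [set b]%SET finset.set0 finset.set0 X e1 e2 tr.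
    rewrite !finset.set0U finset.setD0 finset.sub0set inE eq_sym bv; case=> //.
    + by apply/finset.setP => -[x y]; rewrite !inE; case: eqP => //= ->; rewrite ob inE.
    + by apply/pred0Pn; exists b; rewrite /= b1 inE eqxx.
    + by apply/pred0Pn; exists b; rewrite /= b2 !inE eqxx.
    + rewrite XE cover_set2; apply/finset.setP => x; rewrite !inE.
      by case: eqP => // ->; rewrite b1.
    + by move=> Y [? ? ?]; exists Y; split=> //; right.
  move=> con; have [X0|X0] := eqVneq X finset.set0.
    exists finset.set0; rewrite X0; split; rewrite ?finset.sub0set ?cards0 //.
    by right; exists v, out; rewrite !finset.setU0; split.
  have CXG : CE :|: X \subset G.
    rewrite finset.subUset (subset_trans (finset.subsetUl _ _) sG).
    exact: subset_trans XG (finset.subsetDl _ _).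
  have [e1 [e2 [XE e1C e2C]]] := ordered_turn CXG CE0 X0 X2 con.
  have [|Y [? ? ?]] := trapped_turn tr sG vC d0 XE XG e1C e2C.
    by rewrite cover_edgesU XE cover_set2 finset.setUA.
  by exists Y; split=> //; right.
have iso (T : edges n) (v w : 'I_n) : v \notin finset.cover T -> v != w -> ~ spanning_tree G T.
  move=> vT vw [_ con _]; have /connectP[[|z p]] := con v w; first by move=> _ /= wv; rewrite wv eqxx in vw.
  case/andP => vz _ _; case/negP: vT; apply: (mem_cover vz).
  by rewrite !inE eqxx.
move=> CE BE [[-> _]|[v [out [_ CE0 sG vC _]]]] T TC.
  have [v [_ [bv _ _]]] := traps (Ordinal n0); apply: (iso T (Ordinal n0) v) bv.
  by move: TC; rewrite finset.subset0 => /eqP ->; rewrite /finset.cover big_set0 inE.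
case/finset.set0Pn: CE0 => e eCE.
have eG : e \in G by apply: (subsetP sG); rewrite inE eCE.
have [w we] := edge_neq0 eG.
apply: (iso T v w).
  apply: contra vC => /finset.bigcupP[f fT vf]; exact: mem_cover (subsetP TC _ fT) vf.
by apply: contraNneq vC => ->; exact: mem_cover eCE we.
Qed.

End BreakerTrap.

(** * The game on vertex sets and binary trees of threats *)

Section VertexGame.
Variables (V : finType) (G : {set {set V}}).

Definition vertex_step (BE : {set {set V}}) (C C' : {set V}) : Prop :=
  C' = C \/ exists x y, [/\ x \in C, y \notin C, [set x; y] \in G :\: BE & C' = y |: C].

(* The game seen from the vertex set [C] of Connector's tree: she adds at most
   two vertices per round, and Breaker then claims at most two edges, which may
   even be edges already claimed.  [forces r Q] : she can reach [Q] within [r] rounds. *)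
Fixpoint forces (r : nat) (Q : {set V} -> {set {set V}} -> Prop)
    (C : {set V}) (BE : {set {set V}}) : Prop :=
  if r is r'.+1 then
    Q C BE \/ exists C1 C2, [/\ vertex_step BE C C1, vertex_step BE C1 C2
      & forall Y : {set {set V}}, Y \subset G -> #|Y| <= 2 -> forces r' Q C2 (BE :|: Y)]
  else Q C BE.

Lemma forces_now r Q C BE : Q C BE -> forces r Q C BE.
Proof. by case: r => //= r QC; left. Qed.

Lemma forces_leq r r' Q C BE : r <= r' -> forces r Q C BE -> forces r' Q C BE.
Proof.
elim: r r' C BE => [|r IH] [|r'] C BE //= rr'; first by left.
case=> [QC|[C1 [C2 [s1 s2 nxt]]]]; [by left|right].
by exists C1, C2; split=> // Y YG Y2; apply: IH => //; apply: nxt.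
Qed.

Lemma forces_trans r r' Q Q' C BE : forces r Q C BE ->
  (forall C' BE', Q C' BE' -> forces r' Q' C' BE') -> forces (r + r') Q' C BE.
Proof.
move=> + QQ; elim: r C BE => [|r IH] C BE /=; first exact: QQ.
case=> [QC|[C1 [C2 [s1 s2 nxt]]]].
  exact: forces_leq (leq_addl r.+1 r') (QQ _ _ QC).
by right; exists C1, C2; split=> // Y YG Y2; apply/IH/nxt.
Qed.

Lemma vertex_stepS BE C C' : vertex_step BE C C' -> C \subset C'.
Proof. by case=> [->|[x [y [_ _ _ ->]]]]; rewrite ?subsetUr. Qed.

Lemma forces_grow r Q C BE : forces r Q C BE ->
  forces r (fun C' BE' => [/\ Q C' BE', C \subset C' & exists2 Z : {set {set V}},
    Z \subset G /\ #|Z| <= 2 * r & BE' = BE :|: Z]) C BE.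
Proof.
have now r' C0 BE0 : Q C0 BE0 -> [/\ Q C0 BE0, C0 \subset C0 & exists2 Z : {set {set V}},
    Z \subset G /\ #|Z| <= 2 * r' & BE0 = BE0 :|: Z].
  by move=> QC; split=> //; exists set0; rewrite ?setU0 // sub0set cards0.
elim: r C BE => [|r IH] C BE /=; first exact: now.
case=> [QC|[C1 [C2 [s1 s2 nxt]]]]; first by left; apply: now.
right; exists C1, C2; split=> // Y YG Y2.
have /forces_trans := IH _ _ (nxt Y YG Y2).
rewrite -[X in forces X _ _ _]addn0; apply => C' BE' [QC sC [Z [ZG Zr] E]].
apply: forces_now; split=> //.
  by apply: subset_trans sC; apply: subset_trans (vertex_stepS s1) (vertex_stepS s2).
exists (Y :|: Z); last by rewrite E setUA.
rewrite subUset YG ZG; split=> //.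
by rewrite mulnS (leq_trans (leq_card_setU _ _).1) // leq_add.
Qed.

(** * Binary trees as threats *)

Section Pending.
Variable v : V.

(* [btree BE d S a] : inside [S], a binary tree of depth at most [d] rooted at [a]
   consists of edges not in [BE], and so do the edges joining its leaves to [v]. *)
Fixpoint btree (BE : {set {set V}}) (d : nat) (S : {set V}) (a : V) : Prop :=
  a \in S /\ ([set a; v] \in G :\: BE \/
  if d is d'.+1 then
    exists (S1 S2 : {set V}) a1 a2, [/\ S1 \subset S :\ a /\ S2 \subset S :\ a, [disjoint S1 & S2],
      [set a; a1] \in G :\: BE /\ [set a; a2] \in G :\: BE,
      btree BE d' S1 a1 & btree BE d' S2 a2]
  else False).

Definition pending (C : {set V}) BE d (p : {set V} * V) : Prop :=
  [/\ exists2 x, x \in C & [set x; p.2] \in G :\: BE,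
      [disjoint p.1 & C], v \notin p.1 & btree BE d p.1 p.2].

(** It contains every edge on which a pending tree in [S] relies: tree edges, edges from leaves to
    [v], and the edge from [C] to the root. All of these meet [S], so disjoint regions avoiding [C]
    and [v] have disjoint zones and one Breaker edge ruins at most one tree. *)
Definition zone (C S : {set V}) : {set {set V}} :=
  [set e : {set V} | (e \subset v |: (S :|: C)) && ~~ [disjoint e & S]].

Lemma btree_root BE d S a : btree BE d S a -> a \in S.
Proof. by case: d => [|d] []. Qed.

Lemma zone_edge (C S : {set V}) x y : x \in v |: (S :|: C) -> y \in S -> [set x; y] \in zone C S.
Proof.
move=> xS yS; rewrite inE subUset !sub1set xS !inE yS orbT /=.
by apply/pred0Pn; exists y; rewrite /= !inE eqxx orbT.
Qed.

Lemma zoneS (C S S' : {set V}) : S' \subset S -> zone C S' \subset zone C S.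
Proof.
move=> SS; apply/subsetP => e; rewrite !inE => /andP[eS' eS]; apply/andP; split.
  by apply: subset_trans eS' _; rewrite setUS // setSU.
by apply: contra eS; apply: disjointWr.
Qed.

Lemma free_zone (C S : {set V}) (BE Y : {set {set V}}) (e : {set V}) : e \in zone C S -> [disjoint Y & zone C S] ->
  e \in G :\: BE -> e \in G :\: (BE :|: Y).
Proof.
move=> ez d; rewrite !inE negb_or => /andP[-> ->]; rewrite andbT /=.
by apply: contraL ez => eY; rewrite (disjointFr d eY).
Qed.

Lemma btree_zone (C : {set V}) (BE Y : {set {set V}}) d (S : {set V}) a : [disjoint Y & zone C S] ->
  btree BE d S a -> btree (BE :|: Y) d S a.
Proof.
elim: d S a => [|d IH] S a dY /= [aS].
  case=> // av; split=> //; left; apply: free_zone dY av.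
  by rewrite setUC zone_edge // !inE eqxx.
move=> H; split=> //; case: H => [av|[S1 [S2 [a1 [a2 [[s1 s2] d12 [e1 e2] t1 t2]]]]]]; [left|right].
  by apply: free_zone dY av; rewrite setUC zone_edge // !inE eqxx.
have ss1 : S1 \subset S by apply: subset_trans s1 (subsetDl _ _).
have ss2 : S2 \subset S by apply: subset_trans s2 (subsetDl _ _).
exists S1, S2, a1, a2; split=> //.
- by split; apply: (free_zone _ dY) => //; apply: zone_edge; rewrite ?inE ?aS ?orbT //;
    [apply: (subsetP ss1)|apply: (subsetP ss2)]; apply: btree_root; eassumption.
- by apply: IH t1; apply: disjointWr dY; apply: zoneS.
- by apply: IH t2; apply: disjointWr dY; apply: zoneS.
Qed.

Lemma pending_zone (C : {set V}) (BE Y : {set {set V}}) d p : [disjoint Y & zone C p.1] ->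
  pending C BE d p -> pending C (BE :|: Y) d p.
Proof.
move=> dY [[x xC xp] pC vp t]; split=> //; last exact: btree_zone dY t.
exists x => //; apply: free_zone dY xp; apply: zone_edge (btree_root t).
by rewrite !inE xC !orbT.
Qed.

Lemma zone_disjoint (C S S' : {set V}) : [disjoint S & S'] -> [disjoint S & C] -> v \notin S ->
  [disjoint zone C S & zone C S'].
Proof.
move=> SS SC vS; apply: disjoint_notin => e; rewrite !inE => /andP[_ /pred0Pn[x /= /andP[xe xS]]].
apply/negP => /andP[/subsetP/(_ x xe)]; rewrite !inE.
by rewrite (disjointFr SS xS) (disjointFr SC xS) => /orP[/eqP xv|//]; rewrite -xv xS in vS.
Qed.

Lemma two_survivors C BE d (s : seq ({set V} * V)) (Y : {set {set V}}) :
  pairwise (fun p q : {set V} * V => [disjoint p.1 & q.1]) s -> 4 <= size s -> #|Y| <= 2 ->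
  (forall p, p \in s -> pending C BE d p) ->
  exists p q : {set V} * V, [/\ [disjoint p.1 & q.1], pending C (BE :|: Y) d p & pending C (BE :|: Y) d q].
Proof.
move=> ds s4 Y2 pend.
pose alive (p : {set V} * V) := [disjoint Y & zone C p.1].
have cnt : count (predC alive) s <= 2.
  apply: leq_trans Y2; have := @count_meeting _ [seq zone C p.1 | p <- s] Y.
  rewrite count_map pairwise_map; apply.
  apply: (@sub_in_pairwise _ [in s] _ _ _ s) ds; last exact/allP.
  by move=> p q /pend[_ pC vp _] _ /= dpq; exact: zone_disjoint.
have := count_predC alive s; rewrite -size_filter.
case E: (filter alive s) => [|p [|q t]] /=; try by move=> h; exfalso; clear -h s4 cnt; lia.
move=> _; have := pairwise_filter alive ds; rewrite E /= => /andP[/andP[dpq _] _].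
have al r : r \in p :: q :: t -> pending C (BE :|: Y) d r.
  by rewrite -E mem_filter => /andP[ar rs]; apply: pending_zone ar (pend _ rs).
by exists p, q; split=> //; apply: al; rewrite !inE eqxx ?orbT.
Qed.

Definition reached (C : {set V}) (BE : {set {set V}}) : Prop := v \in C.

Lemma leaf_wins r (C : {set V}) BE d p : v \notin C -> pending C BE d p -> [set p.2; v] \in G :\: BE ->
  forces r.+1 reached C BE.
Proof.
move=> vC [[x xC xp] pC vp t] pv; right; have pS := btree_root t.
have pnC : p.2 \notin C by rewrite (disjointFr pC pS).
exists (p.2 |: C), (v |: (p.2 |: C)); split.
- by right; exists x, p.2.
- right; exists p.2, v; split; rewrite // !inE ?eqxx // negb_or vC andbT.
  by apply: contraNneq vp => ->.
- by move=> Y _ _; apply: forces_now; rewrite /reached !inE eqxx.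
Qed.

(** In one turn Connector steps onto both roots and makes four subtrees pending. Breaker ruins at
    most two, which leaves two disjoint trees of smaller depth. A root with a free edge to [v] wins
    at once, as two steps fit into one turn. *)
Lemma two_pending d (C : {set V}) BE (p q : {set V} * V) : v \notin C -> [disjoint p.1 & q.1] ->
  pending C BE d p -> pending C BE d q -> forces d.+1 reached C BE.
Proof.
elim: d C BE p q => [|d IH] C BE p q vC dpq pp pq.
  by have [_ _ _ [_ [pv|//]]] := pp; apply: leaf_wins pp pv.
have [_ _ _ [pS [pv|]]] := pp; first exact: leaf_wins pp pv.
case=> [S1 [S2 [a1 [a2 [[s1 s2] d12 [e1 e2] t1 t2]]]]].
have [_ _ _ [qS [qv|]]] := pq; first exact: leaf_wins pq qv.
case=> [S3 [S4 [a3 [a4 [[s3 s4] d34 [e3 e4] t3 t4]]]]].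
have [[x xC xp] pC vp _] := pp; have [[y yC yq] qC vq _] := pq.
have pnC : p.2 \notin C by rewrite (disjointFr pC pS).
have qnC : q.2 \notin C by rewrite (disjointFr qC qS).
have qnp : q.2 \notin p.1 by rewrite (disjointFl dpq qS).
have pnq : p.2 \notin q.1 by rewrite (disjointFr dpq pS).
right; exists (p.2 |: C), (q.2 |: (p.2 |: C)); split.
- by right; exists x, p.2.
- right; exists y, q.2; split; rewrite // !inE ?yC ?orbT // negb_or qnC andbT.
  by apply: contraNneq qnp => ->.
move=> Y YG Y2; set C2 := q.2 |: (p.2 |: C).
have vC2 : v \notin C2.
  rewrite !inE !negb_or vC andbT; apply/andP; split.
    by apply: contraNneq vq => ->.
  by apply: contraNneq vp => ->.
have pnd u (S T : {set V}) a : S \subset T :\ u -> [disjoint T & C] -> v \notin T -> u \in C2 ->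
    (forall z, z \in C2 -> z \in T -> z = u) -> btree BE d S a ->
    [set u; a] \in G :\: BE -> pending C2 BE d (S, a).
  move=> ST TC vT uC TC2 t ua; split=> //=.
  - by exists u.
  - apply: disjoint_notin => z zS; apply/negP => zC2.
    by have /setD1P[zu zT] := subsetP ST _ zS; rewrite (TC2 _ zC2 zT) eqxx in zu.
  - by apply: contra vT => /(subsetP ST); rewrite inE => /andP[].
have onlyp z : z \in C2 -> z \in p.1 -> z = p.2.
  rewrite !inE => /or3P[/eqP ->|/eqP -> //|zC] zp; first by rewrite zp in qnp.
  by rewrite (disjointFr pC zp) in zC.
have onlyq z : z \in C2 -> z \in q.1 -> z = q.2.
  rewrite !inE => /or3P[/eqP -> //|/eqP ->|zC] zq; first by rewrite zq in pnq.
  by rewrite (disjointFr qC zq) in zC.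
have pC2 : p.2 \in C2 by rewrite !inE eqxx orbT.
have qC2 : q.2 \in C2 by rewrite !inE eqxx.
have P1 := pnd _ _ _ _ s1 pC vp pC2 onlyp t1 e1.
have P2 := pnd _ _ _ _ s2 pC vp pC2 onlyp t2 e2.
have P3 := pnd _ _ _ _ s3 qC vq qC2 onlyq t3 e3.
have P4 := pnd _ _ _ _ s4 qC vq qC2 onlyq t4 e4.
have dd (S T : {set V}) : S \subset p.1 :\ p.2 -> T \subset q.1 :\ q.2 -> [disjoint S & T].
  move=> /subsetP Sp /subsetP Tq; apply: disjointW dpq; apply/subsetP => z.
    by move=> /Sp/setD1P[].
  by move=> /Tq/setD1P[].
have [||||p' [q' [d' pp' pq']]] :=
    @two_survivors C2 BE d [:: (S1, a1); (S2, a2); (S3, a3); (S4, a4)] Y.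
- by rewrite /= d12 d34 !dd.
- by [].
- by [].
- by move=> r; rewrite !inE => /or4P[] /eqP ->.
exact: IH vC2 d' pp' pq'.
Qed.

End Pending.
End VertexGame.

(** * Expanding graphs: one phase of Connector's strategy *)

Section FiniteSets.
Variable T : finType.

Lemma subset_of_card (A : {set T}) k : k <= #|A| -> exists2 B : {set T}, B \subset A & #|B| = k.
Proof.
move=> kA; exists [set x in take k (enum A)].
  by apply/subsetP => x; rewrite inE => /mem_take; rewrite mem_enum.
rewrite cardsE; have /card_uniqP -> : uniq (take k (enum A)) by rewrite take_uniq // enum_uniq.
by rewrite size_takel // -cardE.
Qed.

Lemma card_bigcup (I : finType) (P : pred I) (F : I -> {set T}) :
  #|\bigcup_(i | P i) F i| <= \sum_(i | P i) #|F i|.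
Proof.
elim/big_rec2: _ => [|i m A _ IH]; first by rewrite cards0.
by rewrite (leq_trans (leq_card_setU _ _).1) // leq_add2l.
Qed.

Lemma card_disjoint_pieces (A : {set T}) N k : N * k <= #|A| ->
  exists s : seq {set T}, [/\ size s = N, pairwise (fun B C : {set T} => [disjoint B & C]) s
    & forall B, B \in s -> B \subset A /\ #|B| = k].
Proof.
elim: N A => [|N IH] A NA; first by exists [::].
have [|B BA Bk] := @subset_of_card A k; first by rewrite (leq_trans _ NA) // leq_pmull.
have [|s [sN ds sA]] := IH (A :\: B).
  by rewrite cardsDS // Bk; move: NA; rewrite mulSn; clear; lia.
exists (B :: s); split=> /=; first by rewrite sN.
  rewrite ds andbT; apply/allP => D /sA[DA _].
  by rewrite disjoint_sym; apply: disjointWl DA _; apply: disjoint_notin => x /setDP[].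
move=> D; rewrite inE => /orP[/eqP ->//|/sA[DA Dk]]; split=> //.
by apply: subset_trans DA (subsetDl _ _).
Qed.

End FiniteSets.

Section Expansion.
Variables (V : finType) (G : {set {set V}}).
Local Notation nbr := (nbrs G).

Definition boundary (S : {set V}) : {set V} :=
  [set y | (y \notin S) && ~~ [disjoint nbr y & S]].

Definition common_nbrs (A B : {set V}) : {set V} :=
  [set y | [&& y \notin A :|: B, ~~ [disjoint nbr y & A] & ~~ [disjoint nbr y & B]]].

(** For n about q^(6J) and p = q^-(4J-2) one expects about q^(2J+4j+4) common neighbours and a
    boundary of about |S| q^(2J+2); both demands leave at least one factor [q] to spare. The sets of
    the last clause exceed 1/p by a factor [q]. *)
Definition expanding (q J : nat) : Prop :=
  [/\ forall j (A B : {set V}), j < J -> [disjoint A & B] ->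
        #|A| = q ^ (2 * J + 2 * j) -> #|B| = q ^ (2 * J + 2 * j) ->
        q ^ (2 * J + 2 * j + 3) <= #|common_nbrs A B|,
      forall S : {set V}, 0 < #|S| <= q ^ (2 * J) -> #|S| * q ^ (2 * J + 1) <= #|boundary S|
    & forall A B : {set V}, [disjoint A & B] -> #|A| = q ^ (4 * J).-1 -> #|B| = q ^ (4 * J).-1 ->
        ~~ [disjoint boundary A & B]].

(* Splitting [A] into [r + 1] pieces of size [h] shows that few vertices have at
   most [r] neighbours in [A]. *)
Lemma few_low_degree h r (A X : {set V}) : 0 < h ->
  (forall B D : {set V}, [disjoint B & D] -> #|B| = h -> #|D| = h -> ~~ [disjoint boundary B & D]) ->
  [disjoint A & X] -> r.+1 * h <= #|A| ->
  #|[set x in X | #|nbr x :&: A| <= r]| < r.+1 * h.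
Proof.
move=> h0 hole dAX /card_disjoint_pieces[s [sr ds sA]].
pose miss (B : {set V}) := [set x in X | [disjoint nbr x & B]].
have lt B : B \in s -> #|miss B| < h.
  move=> /sA[BA Bh]; rewrite ltnNge; apply/negP => /subset_of_card[D /subsetP DX Dh].
  have dBD : [disjoint B & D].
    rewrite disjoint_sym; apply: disjoint_notin => x /DX; rewrite inE => /andP[xX _].
    by apply/negP => /(subsetP BA) xA; rewrite (disjointFr dAX xA) in xX.
  have /pred0Pn[x /= /andP[]] := hole B D dBD Bh Dh.
  by rewrite inE => /andP[_ +] /DX; rewrite inE => /negPf -> /andP[].
suff sub : [set x in X | #|nbr x :&: A| <= r] \subset \bigcup_(i < size s) miss (nth set0 s i).
  apply: leq_ltn_trans (subset_leq_card sub) _.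
  apply: leq_ltn_trans (card_bigcup _ _) _.
  apply: (@leq_ltn_trans (\sum_(i < size s) h.-1)).
    apply: leq_sum => i _; rewrite -ltnS prednK //; apply: lt; exact: mem_nth.
  by rewrite sum_nat_const card_ord sr ltn_pmul2l // prednK.
apply/subsetP => x; rewrite inE => /andP[xX xr]; apply/bigcupP.
have [/existsP[i ni]|] := boolP [exists i : 'I_(size s), [disjoint nbr x & nth set0 s i]].
  by exists i => //; rewrite inE xX.
rewrite negb_exists => /forallP all_meet; exfalso.
have /leq_trans/(_ xr) : r < #|nbr x :&: A|; last by rewrite ltnn.
rewrite -sr; apply: leq_trans (count_meeting _ ds).
suff : all (fun B : {set V} => ~~ [disjoint nbr x :&: A & B]) s by rewrite all_count => /eqP ->.
apply/allP => B Bs; have [BA _] := sA B Bs.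
have [i iE] : exists i : 'I_(size s), B = nth set0 s i.
  have iB : index B s < size s by rewrite index_mem.
  by exists (Ordinal iB); rewrite /= nth_index.
have := all_meet i; rewrite -iE => /pred0Pn[y /= /andP[yx yB]].
by apply/pred0Pn; exists y; rewrite /= inE yx yB (subsetP BA).
Qed.

End Expansion.

(** * Merging parts into deeper levels *)

Section Parts.
Variables (V : finType) (G : {set {set V}}).
Hypothesis G2 : simple_graph G.
Local Notation nbr := (nbrs G).

Definition edge_degree (BE : {set {set V}}) (x : V) : nat := #|[set e in BE | x \in e]|.

Variables (C : {set V}) (BE : {set {set V}}) (v : V) (L : nat).
Hypothesis vC : v \notin C.
Hypothesis degL : forall z, z \notin C -> edge_degree BE z <= L.

Lemma set2_inj (T : finType) (x : T) : injective (fun y => [set x; y]).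
Proof.
move=> y z /setP E; move: (E y) (E z); rewrite !inE !eqxx !orbT.
by move=> /esym/orP[/eqP ->|/eqP //] /orP[/eqP ->|/eqP ->].
Qed.

Lemma card_claimed_nbrs x : #|[set y | [set x; y] \in BE]| <= edge_degree BE x.
Proof.
rewrite -(card_imset _ (@set2_inj _ x)); apply/subset_leq_card/subsetP => _ /imsetP[y + ->].
by rewrite !inE eqxx => ->.
Qed.

Lemma card_claimed_boundary (A : {set V}) : [disjoint A & C] ->
  #|[set y | [exists a in A, [set a; y] \in BE]]| <= L * #|A|.
Proof.
move=> AC; have -> : [set y | [exists a in A, [set a; y] \in BE]] =
    \bigcup_(a in A) [set y | [set a; y] \in BE].
  apply/setP => y; rewrite inE; apply/existsP/bigcupP.
    by case=> a /andP[aA e]; exists a; rewrite ?inE.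
  by case=> a aA; rewrite inE => e; exists a; rewrite aA.
apply: leq_trans (card_bigcup _ _) _; rewrite mulnC -sum_nat_const; apply: leq_sum => a aA.
apply: leq_trans (card_claimed_nbrs a) _; apply: degL.
by rewrite (disjointFr AC aA).
Qed.

(* [p.1] is a level set, and [p.2] contains the binary trees joining it to [v]. *)
Definition part (d k : nat) (p : {set V} * {set V}) : Prop :=
  [/\ p.1 \subset p.2, [disjoint p.2 & C], v \notin p.2,
      forall a, a \in p.1 -> btree G v BE d p.2 a & #|p.1| = k /\ #|p.2| <= 2 * k].

Definition dead (p : {set V} * {set V}) : bool :=
  [forall x in C, forall a in p.1, [set x; a] \notin G :\: BE].

Lemma deadP p x a : dead p -> x \in C -> a \in p.1 -> [set x; a] \notin G :\: BE.
Proof. by move=> /forall_inP/(_ x)H xC; move: (H xC) => /forall_inP; apply. Qed.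

Definition disjoint_supports (l : seq ({set V} * {set V})) : bool :=
  pairwise (fun p q : {set V} * {set V} => [disjoint p.2 & q.2]) l.

Lemma btree_child d (S A1 A2 S1 S2 : {set V}) a :
  a \in S -> a \notin S1 -> a \notin S2 -> S1 \subset S -> S2 \subset S -> [disjoint S1 & S2] ->
  (forall b, b \in A1 -> btree G v BE d S1 b) -> (forall b, b \in A2 -> btree G v BE d S2 b) ->
  (exists2 b, b \in A1 & [set a; b] \in G :\: BE) ->
  (exists2 b, b \in A2 & [set a; b] \in G :\: BE) -> btree G v BE d.+1 S a.
Proof.
move=> aS a1 a2 s1 s2 d12 t1 t2 [b1 b1A e1] [b2 b2A e2]; split=> //; right.
by exists S1, S2, b1, b2; split; rewrite ?subsetD1 ?s1 ?s2; auto.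
Qed.

(** Remove from the common neighbours the set [U] and the at most [2 * L * k] vertices joined to a
    level set by a Breaker edge. A remaining vertex has free edges to both level sets, so it roots a
    deeper tree, and it lies outside [C] because the parts are dead. Since [4 * k <= k'], both old
    supports fit into the bound [2 * k']. *)
Lemma pair_up d k k' t (p1 p2 : {set V} * {set V}) (U : {set V}) :
  part d k p1 -> part d k p2 -> dead p1 -> dead p2 -> [disjoint p1.2 & p2.2] ->
  t <= #|common_nbrs G p1.1 p2.1| -> v \in U -> p1.2 \subset U -> p2.2 \subset U ->
  k' + 2 * L * k + #|U| <= t -> 4 * k <= k' ->
  exists A : {set V}, [disjoint A & U] /\ part d.+1 k' (A, A :|: (p1.2 :|: p2.2)).
Proof.
move=> [s1 c1 v1 t1 [k1 m1]] [s2 c2 v2 t2 [k2 m2]] dd1 dd2 d12 tN vU U1 U2 le kk.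
have dC1 : [disjoint p1.1 & C] by apply: disjointWl c1.
have dC2 : [disjoint p2.1 & C] by apply: disjointWl c2.
pose X := common_nbrs G p1.1 p2.1.
pose Z := [set y | [exists a in p1.1, [set a; y] \in BE]] :|:
          [set y | [exists a in p2.1, [set a; y] \in BE]] :|: U.
have [A sA Ak] : exists2 A : {set V}, A \subset X :\: Z & #|A| = k'.
  apply: subset_of_card; rewrite cardsD.
  have IZ : #|X :&: Z| <= #|Z| by apply/subset_leq_card/subsetIr.
  have z1 := card_claimed_boundary dC1; have z2 := card_claimed_boundary dC2.
  rewrite k1 in z1; rewrite k2 in z2.
  have hZ : #|Z| <= L * k + L * k + #|U|.
    apply: leq_trans (leq_card_setU _ _).1 _; rewrite leq_add2r.
    by apply: leq_trans (leq_card_setU _ _).1 _; apply: leq_add.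
  by rewrite -/X in tN; clear -IZ hZ tN le; lia.
have inA y : y \in A -> [/\ y \notin U, y \notin C,
    exists2 b, b \in p1.1 & [set y; b] \in G :\: BE
    & exists2 b, b \in p2.1 & [set y; b] \in G :\: BE].
  move=> /(subsetP sA)/setDP[]; rewrite inE => /and3P[_ n1 n2].
  rewrite !in_setU !negb_or => /andP[/andP[z1 z2] yU].
  have fr p : dead p -> ~~ [disjoint nbr y & p.1] ->
      y \notin [set y | [exists a in p.1, [set a; y] \in BE]] ->
      y \notin C /\ exists2 b, b \in p.1 & [set y; b] \in G :\: BE.
    move=> dp /pred0Pn[b /= /andP[yb bp]]; rewrite inE negb_exists => /forallP/(_ b).
    rewrite bp /= => bBE; have ybG : [set y; b] \in G :\: BE.
      by rewrite inE setUC bBE setUC; move: yb; rewrite inE.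
    split; last by exists b.
    by apply: contraL ybG => yC; apply: deadP bp.
  by have [yC f1] := fr _ dd1 n1 z1; have [_ f2] := fr _ dd2 n2 z2.
exists A; split; first by apply: disjoint_notin => y /inA[].
have notin y (S : {set V}) : y \in A -> S \subset U -> y \notin S.
  by move=> /inA[yU _ _ _] SU; apply: contra yU; apply: (subsetP SU).
split=> /=.
- exact: subsetUl.
- apply: disjoint_notin => y; rewrite !inE => /or3P[/inA[]//|y1|y2].
    by rewrite (disjointFr c1 y1).
  by rewrite (disjointFr c2 y2).
- rewrite !inE !negb_or v1 v2 !andbT; apply: contraL vU => /inA[]//.
- move=> a aA; have [_ _ f1 f2] := inA a aA.
  apply: (btree_child _ _ _ _ _ d12 t1 t2 f1 f2); rewrite ?notin //.
  + by rewrite inE aA.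
  + by rewrite setUCA subsetUl.
  + by rewrite setUA subsetUr.
- split=> //; have := (leq_card_setU A (p1.2 :|: p2.2)).1.
  have := (leq_card_setU p1.2 p2.2).1; rewrite Ak; clear -m1 m2 kk; lia.
Qed.

(** The parts are merged in pairs. [U] collects the vertices in use; the last clause, which places
    new supports outside [U] or inside old supports, keeps the new parts disjoint through the
    induction. *)
Lemma level_up d k k' t m (l : seq ({set V} * {set V})) (U : {set V}) :
  (forall A B : {set V}, [disjoint A & B] -> #|A| = k -> #|B| = k -> t <= #|common_nbrs G A B|) ->
  2 * m <= size l -> (forall p, p \in l -> part d k p /\ dead p) -> disjoint_supports l ->
  v \in U -> (forall p, p \in l -> p.2 \subset U) ->
  k' + 2 * L * k + (#|U| + m * k') <= t -> 4 * k <= k' ->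
  exists l', [/\ size l' = m, disjoint_supports l', forall p, p \in l' -> part d.+1 k' p
    & forall p x, p \in l' -> x \in p.2 -> x \notin U \/ exists2 o, o \in l & x \in o.2].
Proof.
move=> exp + + + + + + kk; elim: m l U => [|m IH] l U; first by exists [::].
case: l => [|p1 [|p2 l]] //; first by rewrite mulnS.
rewrite mulnS !ltnS => sl pl /=; rewrite /disjoint_supports /= => /and3P[/andP[d12 d1l] d2l dl].
move=> vU pU le.
have in1 : p1 \in [:: p1, p2 & l] by rewrite inE eqxx.
have in2 : p2 \in [:: p1, p2 & l] by rewrite !inE eqxx orbT.
have inl p : p \in l -> p \in [:: p1, p2 & l] by rewrite !inE => ->; rewrite !orbT.
have [P1 D1] := pl _ in1; have [P2 D2] := pl _ in2.
have tN : t <= #|common_nbrs G p1.1 p2.1|.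
  have [s1 _ _ _ [k1 _]] := P1; have [s2 _ _ _ [k2 _]] := P2.
  by apply: exp => //; apply: disjointW d12.
have [|A [AU PA]] := @pair_up d k k' t p1 p2 U P1 P2 D1 D2 d12 tN vU (pU _ in1) (pU _ in2) _ kk.
  by move: le; rewrite mulSn; clear; lia.
have [|||||l' [sl' dl' pl' xl']] := IH l (A :|: U) sl.
- by move=> p /inl/pl.
- exact: dl.
- by rewrite inE vU orbT.
- by move=> p /inl/pU sp; apply: subset_trans sp (subsetUr _ _).
- have [_ _ _ _ [Ak _]] := PA; rewrite /= in Ak.
  have := (leq_card_setU A U).1; move: le; rewrite mulSn Ak; clear; lia.
exists ((A, A :|: (p1.2 :|: p2.2)) :: l'); split=> /=.
- by rewrite sl'.
- rewrite /disjoint_supports /= -/(disjoint_supports _) dl' andbT.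
  apply/allP => p pl2 /=; rewrite disjoint_sym; apply: disjoint_notin => x /(xl' p x pl2) H.
  apply/negP; rewrite !in_setU; case: H => [|[o ol xo]].
    rewrite inE negb_or => /andP[xA xU]; rewrite (negPf xA) /= => /orP[] xp.
      by rewrite (subsetP (pU _ in1)) in xU.
    by rewrite (subsetP (pU _ in2)) in xU.
  have xU := subsetP (pU _ (inl _ ol)) _ xo.
  rewrite (disjointFl AU xU) /= => /orP[] xp.
    by have /= dpo := allP d1l _ ol; rewrite (disjointFr dpo xp) in xo.
  by have /= dpo := allP d2l _ ol; rewrite (disjointFr dpo xp) in xo.
- by move=> p; rewrite inE => /orP[/eqP ->|/pl'].
- move=> p x; rewrite inE => /orP[/eqP -> /=|pl2 xp].
    rewrite !inE => /or3P[xA|x1|x2].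
    + by left; rewrite (disjointFr AU xA).
    + by right; exists p1; rewrite ?inE ?eqxx.
    + by right; exists p2; rewrite ?inE ?eqxx ?orbT.
  have [|[o ol xo]] := xl' p x pl2 xp; last by right; exists o; first exact: inl.
  by rewrite inE negb_or => /andP[_ ?]; left.
Qed.

(** Two parts that are not dead provide two disjoint pending trees, hence a win. Otherwise
    discarding one part leaves only dead ones. *)
Lemma dead_or_win d k (l : seq ({set V} * {set V})) m :
  (forall p, p \in l -> part d k p) -> disjoint_supports l -> m < size l ->
  forces G d.+1 (reached v) C BE \/
  exists l', [/\ size l' = m, disjoint_supports l' & forall p, p \in l' -> part d k p /\ dead p].
Proof.
move=> pl dl ml; have cnt := count_predC dead l.
have [c1|c2] := leqP (count (predC dead) l) 1.
  right; exists (take m (filter dead l)); split.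
  - by rewrite size_takel // size_filter; clear -cnt c1 ml; lia.
  - apply: subseq_pairwise (pairwise_filter dead dl); exact: take_subseq.
  - by move=> p /mem_take; rewrite mem_filter => /andP[dp /pl].
left; move: c2; rewrite -size_filter; case E: (filter _ l) => [|p [|q s]] //= _.
have := pairwise_filter (predC dead) dl; rewrite E /= => /andP[/andP[dpq _] _].
have pend r : r \in [:: p, q & s] -> exists a, pending G v C BE d (r.2, a).
  rewrite -E mem_filter => /andP[/= + /pl[s1 c1 v1 t1 _]].
  rewrite negb_forall => /existsP[x]; rewrite negb_imply => /andP[xC].
  rewrite negb_forall => /existsP[a]; rewrite negb_imply => /andP[ar /negPn xa].
  exists a; split=> //=; first by exists x.
  exact: t1.
have [|a pa] := pend p; first by rewrite inE eqxx.
have [|b pb] := pend q; first by rewrite !inE eqxx orbT.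
exact: two_pending vC _ pa pb.
Qed.

End Parts.

Section Levels.
Variables (V : finType) (G : {set {set V}}) (q J L : nat).
Hypothesis G2 : simple_graph G.
Hypothesis exG : expanding G q J.
Hypothesis J0 : 0 < J.
Hypothesis hq : 2 * L + 35 * 2 ^ J + 2 * J + 40 <= q.
Local Notation nbr := (nbrs G).

Lemma q_gt0 : 0 < q.
Proof. by clear -hq; lia. Qed.

Variables (C : {set V}) (BE : {set {set V}}) (v : V).
Hypothesis vC : v \notin C.
Hypothesis C0 : 0 < #|C|.
Hypothesis degL : forall z, z \notin C -> edge_degree BE z <= L.

Lemma support_union (l : seq ({set V} * {set V})) k :
  (forall p, p \in l -> #|p.2| <= k) -> exists U : {set V}, [/\ v \in U,
    forall p, p \in l -> p.2 \subset U & #|U| <= 1 + size l * k].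
Proof.
elim: l => [|p l IH] lk; first by exists [set v]; rewrite set11 cards1.
have [|U [vU lU Uk]] := IH; first by move=> r rl; apply: lk; rewrite inE rl orbT.
exists (p.2 :|: U); split.
- by rewrite inE vU orbT.
- move=> r; rewrite inE => /orP[/eqP ->|/lU rU]; first exact: subsetUl.
  exact: subset_trans rU (subsetUr _ _).
- have := lk p (mem_head _ _); have := (leq_card_setU p.2 U).1; move: Uk.
  by rewrite /= mulSn; clear; lia.
Qed.

(** The length [7 * 2 ^ i - 1] comes from iterating x -> 2x + 1 on 6: each level may lose one part
    before the number is halved, and five dead parts remain at the end. No round is played
    meanwhile. *)
Lemma levels i j (l : seq ({set V} * {set V})) : j + i = J -> size l = 7 * 2 ^ i - 1 ->
  (forall p, p \in l -> part G C BE v j (q ^ (2 * J + 2 * j)) p) -> disjoint_supports l ->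
  forces G J.+1 (reached v) C BE \/
  exists l', [/\ size l' = 5, disjoint_supports l'
    & forall p, p \in l' -> part G C BE v J (q ^ (4 * J)) p /\ dead G C BE p].
Proof.
have win d : d <= J -> forces G d.+1 (reached v) C BE -> forces G J.+1 (reached v) C BE.
  by move=> dJ; apply: forces_leq.
elim: i j l => [|i IH] j l.
  rewrite addn0 => -> sl pl dl; have [||[l' [sl' dl' pl']]] := dead_or_win vC (m := 5) pl dl.
  - by rewrite sl.
  - by left.
  by right; exists l'; split=> // p; rewrite -[4]/(2 + 2) mulnDl; apply: pl'.
move=> ji sl pl dl; set N := 7 * 2 ^ i - 1.
have iJ : i < J by rewrite -ji addnS ltnS leq_addl.
have i2 : 2 ^ i.+1 <= 2 ^ J by rewrite leq_exp2l.
have i1 : 0 < 2 ^ i by rewrite expn_gt0.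
have [|fw|[l' [sl' dl' pl']]] := dead_or_win vC (m := 2 * N) pl dl.
- by rewrite sl /N expnS; clear -i1; lia.
- by left; apply: win fw; rewrite -ji leq_addr.
have [|U [vU lU Uk]] := @support_union l' (2 * q ^ (2 * J + 2 * j)).
  by move=> p /pl'[[_ _ _ _ []]].
case: (exG) => expand _ _.
pose k := q ^ (2 * J + 2 * j).
have k'E : q ^ (2 * J + 2 * j.+1) = q ^ 2 * k by rewrite /k mulnS (addnC 2) addnA expnD mulnC.
have tE : q ^ (2 * J + 2 * j + 3) = q * (q ^ 2 * k) by rewrite /k expnD mulnC mulnA -expnS.
have k0 : 0 < k by rewrite expn_gt0 q_gt0.
have kk : 4 * k <= q ^ 2 * k.
  by rewrite leq_mul2r; apply/orP; right; apply: (@leq_trans (2 ^ 2)) => //; rewrite leq_exp2r //; clear -hq; lia.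
(* The old supports take [4 * N * k] vertices, Breaker's edges [2 * L * k] and the new levels
   [N * (q ^ 2 * k)]. These five multiples of [N < 7 * 2 ^ i] are the origin of [35 * 2 ^ J] in the
   assumption on [q]. *)
have arith : q ^ 2 * k + 2 * L * k + (#|U| + N * (q ^ 2 * k)) <= q * (q ^ 2 * k).
  have : (N + 1 + (2 * L + 4 * N + 1)) * (q ^ 2 * k) <= q * (q ^ 2 * k).
    rewrite leq_mul2r; apply/orP; right; apply: leq_trans hq; rewrite /N.
    by move: i2; rewrite expnS; clear; lia.
  have : (2 * L + 4 * N + 1) * k <= (2 * L + 4 * N + 1) * (q ^ 2 * k).
    by rewrite leq_mul2l leq_pmull ?orbT // expn_gt0 q_gt0.
  move: Uk; rewrite sl' -/k !mulnDl !mul1n; move: (q ^ 2 * k) => K; move: (q * K) => Z.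
  rewrite !mul0n (mulnCA N 2 k); move: (N * K) (L * K) (N * k) (L * k) => a b c e.
  by move: (#|U|) k0 => u; clear; lia.
have := @level_up V G C BE v L degL j k (q ^ 2 * k) (q * (q ^ 2 * k)) N l' U.
case=> //.
- by move=> A B dAB Ak Bk; rewrite -tE; apply: expand => //; rewrite -ji addnS ltnS leq_addr.
- by rewrite sl'.
move=> l'' [sl'' dl'' pl'' _]; apply: (IH j.+1 l''); rewrite ?addSnnS //.
by rewrite k'E.
Qed.

Lemma free_nbr (x : V) (A : {set V}) : x \notin C -> L < #|nbr x :&: A| ->
  exists2 a, a \in A & [set x; a] \in G :\: BE.
Proof.
move=> xC xA; have : ~~ (nbr x :&: A \subset [set y | [set x; y] \in BE]).
  apply: contraL xA => /subset_leq_card h; rewrite -leqNgt.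
  exact: leq_trans h (leq_trans (card_claimed_nbrs _ _) (degL xC)).
case/subsetPn => a; rewrite !inE => /andP[xa aA] aBE; exists a => //.
by rewrite inE aBE.
Qed.

Definition free_boundary : {set V} := [set y | (y \notin C) && [exists x in C, [set x; y] \in G :\: BE]].

(** Expansion is applied to at most [q ^ (2 * J)] vertices of [C]. A boundary vertex is lost if it
    lies in [C] or is cut off by a Breaker edge, and distinct vertices cut off outside [C] use
    distinct edges. The factor [q] outweighs both losses. *)
Lemma free_boundary_big : #|BE| <= 2 * (J + 2) * #|C| -> #|C| < q ^ (4 * J) ->
  q ^ (2 * J) <= #|free_boundary|.
Proof.
move=> BEC CK.
have q0 := q_gt0; set Q := q ^ (2 * J).
have Q0 : 0 < Q by rewrite expn_gt0 q0.
have QQ : q ^ (4 * J) = Q * Q by rewrite -expnD -mulnDl.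
have [C' C'C C'k] := @subset_of_card _ C (minn #|C| Q) (geq_minl _ _).
case: exG => _ /(_ C') H _.
have {}H : minn #|C| Q * (Q * q) <= #|boundary G C'|.
  rewrite -C'k [Q * q]mulnC -expnS -addn1; apply: H.
  by rewrite C'k leq_min C0 Q0 geq_minr.
have : #|boundary G C'| <= #|free_boundary| + #|C :\: C'| + #|BE|.
  pose lost := (boundary G C' :\: free_boundary) :\: C.
  have lostBE : #|lost| <= #|BE|.
    pose f y := if [pick x in C' | [set x; y] \in BE] is Some x then [set x; y] else set0.
    have fP y : y \in lost -> y \notin C /\ exists2 x, x \in C & f y = [set x; y] /\ f y \in BE.
      rewrite !inE => /and4P[yC + yC' /pred0Pn[x /= /andP[yx xC']]].
      rewrite yC /= negb_exists => /forallP/(_ x); rewrite (subsetP C'C _ xC') /=.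
      rewrite inE negb_and negbK => H'; split=> //.
      rewrite /f; case: pickP => [z /andP[zC' zBE]|/(_ x)].
        by exists z; first exact: (subsetP C'C).
      rewrite xC' /=; case/orP: H' => [-> //|]; by move: yx; rewrite inE setUC => ->.
    have inj : {in lost &, injective f}.
      move=> y z /fP[yC [a aC [fy _]]] /fP[zC [b bC [fz _]]]; rewrite fy fz => /setP/(_ y).
      rewrite !inE eqxx orbT => /esym/orP[/eqP yb|/eqP //].
      by rewrite yb bC in yC.
    rewrite -(card_in_imset inj); apply/subset_leq_card/subsetP => _ /imsetP[y /fP[_ [x _ [_ ?]]] ->] //.
  apply: (@leq_trans #|free_boundary :|: (C :\: C') :|: lost|).
    apply/subset_leq_card/subsetP => y yB; rewrite !in_setU !in_setD yB.
    have yC' : y \notin C' by move: yB; rewrite inE => /andP[].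
    by rewrite yC'; case: (y \in free_boundary); case: (y \in C).
  apply: leq_trans (leq_card_setU _ _).1 _; apply: leq_add lostBE.
  exact: (leq_card_setU _ _).1.
rewrite cardsDS // C'k.
have hq' : 2 * J + 40 <= q by clear -hq; lia.
have [cQ|Qc] := leqP #|C| Q.
  rewrite (minn_idPl cQ) subnn in H *; move=> h.
  have : #|C| * (Q * (2 * J + 5)) <= #|C| * (Q * q).
    by rewrite !leq_mul2l; apply/orP; right; apply/orP; right; clear -hq'; lia.
  have : 2 * (J + 2) * #|C| <= 2 * (J + 2) * (#|C| * Q) by rewrite leq_mul2l leq_pmulr ?orbT.
  have : Q <= #|C| * Q by rewrite leq_pmull.
  move: H h BEC; clearbody Q.
  move: #|free_boundary| #|BE| #|C| #|boundary G C'| => x y z t.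
  by clear; lia.
rewrite (minn_idPr (ltnW Qc)) in H *; move=> h.
have : (Q * Q) * (2 * J + 6) <= Q * Q * q by rewrite leq_mul2l; apply/orP; right; clear -hq'; lia.
have : 2 * (J + 2) * #|C| <= 2 * (J + 2) * (Q * Q) by rewrite leq_mul2l -QQ (ltnW CK) orbT.
have : Q <= Q * Q by rewrite leq_pmull.
rewrite QQ in CK; move: H h BEC CK; clearbody Q.
move: #|free_boundary| #|BE| #|C| #|boundary G C'| => x y z t.
by clear; lia.
Qed.

End Levels.

(** * Reaching a prescribed vertex *)

Section Reaching.
Variables (V : finType) (G : {set {set V}}) (q J L : nat).
Hypothesis G2 : simple_graph G.
Hypothesis exG : expanding G q J.
Hypothesis J0 : 0 < J.
Hypothesis hq : 2 * L + 35 * 2 ^ J + 2 * J + 40 <= q.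
Local Notation nbr := (nbrs G).
Variables (C : {set V}) (BE : {set {set V}}) (v : V).
Hypothesis vC : v \notin C.
Hypothesis C0 : 0 < #|C|.
Hypothesis degL : forall z, z \notin C -> edge_degree BE z <= L.

Lemma hole_side : 0 < q ^ (4 * J).-1 /\ L.+1 * q ^ (4 * J).-1 <= q ^ (4 * J).
Proof.
have q0 := q_gt0 hq; split; first by rewrite expn_gt0 q0.
have E : 4 * J = (4 * J).-1.+1 by rewrite prednK // muln_gt0.
by rewrite [in X in _ <= X]E expnS leq_mul2r; apply/orP; right; clear -hq; lia.
Qed.

Lemma avoid_bad (T : eqType) (X : {set V}) (l : seq T) (bad : T -> {set V}) K :
  (forall p, p \in l -> #|bad p| <= K) -> size l * K < #|X| ->
  exists2 x, x \in X & forall p, p \in l -> x \notin bad p.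
Proof.
elim: l X => [|p l IH] X bK; first by rewrite mul0n card_gt0 => /set0Pn[x xX]; exists x.
rewrite /= mulSn => lt.
have [||x] := IH (X :\: bad p); first by move=> r rl; apply: bK; rewrite inE rl orbT.
  have := bK p (mem_head _ _); have := subset_leq_card (subsetIr X (bad p)).
  by rewrite cardsD; move: lt; clear; lia.
rewrite inE => /andP[xp xX] xl; exists x => // r; rewrite inE => /orP[/eqP -> //|]; exact: xl.
Qed.

(** One turn leads along [c], [x1], [x2] to a vertex with more than [L] neighbours, hence a free
    edge, in each of the five level sets. At most one support contains [x1]; four threats remain and
    Breaker stops two. *)
Lemma final_fan (l : seq ({set V} * {set V})) :
  (forall x, x \in C -> [set x; v] \notin G :\: BE) ->
  #|BE| <= 2 * (J + 2) * #|C| -> #|C| < q ^ (4 * J) ->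
  size l = 5 -> disjoint_supports l ->
  (forall p, p \in l -> part G C BE v J (q ^ (4 * J)) p) ->
  forces G (J + 2) (reached v) C BE.
Proof.
move=> noC BEC CK l5 dl pl; set K := q ^ (4 * J) in CK pl *; set Q := q ^ (2 * J).
have q0 := q_gt0 hq.
have [h0 hK] := hole_side.
have QQ : K = Q * Q by rewrite -expnD -mulnDl.
have Q0 : 0 < Q by rewrite expn_gt0 q0.
have [S SF SQ] := subset_of_card (free_boundary_big exG hq C0 BEC CK); rewrite -/Q in SQ.
have [U [vU lU Uk]] := @support_union _ v l (2 * K) (fun p pi => ltac:(by case: (pl p pi) => _ _ _ _ [])).
case: exG => _ /(_ S) bS hole.
have SC : [disjoint S & C].
  by apply: disjoint_notin => x /(subsetP SF); rewrite inE => /andP[].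
pose Z := [set y | [exists a in S, [set a; y] \in BE]].
pose X := ((boundary G S :\: C) :\: Z) :\: U.
have Xbig : 5 * K < #|X|.
  have ZL : #|Z| <= L * Q by rewrite -SQ; apply: (card_claimed_boundary degL SC).
  have bK : K * q <= #|boundary G S|.
    by rewrite QQ -mulnA [Q * q]mulnC -expnS -addn1 -SQ; apply: bS; rewrite SQ Q0 leqnn.
  have s1 := subset_leq_card (subsetIr (boundary G S) C).
  have s2 := subset_leq_card (subsetIr (boundary G S :\: C) Z).
  have s3 := subset_leq_card (subsetIr (boundary G S :\: C :\: Z) U).
  have lK : L * Q <= L * K by rewrite leq_mul2l QQ leq_pmull ?orbT.
  have : K * (L + 18) <= K * q by rewrite leq_mul2l; apply/orP; right; clear -hq; lia.
  have K0 : 0 < K by rewrite QQ muln_gt0 Q0.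
  rewrite /X !cardsD; rewrite l5 in Uk; move: K0 lK ZL bK s1 s2 s3 CK Uk; clear.
  rewrite -/K; move: (K * q) => b; rewrite mulnDr.
  move: #|boundary G S| #|Z| #|C| #|U| => x y z u.
  move: (#|_ :&: Z|) (#|_ :&: C|) (#|_ :&: U|) => i1 i2 i3; rewrite (mulnC K L).
  by move: (L * K) (L * Q) => e f; lia.
have Xnot x : x \in X -> [/\ x \notin U, x \notin C, x \notin Z & x \in boundary G S].
  by rewrite /X !in_setD => /and4P[].
have badK p : p \in l -> #|[set x in X | #|nbr x :&: p.1| <= L]| <= K.
  move=> pi; have [s1 _ _ _ [k1 _]] := pl p pi.
  apply: ltnW; apply: (leq_trans (few_low_degree h0 hole _ _) hK); last by rewrite k1.
  rewrite disjoint_sym; apply: disjoint_notin => x /Xnot[xU _ _ _].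
  by apply: contra xU => /(subsetP s1)/(subsetP (lU p pi)).
have [|x2 x2X x2l] := @avoid_bad _ X l (fun p => [set x in X | #|nbr x :&: p.1| <= L]) K badK; first by rewrite l5.
have [x2U x2C x2Z] := Xnot x2 x2X.
rewrite inE => /andP[x2S /pred0Pn[x1 /= /andP[x12 x1S]]].
have := subsetP SF _ x1S; rewrite inE => /andP[x1C /exists_inP[c cC cx1]].
have e12 : [set x1; x2] \in G :\: BE.
  move: x12 x2Z; rewrite !inE setUC => ->; rewrite negb_exists andbT => /forallP/(_ x1).
  by rewrite x1S.
have x21 : x2 != x1 by apply: contraNneq x2S => ->.
rewrite addnS; right; exists (x1 |: C), (x2 |: (x1 |: C)); split.
- by right; exists c, x1.
- by right; exists x1, x2; split; rewrite // !inE ?eqxx // negb_or x21.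
move=> Y YG Y2; set C2 := x2 |: (x1 |: C).
have vC2 : v \notin C2.
  rewrite !inE !negb_or vC andbT; apply/andP; split.
    by apply: contraNneq x2U => <-.
  by apply: contraTneq cx1 => <-; apply: noC.
(* For the parts in [l] the default [x2] is never taken. *)
pose f (p : {set V} * {set V}) := odflt x2 [pick a in p.1 | [set x2; a] \in G :\: BE].
have fP p : p \in l -> f p \in p.1 /\ [set x2; f p] \in G :\: BE.
  move=> pi; have [|a ap xa] := @free_nbr _ G L C BE degL x2 p.1 x2C.
    by have := x2l p pi; rewrite inE x2X /= -ltnNge.
  by rewrite /f; case: pickP => [b /andP[]|/(_ a)] //; rewrite ap xa.
pose s := [seq (p.2, f p) | p : {set V} * {set V} <- l & x1 \notin p.2].
have [||||p' [q' [d' pp' pq']]] := @two_survivors V G v C2 BE J s Y.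
- rewrite /s pairwise_map; apply: pairwise_filter; exact: dl.
- have := count_predC (fun p : {set V} * {set V} => x1 \notin p.2) l.
  rewrite size_map size_filter l5.
  suff : count (predC (fun p : {set V} * {set V} => x1 \notin p.2)) l <= 1 by clear; lia.
  have := @count_meeting V [seq p.2 | p : {set V} * {set V} <- l] [set x1]; rewrite pairwise_map cards1 => /(_ dl).
  rewrite count_map; apply: leq_trans; apply: sub_count => p /=.
  by rewrite negbK disjoints1 => ->.
- by [].
- move=> _ /mapP[p + ->]; rewrite mem_filter => /andP[x1p pi].
  have [s1 c1 v1 t1 _] := pl p pi; have [fp1 fp2] := fP p pi.
  split=> //=; first by exists x2; [rewrite !inE eqxx|exact: fp2].
    rewrite disjoint_sym; apply: disjoint_notin => x; rewrite !inE => /or3P[/eqP ->|/eqP -> //|xC].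
      by apply: contra x2U => /(subsetP (lU p pi)).
    by rewrite (disjointFl c1 xC).
  exact: t1.
by rewrite addn1; apply: two_pending vC2 d' pp' pq'.
Qed.

(** Slices of the free neighbourhood of [v] serve as parts of depth zero. If [C] has at least
    [q ^ (4 * J)] vertices, expansion yields a free edge from [C] into a dead level set, a
    contradiction; a smaller [C] is handled by the fan. The count is one round for entering the fan
    and [J + 1] for two pending trees. *)
Lemma phase : #|BE| <= 2 * (J + 2) * #|C| -> forces G (J + 2) (reached v) C BE.
Proof.
move=> BEC; have q0 := q_gt0 hq.
have [/exists_inP[x xC xv]|] := boolP [exists x in C, [set x; v] \in G :\: BE].
  rewrite addnS; right; exists (v |: C), (v |: C); split; [|by left|].
    by right; exists x, v.
  by move=> Y _ _; apply: forces_now; rewrite /reached !inE eqxx.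
rewrite negb_exists => /forallP noC'.
have noC x : x \in C -> [set x; v] \notin G :\: BE.
  by move=> xC; have := noC' x; rewrite xC.
have [h0 hK] := hole_side; set K := q ^ (4 * J) in hK *; set Q := q ^ (2 * J).
have Q0 : 0 < Q by rewrite expn_gt0 q0.
case: (exG) => _ bS hole.
pose W := [set w | [set w; v] \in G :\: BE].
have Wbig : (7 * 2 ^ J - 1) * Q <= #|W|.
  have : Q * q <= #|boundary G [set v]|.
    by have := bS [set v]; rewrite cards1 mul1n Q0 addn1 expnS mulnC => /(_ isT).
  have : #|boundary G [set v]| <= #|W| + L.
    apply: (@leq_trans #|W :|: [set y | [set v; y] \in BE]|).
      apply/subset_leq_card/subsetP => y; rewrite !inE.
      case/andP=> yv /pred0Pn[z /= /andP[yz /set1P zv]].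
      move: yz; rewrite zv inE => yvG; rewrite yvG andbT (setUC [set v]).
      by case: (_ \in BE).
    apply: leq_trans (leq_card_setU _ _).1 _; rewrite leq_add2l.
    apply: leq_trans (card_claimed_nbrs _ _) _; exact: degL.
  have : Q * (7 * 2 ^ J - 1 + L) <= Q * q.
    by rewrite leq_mul2l; apply/orP; right; clear -hq; lia.
  have : L <= Q * L by rewrite leq_pmull.
  rewrite mulnDr (mulnC _ Q); move: (Q * L) (Q * q) (Q * _) => a b c; clear; lia.
have [s [sN ds sW]] := card_disjoint_pieces Wbig.
have [||||fw|[l [l5 dl pl]]] := @levels V G q J L exG hq C BE v vC degL J 0 [seq (B, B) | B <- s].
- by [].
- by rewrite size_map.
- move=> _ /mapP[B /sW[BW Bk] ->]; split=> //=.
  + apply: disjoint_notin => x /(subsetP BW); rewrite inE.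
    by apply: contraL => /noC.
  + apply: contraT => /negPn/(subsetP BW); rewrite inE.
    by move=> /setDP[/(simple_loop G2)]; rewrite eqxx.
  + by move=> a aB; split=> //; left; move: (subsetP BW _ aB); rewrite inE.
  + by rewrite muln0 addn0 Bk leq_pmull.
- by rewrite /disjoint_supports pairwise_map.
- by apply: forces_leq fw; rewrite addn2.
have [CK|KC] := ltnP #|C| K.
  by apply: (final_fan noC BEC CK l5 dl) => p /pl[].
case: l l5 {dl} pl => // p l _ /(_ p (mem_head _ _))[[s1 c1 v1 t1 [k1 _]] dp].
have dCp : [disjoint C & p.1] by rewrite disjoint_sym; apply: disjointWl c1.
have := few_low_degree h0 hole dCp (leq_trans hK KC).
move=> /leq_trans/(_ hK); rewrite /K -k1 => lt.
have [x] : exists2 x, x \in p.1 & x \notin [set x in p.1 | #|nbr x :&: C| <= L].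
  by apply/subsetPn; apply: contraL lt => /subset_leq_card; rewrite -leqNgt.
rewrite inE => xp; rewrite xp /= -ltnNge => xL.
have xC : x \notin C by rewrite (disjointFl dCp xp).
have [c cC] := free_nbr degL xC xL; rewrite setUC => cx.
by have := deadP dp cC xp; rewrite cx.
Qed.

End Reaching.

(** * From the vertex game to a winning strategy *)

Section ForceStrategy.
Variables (n m b : nat) (G : edges n).

Fixpoint edge_forces (r : nat) (CE BE : edges n) : Prop :=
  if r is r'.+1 then
    spanning_tree G CE \/ exists X : edges n,
      [/\ X \subset G :\: (CE :|: BE), #|X| <= m, edges_connected (CE :|: X)
        & forall Y : edges n, Y \subset G :\: (CE :|: BE) :\: X -> #|Y| <= b ->
          edge_forces r' (CE :|: X) (BE :|: Y)]
  else spanning_tree G CE.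

Lemma edge_forces_now r CE BE : spanning_tree G CE -> edge_forces r CE BE.
Proof. by case: r => //= r; left. Qed.

(** After [size h] rounds [r - size h] are left, so the history determines a forced position and any
    move that keeps it forced will do. Once the tree is complete, passing is such a move. *)
Lemma edge_forces_wins r : edge_forces r finset.set0 finset.set0 -> connector_wins m b G.
Proof.
move=> r0.
pose good (h : history n) (X : edges n) := connector_legal m G h X /\
  forall Y : edges n, breaker_legal b G h X Y ->
    edge_forces (r - size h).-1 (connector_edges h :|: X) (breaker_edges h :|: Y).
pose s (h : history n) : edges n :=
  if pselect (exists X, good h X) is left e then projT1 (cid e) else finset.set0.
have sgood h : (exists X, good h X) -> good h (s h).
  by rewrite /s; case: pselect => // e _; exact: (projT2 (cid e)).
have force_good h : edge_forces (r - size h) (connector_edges h) (breaker_edges h) ->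
    exists X, good h X.
  have pass : spanning_tree G (connector_edges h) -> exists X, good h X.
    move=> st; exists finset.set0; split.
      split; rewrite ?finset.sub0set ?cards0 // finset.setU0.
      by move=> x y _ _; case: st => _ + _; apply.
    by move=> Y _; apply: edge_forces_now; rewrite finset.setU0.
  case E: (r - size h) => [|k] /=; first exact: pass.
  case=> [/pass //|[X [XG Xm Xc Xf]]]; exists X; split=> // Y [YG Yb].
  by rewrite E; apply: Xf.
exists s => B legB.
have size_play k : size (play s B k) = k by elim: k => //= k IH; rewrite size_rcons IH.
have inv k : edge_forces (r - k) (connector_edges (play s B k)) (breaker_edges (play s B k)).
  elim: k => [|k IH]; first by rewrite subn0 /connector_edges /breaker_edges !big_nil.
  have /sgood[_ /(_ (B k) (legB k))] : exists X, good (play s B k) X.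
    by apply: force_good; rewrite size_play.
  by rewrite size_play /= connector_edges_rcons breaker_edges_rcons subnS.
split.
  by move=> i; have /sgood[] : exists X, good (play s B i) X; first by apply: force_good; rewrite size_play.
by have := inv r; rewrite subnn /= => st; exists r, (connector_edges (play s B r)).
Qed.

End ForceStrategy.

Lemma adj_sym n (E : edges n) : symmetric (adj E).
Proof. by move=> x y; rewrite /adj finset.setUC. Qed.

(** The new vertex [y] has one neighbour, whereas a cycle through it would need two distinct
    ones. *)
Lemma acyclic_leaf n (E : edges n) (C : {set 'I_n}) x y :
  acyclic E -> finset.cover E \subset C -> x \in C -> y \notin C ->
  acyclic ([set x; y]%SET |: E).
Proof.
move=> aE EC xC yC.
have yE z : adj E y z = false.
  apply: contraNF yC => yz; apply: (subsetP EC); apply: (mem_cover yz).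
  by rewrite !inE eqxx.
have only z : adj ([set x; y]%SET |: E) y z -> z != y -> z = x.
  rewrite /adj inE -/(adj E y z) yE orbF inE => /eqP/finset.setP/(_ z).
  by rewrite !inE eqxx orbT => /esym/orP[/eqP //|->].
move=> c c2 cyc; have [yc|yc] := boolP (y \in c).
  have [i c' cE] := rot_to yc; move: cyc c2; rewrite -(rot_ucycle i) -(size_rot i) cE.
  case: c' {cE} => [|z [|w p]] //; rewrite /ucycle /= => /andP[/and3P[yz _ +]].
  rewrite rcons_path => /andP[_]; rewrite /= => ly /and3P[] yn zn _ _.
  move: yn; rewrite !inE !negb_or => /and3P[yz' yw yp].
  have zx : z = x by apply: only yz _; rewrite eq_sym.
  have lE : last w p \in w :: p := mem_last w p.
  have lx : last w p = x.
    apply: only; first by rewrite adj_sym.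
    by apply: contraTneq lE => ->; rewrite inE negb_or yw.
  by rewrite zx -lx lE in zn.
apply: (aE c c2); case/andP: cyc => cyc cU; apply/andP; split=> //.
apply: (@sub_in_cycle _ [in c] _ _ _ c) cyc; last exact/allP.
move=> u w uc wc; rewrite /adj inE inE => /orP[/eqP/finset.setP/(_ y)|//].
by rewrite !inE eqxx orbT => /orP[] /eqP yE'; [rewrite yE' uc in yc|rewrite yE' wc in yc].
Qed.

Section VertexToEdge.
Variables (n : nat) (G : edges n) (u : 'I_n).
Hypothesis G2 : simple_graph G.

Definition tree_on (CE : edges n) (C : {set 'I_n}) : Prop :=
  [/\ CE \subset G, acyclic CE, finset.cover CE \subset C
    & forall x, x \in C -> connect (adj CE) u x].

Lemma tree_on_step (CE BE : edges n) (C C' : {set 'I_n}) :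
  tree_on CE C -> vertex_step G BE C C' -> exists X : edges n,
  [/\ X \subset G :\: (CE :|: BE), #|X| <= 1 & tree_on (CE :|: X) C'].
Proof.
move=> tr [->|[x [y [xC yC xy ->]]]].
  by exists finset.set0; rewrite finset.sub0set cards0 finset.setU0.
case: tr => CG aC cC conC; exists [set [set x; y]]%SET.
have /finset.setDP[xyG xyB] := xy.
have xyC : [set x; y]%SET \notin CE.
  apply: contra yC => xyC; apply: (subsetP cC); apply: (mem_cover xyC).
  by rewrite !inE eqxx orbT.
split; rewrite ?cards1 // ?sub1set ?inE ?negb_or ?xyC ?xyB ?xyG //.
split.
- by rewrite finset.subUset CG finset.sub1set.
- by rewrite finset.setUC; apply: acyclic_leaf aC cC xC yC.
- rewrite cover_edgesU finset.subUset (subset_trans cC) ?finset.subsetUr //.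
  rewrite /finset.cover finset.big_set1 finset.subUset !finset.sub1set !inE eqxx xC.
  by rewrite orbT.
have sub : subrel (adj CE) (connect (adj (CE :|: [set [set x; y]]%SET))).
  by move=> z w zw; apply: connect1; rewrite /adj inE [_ \in CE]zw.
move=> z; rewrite inE => /orP[/finset.set1P ->|/conC cz].
  apply: (@connect_trans _ _ x); first by apply: (connect_sub sub); apply: conC.
  by apply: connect1; rewrite /adj !inE eqxx orbT.
by apply: (connect_sub sub).
Qed.

Lemma tree_on_connected (CE : edges n) (C : {set 'I_n}) x y :
  tree_on CE C -> x \in C -> y \in C -> connect (adj CE) x y.
Proof.
case=> _ _ _ conC xC yC; apply: (@connect_trans _ _ u); last exact: conC.
by rewrite (sym_connect_sym (@adj_sym n CE)) conC.
Qed.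

(** Breaker is stronger in the vertex game, where he may name any two edges of [G], so his legal
    replies are among those considered there. *)
Lemma forces_edge_forces r (CE BE : edges n) (C : {set 'I_n}) :
  tree_on CE C -> forces G r (fun C' _ => C' = finset.setT) C BE -> edge_forces 2 2 G r CE BE.
Proof.
have done CE' C' : tree_on CE' C' -> C' = finset.setT -> spanning_tree G CE'.
  move=> tr CT; have [CG aC _ _] := tr; split=> // x y.
  by apply: (tree_on_connected tr); rewrite CT inE.
elim: r CE BE C => [|r IH] CE BE C tr /=; first exact: done.
case=> [/(done _ _ tr)|[C1 [C2 [s1 s2 nxt]]]]; [by left|right].
have [X1 [X1G X1k tr1]] := tree_on_step tr s1.
have [X2 [X2G X2k tr2]] := tree_on_step tr1 s2.
rewrite -finset.setUA in tr2.
have XG : X1 :|: X2 \subset G :\: (CE :|: BE).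
  rewrite finset.subUset X1G (subset_trans X2G) // finset.setDS //.
  by rewrite finset.setSU // finset.subsetUl.
exists (X1 :|: X2); split=> //.
- by apply: leq_trans (leq_card_setU _ _).1 _; apply: (@leq_add _ _ 1 1).
- case: (tr2) => _ _ cC _ x y xc yc.
  by apply: (tree_on_connected tr2); apply: (subsetP cC).
move=> Y YG Y2; apply: IH tr2 _; apply: nxt => //.
apply: subset_trans YG _; apply: subset_trans (finset.subsetDl _ _) (finset.subsetDl _ _).
Qed.

Lemma forces_connector_wins r :
  forces G r (fun C _ => C = finset.setT) [set u]%SET finset.set0 -> connector_wins 2 2 G.
Proof.
move=> fr; apply: (@edge_forces_wins _ _ _ _ r); apply: forces_edge_forces fr.
split; rewrite ?finset.sub0set //.
- move=> c c2 /andP[cyc _]; case: c c2 cyc => [|x [|y c]] //= _.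
  by case/andP; rewrite /adj inE.
- by rewrite /finset.cover finset.big_set0 finset.sub0set.
- by move=> x /finset.set1P ->.
Qed.

End VertexToEdge.

(* Connector ignores the edges outside [G], and Breaker's claims there. *)
Lemma connector_wins_mono m b n (G G' : edges n) :
  G \subset G' -> connector_wins m b G -> connector_wins m b G'.
Proof.
move=> GG [s win].
pose cut (h : history n) : history n := [seq (r.1, r.2 :&: G)%SET | r <- h].
pose s' h := s (cut h).
exists s' => B legB; pose B0 i := (B i :&: G)%SET.
have playE k : cut (play s' B k) = play s B0 k.
  by elim: k => //= k IH; rewrite /cut map_rcons -/(cut _) /= /s' IH.
have CE h : connector_edges (cut h) = connector_edges h by rewrite /connector_edges big_map.
have BE h : breaker_edges (cut h) = (breaker_edges h :&: G)%SET.
  rewrite /breaker_edges; elim: h => [|r h IH]; first by rewrite !big_nil finset.set0I.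
  by rewrite /= !big_cons IH finset.setIUl.
have sE k : s' (play s' B k) = s (play s B0 k) by rewrite /s' playE.
have unE k : unclaimed G (play s B0 k) = (unclaimed G' (play s' B k) :&: G)%SET.
  rewrite /unclaimed -playE CE BE; apply/setP => e; rewrite !inE.
  by have /implyP := subsetP GG e; case: (e \in G); case: (e \in G'); rewrite ?andbF ?andbT.
have [|legC [k [T st TC]]] := win B0.
  move=> i; have [BU Bb] := legB i; split.
    apply/subsetP => e; rewrite inE => /andP[eB eG].
    have := subsetP BU e eB; rewrite -sE unE => /finset.setDP[eU eX].
    by apply/finset.setDP; split; rewrite // inE eU.
  by apply: leq_trans Bb; apply/subset_leq_card/finset.subsetIl.
split.
  move=> i; have [XU Xm Xc] := legC i; rewrite /connector_legal sE -CE playE; split=> //.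
  by apply: subset_trans XU _; rewrite unE finset.subsetIl.
exists k, T; last by rewrite -CE playE.
by case: st => TG conT aT; split=> //; apply: subset_trans GG.
Qed.

(** * Integer roots and logarithms *)

Definition floor_root (J n : nat) : nat := \max_(k < n.+1 | k ^ (6 * J) <= n) k.

Definition lg (n : nat) : nat := (trunc_log 2 n).+1.

Lemma floor_root_le J n : 0 < J -> floor_root J n ^ (6 * J) <= n.
Proof.
move=> J0; rewrite /floor_root; elim/big_ind: _ => // [|a b an bn].
  by rewrite exp0n // muln_gt0.
by rewrite /maxn; case: ifP.
Qed.

Lemma floor_root_gt J n : 0 < J -> n < (floor_root J n).+1 ^ (6 * J).
Proof.
move=> J0; rewrite ltnNge; apply/negP => le.
have d0 : 0 < 6 * J by rewrite muln_gt0.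
have rn : (floor_root J n).+1 < n.+1.
  by rewrite ltnS; apply: leq_trans le; rewrite -[X in X <= _]expn1 leq_pexp2l.
have := @leq_bigmax_cond _ (fun k : 'I_n.+1 => k ^ (6 * J) <= n) (fun k => nat_of_ord k) (Ordinal rn) le.
by rewrite -/(floor_root J n) ltnn.
Qed.

Lemma floor_root_gt0 J n : 0 < J -> 0 < n -> 0 < floor_root J n.
Proof.
move=> J0 n0; have := floor_root_gt n J0; case: (floor_root J n) => //.
by rewrite exp1n; case: n n0.
Qed.

Lemma floor_root_upper J n : 0 < J -> 0 < n -> n <= 64 ^ J * floor_root J n ^ (6 * J).
Proof.
move=> J0 n0; apply: leq_trans (ltnW (floor_root_gt n J0)) _.
have -> : 64 ^ J = 2 ^ (6 * J) by rewrite expnM.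
rewrite -expnMn leq_exp2r ?muln_gt0 //.
by have := floor_root_gt0 J0 n0; lia.
Qed.

Lemma lg_gt n : n < 2 ^ lg n.
Proof. exact: trunc_log_ltn. Qed.

Lemma lg_le n : 0 < n -> 2 ^ (lg n).-1 <= n.
Proof. by move=> n0; apply: trunc_logP. Qed.

Lemma lg_ge k n : 2 ^ k <= n -> k < lg n.
Proof. by move=> kn; rewrite -(@ltn_exp2l 2) //; apply: leq_ltn_trans kn (lg_gt n). Qed.

Lemma linear_leq_exp A B u : 2 * (A + 3 * B + 1) <= u -> A + B * u <= 2 ^ u.
Proof.
move=> Hu; pose w := u./2.
have uw : 2 * w <= u <= 2 * w + 1 by have := odd_double_half u; rewrite -/w; lia.
have w2 : w.+1 <= 2 ^ w by apply: ltn_expl.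
apply: (@leq_trans (2 ^ w * 2 ^ w)); last by rewrite -expnD leq_pexp2l //; lia.
apply: (@leq_trans (w * w)); last by apply: leq_mul; lia.
have Aw : A + 3 * B + 1 <= w by lia.
have : (A + 3 * B + 1) * w <= w * w by rewrite leq_mul2r Aw orbT.
have : B * u <= B * (2 * w + 1) by rewrite leq_mul2l; apply/orP; right; lia.
clear -Aw; nia.
Qed.

(** On the binary scale the root is at least 2^u with u about [lg n] divided by [6 * J], which beats
    every linear function of [lg n]. *)
Lemma floor_root_growth J A B : 0 < J -> exists n0, forall n, n0 <= n -> A + B * lg n <= floor_root J n.
Proof.
move=> J0; set d := 6 * J; have d0 : 0 < d by rewrite muln_gt0.
pose u0 := 2 * ((A + B * d) + 3 * (B * d) + 1).
exists (2 ^ (d * u0)) => n nn; rewrite leqNgt; apply/negP => lt.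
have n0 : 0 < n by apply: leq_trans nn; rewrite expn_gt0.
have lgn := lg_ge nn.
pose u := (lg n).-1 %/ d.
have uu : u0 <= u by rewrite leq_divRL // mulnC; lia.
have lu : lg n <= d * u + d.
  by have := ltn_ceil (lg n).-1 d0; rewrite -/u mulSn mulnC; lia.
have : (2 ^ u) ^ d < (A + B * lg n) ^ d.
  apply: leq_ltn_trans (leq_trans _ (lg_le n0)) (leq_trans (floor_root_gt n J0) _).
    by rewrite -expnM leq_exp2l // leq_divM.
  by rewrite leq_exp2r.
rewrite ltn_exp2r // ltnNge => /negP; apply.
apply: leq_trans (linear_leq_exp uu).
by rewrite -addnA leq_add2l -mulnA -mulnDr leq_mul2l (addnC d) lu orbT.
Qed.

Local Open Scope ring_scope.

(** * Box game: keeping Breaker's degrees small *)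

Section Powers.
Variable R : realFieldType.
Implicit Types x a : R.

Lemma bernoulli_ge x m : 0 <= x -> 1 + m%:R * x <= (1 + x) ^+ m.
Proof.
move=> x0; elim: m => [|m IH]; first by rewrite mul0r addr0 expr0.
rewrite exprS -(natr1 m) mulrDl mul1r; have m0 : 0 <= m%:R :> R by rewrite ler0n.
have : (1 + x) * (1 + m%:R * x) <= (1 + x) * (1 + x) ^+ m by rewrite ler_wpM2l // addr_ge0.
have : 0 <= m%:R * x * x by rewrite !mulr_ge0.
move: (m%:R * x) ((1 + x) ^+ m) => y w; lra.
Qed.

Lemma bernoulli_le x m : 0 <= x -> 2 * (m%:R * x) <= 1 -> (1 + x) ^+ m <= 1 + 2 * (m%:R * x).
Proof.
move=> x0; elim: m => [|m IH]; first by rewrite mul0r mulr0 addr0 expr0.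
rewrite exprS -(natr1 m) (mulrDl m%:R 1 x) mul1r => h.
have m0 : 0 <= m%:R * x by rewrite mulr_ge0 // ler0n.
have /IH le : 2 * (m%:R * x) <= 1 by lra.
have : (1 + x) * (1 + x) ^+ m <= (1 + x) * (1 + 2 * (m%:R * x)).
  by rewrite ler_wpM2l // addr_ge0.
have : 2 * (m%:R * x) * x <= 1 * x by rewrite ler_wpM2r //; lra.
move: (m%:R * x) ((1 + x) ^+ m) => y w; lra.
Qed.

(** A substitute for the exponential bound: with Bernoulli's inequality it gives (1 - x)^m <= 1 / (1
    + m x). *)
Lemma pow_subM_add_le1 x m : 0 <= x <= 1 -> (1 - x) ^+ m * (1 + x) ^+ m <= 1.
Proof.
case/andP=> x0 x1; rewrite -exprMn; apply: exprn_ile1.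
  by rewrite mulr_ge0 ?subr_ge0 // addr_ge0.
by rewrite (_ : (1 - x) * (1 + x) = 1 - x * x); [rewrite lerBlDr lerDl mulr_ge0|ring].
Qed.

(** As (a^d - 1)(a^m - 1) is nonnegative, the worst case concentrates all degrees in one vertex. *)
Lemma sum_pow_sub1 (I : finType) (P : pred I) (d : I -> nat) a : 1 <= a ->
  \sum_(i | P i) (a ^+ d i - 1) <= a ^+ (\sum_(i | P i) d i)%N - 1.
Proof.
move=> a1; elim/big_rec2: _ => [|i s m _ IH]; first by rewrite expr0 subrr.
rewrite exprD; have : 0 <= (a ^+ d i - 1) * (a ^+ m - 1).
  by rewrite mulr_ge0 // subr_ge0 exprn_ege1.
move: IH; move: (a ^+ d i) (a ^+ m) => u w; lra.
Qed.

End Powers.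

Section Potential.
Variables (R : realFieldType) (V : finType) (G : {set {set V}}) (a : R) (T : nat).
Hypothesis G2 : simple_graph G.
Hypothesis a1 : 1 <= a.
Hypothesis aT : a ^+ (4 * T) <= 2.

Definition potential (C : {set V}) (BE : {set {set V}}) : R :=
  \sum_(z | z \notin C) a ^+ edge_degree BE z.

Lemma sum_edge_degree (Z : {set {set V}}) : Z \subset G ->
  (\sum_z edge_degree Z z = 2 * #|Z|)%N.
Proof.
move=> ZG; rewrite /edge_degree.
have E z : #|[set e in Z | z \in e]| = (\sum_(e in Z) (z \in e))%N.
  by rewrite -sum1_card big_mkcond [RHS]big_mkcond /=; apply: eq_bigr => e _; rewrite inE; case: (e \in Z); case: (z \in e).
under eq_bigr do rewrite E.
rewrite exchange_big /= mulnC -sum_nat_const; apply: eq_bigr => e eZ.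
by rewrite -(G2 (subsetP ZG _ eZ)) -sum1_card [RHS]big_mkcond.
Qed.

Lemma edge_degreeU (BE Z : {set {set V}}) z :
  (edge_degree (BE :|: Z) z <= edge_degree BE z + edge_degree Z z)%N.
Proof.
rewrite /edge_degree; apply: leq_trans (leq_card_setU _ _).1.
by apply/subset_leq_card/subsetP => e; rewrite !inE andb_orl.
Qed.

(* Box game: the vertex [v] that leaves the outside of [C] carried the largest
   weight, which pays for the [4 T] new incidences. *)
Lemma potential_phase (C C' : {set V}) (BE Z : {set {set V}}) v :
  v \notin C -> (forall z, z \notin C -> (edge_degree BE z <= edge_degree BE v)%N) ->
  C \subset C' -> v \in C' -> Z \subset G -> (#|Z| <= 2 * T)%N ->
  potential C' (BE :|: Z) <= potential C BE.
Proof.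
move=> vC vmax CC' vC' ZG Z2; set M := edge_degree BE v in vmax.
have a0 : 0 <= a by rewrite (le_trans ler01).
have C'C z : z \notin C' -> z \notin C by apply: contra => /(subsetP CC').
have le1 : potential C' (BE :|: Z) <=
    \sum_(z | z \notin C') (a ^+ edge_degree BE z + a ^+ M * (a ^+ edge_degree Z z - 1)).
  apply: ler_sum => z zC'.
  apply: (@le_trans _ _ (a ^+ edge_degree BE z * a ^+ edge_degree Z z)).
    by rewrite -exprD ler_weXn2l // edge_degreeU.
  have : a ^+ edge_degree BE z <= a ^+ M by rewrite ler_weXn2l // vmax // C'C.
  have : 1 <= a ^+ edge_degree Z z by rewrite exprn_ege1.
  move: (a ^+ edge_degree BE z) (a ^+ M) (a ^+ edge_degree Z z) => x y w w1 xy.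
  have : x * (w - 1) <= y * (w - 1) by rewrite ler_wpM2r // subr_ge0.
  lra.
apply: le_trans le1 _; rewrite big_split /= -mulr_sumr.
have le2 : \sum_(z | z \notin C') a ^+ edge_degree BE z + a ^+ M <= potential C BE.
  rewrite /potential [X in _ <= X](bigD1 v) //= addrC -/M lerD2r.
  rewrite [X in X <= _]big_mkcond [X in _ <= X]big_mkcond; apply: ler_sum => z _.
  case: (boolP (z \notin C')) => zC'; last by case: ifP => // _; rewrite exprn_ge0.
  by rewrite C'C //=; case: eqP zC' => // ->; rewrite vC'.
(* The removed vertex has freed [a ^+ M]; the increase is at most this weight times
   [a ^+ (4 * T) - 1], which is at most one. *)
apply: le_trans le2; rewrite lerD2l.
rewrite -[X in _ <= X]mulr1 ler_wpM2l ?exprn_ge0 //.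
apply: le_trans (sum_pow_sub1 _ _ a1) _.
have : a ^+ (\sum_(i | i \notin C') edge_degree Z i)%N <= a ^+ (4 * T).
  rewrite ler_weXn2l //; apply: (@leq_trans (\sum_i edge_degree Z i)%N).
    by rewrite [X in (_ <= X)%N](bigID (fun i => i \notin C')) leq_addr.
  rewrite sum_edge_degree //; by move: Z2; clear; lia.
by move=> /le_trans/(_ aT); rewrite lerBlDr.
Qed.

End Potential.

Section ConnectAll.
Variables (R : realFieldType) (V : finType) (G : {set {set V}}) (q J l : nat).
Hypothesis G2 : simple_graph G.
Hypothesis exG : expanding G q J.
Hypothesis J0 : (0 < J)%N.
Hypothesis Vl : (#|V| < 2 ^ l)%N.
Let T := (J + 2)%N.
Let L := (8 * T * l)%N.
Hypothesis hq : (2 * L + 35 * 2 ^ J + 2 * J + 40 <= q)%N.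

(** The base meets two demands. A phase of [T] rounds brings [2 * T] Breaker edges, so [4 * T]
    incidences, and [a ^+ (4 * T) <= 2] lets one vertex pay for them; [2 <= a ^+ (8 * T)] turns a
    potential below [2 ^+ l] into degrees of at most [8 * T * l]. *)
Let a : R := 1 + (8 * T)%:R^-1.

Lemma a_ge1 : 1 <= a.
Proof. by rewrite lerDl invr_ge0 ler0n. Qed.

Lemma T8_neq0 : (8 * T)%:R != 0 :> R.
Proof. by rewrite pnatr_eq0 muln_eq0 /T addn2. Qed.

Lemma a_pow_le2 : a ^+ (4 * T) <= 2.
Proof.
have E : 2 * ((4 * T)%:R * (8 * T)%:R^-1) = 1 :> R.
  by rewrite mulrA -natrM mulnA divff // T8_neq0.
have := @bernoulli_le R (8 * T)%:R^-1 (4 * T); rewrite E invr_ge0 ler0n.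
by move=> /(_ isT (lexx _)) /le_trans; apply; lra.
Qed.

Lemma a_pow_ge2 : 2 <= a ^+ (8 * T).
Proof.
have := @bernoulli_ge R (8 * T)%:R^-1 (8 * T); rewrite divff ?T8_neq0 // invr_ge0 ler0n.
by move=> /(_ isT); apply: le_trans; lra.
Qed.

Lemma potential_degree (C : {set V}) BE z : potential a C BE <= #|V|%:R -> z \notin C ->
  (edge_degree BE z <= L)%N.
Proof.
move=> pV zC; have a1 := a_ge1; have a0 : 0 <= a by rewrite (le_trans ler01).
rewrite leqNgt; apply/negP => Lz.
have : a ^+ edge_degree BE z <= #|V|%:R.
  apply: le_trans pV; rewrite /potential (bigD1 z) //= lerDl sumr_ge0 // => i _.
  by rewrite exprn_ge0.
have : a ^+ L <= a ^+ edge_degree BE z by rewrite ler_weXn2l // ltnW.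
have : 2 ^+ l <= a ^+ L :> R.
  by rewrite /L exprM lerXn2r ?nnegrE ?exprn_ge0 ?a_pow_ge2 // ler0n.
have : #|V|%:R < 2 ^+ l :> R by rewrite -natrX ltr_nat.
by move=> h1 h2 h3 h4; have := lt_le_trans h1 (le_trans h2 (le_trans h3 h4)); rewrite ltxx.
Qed.

(** The bound on [BE] persists because a phase adds at least one vertex to [C] and at most [2 * T]
    edges to [BE]. *)
Lemma connect_all_from m (C : {set V}) (BE : {set {set V}}) :
  (#|~: C| <= m)%N -> (0 < #|C|)%N -> (#|BE| <= 2 * T * #|C|)%N ->
  potential a C BE <= #|V|%:R ->
  forces G (m * T) (fun C' _ => C' = setT) C BE.
Proof.
elim: m C BE => [|m IH] C BE.
  by rewrite leqn0 cards_eq0 => /eqP C0 _ _ _ /=; rewrite -(setCK C) C0 setC0.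
move=> mC C0 BEC pV.
have [->|CT] := eqVneq C setT; first exact: forces_now.
have [v0 v0C] : exists v0, v0 \notin C.
  by move: CT; rewrite -subTset => /subsetPn[x _ xC]; exists x.
pose v := [arg max_(z > v0 | z \notin C) edge_degree BE z]%N.
have [vC vmax] : v \notin C /\ forall z, z \notin C -> (edge_degree BE z <= edge_degree BE v)%N.
  by rewrite /v; case: arg_maxnP.
have degL z : z \notin C -> (edge_degree BE z <= L)%N by apply: potential_degree.
have ph := forces_grow (phase G2 exG J0 hq vC C0 degL BEC).
rewrite mulSn; apply: forces_trans ph _ => C' BE' [vC' CC' [Z [ZG Z2] ->]].
have CltC' : (#|C| < #|C'|)%N.
  by apply/proper_card; rewrite properE CC'; apply/subsetPn; exists v.
apply: IH.
- by have := cardsC C; have := cardsC C'; move: mC CltC'; clear; lia.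
- exact: leq_trans CltC'.
- apply: leq_trans (leq_card_setU _ _).1 _; apply: leq_trans (leq_add BEC Z2) _.
  by rewrite -/T addnC -mulnS leq_mul2l CltC' orbT.
- by apply: le_trans (potential_phase G2 a_ge1 a_pow_le2 vC vmax CC' vC' ZG Z2) pV.
Qed.

Lemma connect_all u : forces G (#|V| * T) (fun C _ => C = setT) [set u] set0.
Proof.
apply: connect_all_from; rewrite ?cards1 ?cards0 //.
  exact: max_card.
have deg0 z : edge_degree (set0 : {set {set V}}) z = 0%N.
  by apply/eqP; rewrite cards_eq0; apply/eqP/setP => e; rewrite !inE.
rewrite /potential; under eq_bigr do rewrite deg0 expr0.
by rewrite sumr_const ler_nat max_card.
Qed.

End ConnectAll.

(** * Random subsets *)

Section RandomSubset.
Variables (R : realFieldType) (T : finType).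
Implicit Types (p : R) (l : seq T) (f g : {set T} -> R).

(* The expectation of [f] at the random subset of [l] that contains each element
   independently with probability [p]. *)
Fixpoint expect p l f : R :=
  if l is e :: l' then p * expect p l' (fun S => f (e |: S)) + (1 - p) * expect p l' f
  else f set0.

Lemma expect_sum p l f : uniq l ->
  \sum_(S : {set T} | S \subset [set x in l]) (\prod_(e <- l) (if e \in S then p else 1 - p)) * f S
  = expect p l f.
Proof.
elim: l f => [|e l IH] f /=.
  move=> _; rewrite (big_pred1 set0) ?big_nil ?mul1r // => S /=.
  have -> : [set x in [::]] = set0 :> {set T} by apply/setP => x; rewrite !inE.
  by rewrite subset0.
case/andP=> el ul; rewrite (bigID (fun S : {set T} => e \in S)) /=; congr (_ + _).
  rewrite -IH // mulr_sumr.
  rewrite (reindex_onto (fun S : {set T} => e |: S) (fun S => S :\ e)) /=; last first.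
    by move=> S /andP[_ eS]; rewrite setD1K.
  apply: eq_big => [S|S SP].
    rewrite setU11 andbT; apply/andP/idP => [[/subsetP sub /eqP Se]|/subsetP sub].
      apply/subsetP => x xS; have := sub x; rewrite !inE xS orbT => /(_ isT) /orP[/eqP xe|//].
      by move: xS; rewrite xe -Se !inE eqxx.
    have eS : e \notin S by apply: contra el => /sub; rewrite inE.
    split; last by rewrite setU1K.
    by apply/subsetP => x; rewrite !inE => /orP[->//|/sub]; rewrite inE => ->; rewrite orbT.
  rewrite big_cons setU11 mulrA; congr (_ * _ * _).
  apply: eq_big_seq => x xl; rewrite !inE.
  by have -> : (x == e) = false by apply: contraNF el => /eqP <-.
rewrite -IH // mulr_sumr; apply: eq_big => [S|S /andP[_ eS]].
  apply/andP/idP => [[/subsetP sub eS]|/subsetP sub].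
    apply/subsetP => x xS; have := sub x xS; rewrite !inE => /orP[/eqP xe|//].
    by rewrite -xe xS in eS.
  split; last by apply: contra el => /sub; rewrite inE.
  by apply/subsetP => x /sub; rewrite !inE => ->; rewrite orbT.
by rewrite big_cons (negPf eS) mulrA.
Qed.

Lemma eq_expect p l f g : (forall S : {set T}, S \subset [set x in l] -> f S = g S) ->
  expect p l f = expect p l g.
Proof.
elim: l f g => [|e l IH] f g fg /=; first by rewrite fg // sub0set.
congr (_ * _ + _ * _); apply: IH => S /subsetP Sl; apply: fg.
  by apply/subsetP => x; rewrite !inE => /orP[->//|/Sl]; rewrite inE => ->; rewrite orbT.
by apply/subsetP => x /Sl; rewrite !inE => ->; rewrite orbT.
Qed.

Lemma le_expect p l f g : 0 <= p <= 1 ->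
  (forall S : {set T}, S \subset [set x in l] -> f S <= g S) -> expect p l f <= expect p l g.
Proof.
case/andP=> p0 p1; elim: l f g => [|e l IH] f g fg /=; first by rewrite fg // sub0set.
apply: lerD; (apply: ler_wpM2l; [by rewrite ?subr_ge0|apply: IH => S /subsetP Sl; apply: fg]).
  by apply/subsetP => x; rewrite !inE => /orP[->//|/Sl]; rewrite inE => ->; rewrite orbT.
by apply/subsetP => x /Sl; rewrite !inE => ->; rewrite orbT.
Qed.

Lemma expectD p l f g : expect p l (fun S => f S + g S) = expect p l f + expect p l g.
Proof. by elim: l f g => [|e l IH] f g //=; rewrite !IH; ring. Qed.

Lemma expectZ p l c f : expect p l (fun S => c * f S) = c * expect p l f.
Proof. by elim: l f => [|e l IH] f //=; rewrite !IH; ring. Qed.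

Lemma expect_cst p l c : expect p l (fun=> c) = c.
Proof. by elim: l => //= e l ->; ring. Qed.

Lemma expect_bigsum p l (I : Type) (s : seq I) (P : pred I) (F : I -> {set T} -> R) :
  expect p l (fun S => \sum_(i <- s | P i) F i S) = \sum_(i <- s | P i) expect p l (F i).
Proof.
elim: s => [|i s IH].
  rewrite big_nil -[RHS](expect_cst p l); apply: eq_expect => S _; exact: big_nil.
rewrite big_cons -IH; case: ifP => Pi; last first.
  by apply: eq_expect => S _; rewrite big_cons Pi.
by rewrite -expectD; apply: eq_expect => S _; rewrite big_cons Pi.
Qed.

Lemma expect_ge0 p l f : 0 <= p <= 1 -> (forall S, 0 <= f S) -> 0 <= expect p l f.
Proof. by move=> p01 f0; rewrite -[X in X <= _](expect_cst p l); apply: le_expect. Qed.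

(** An element belongs to the union of two independent random sets with probability p1 + p2 - p1
    p2. *)
Lemma expect_union p1 p2 l f :
  expect (p1 + p2 - p1 * p2) l f = expect p1 l (fun A => expect p2 l (fun B => f (A :|: B))).
Proof.
elim: l f => [|e l IH] f /=; first by rewrite setU0.
rewrite !IH; under [in RHS]eq_expect => A _.
  rewrite (_ : expect p2 l (fun B => f (e |: A :|: (e |: B))) =
    expect p2 l (fun B => f (e |: (A :|: B)))); last first.
    by apply: eq_expect => B _; rewrite setUACA setUid.
  rewrite (_ : expect p2 l (fun B => f (e |: A :|: B)) =
    expect p2 l (fun B => f (e |: (A :|: B)))); last first.
    by apply: eq_expect => B _; rewrite setUA.
  over.
under [X in _ = _ + _ * X]eq_expect => A _.
  rewrite (_ : expect p2 l (fun B => f (A :|: (e |: B))) =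
    expect p2 l (fun B => f (e |: (A :|: B)))); last first.
    by apply: eq_expect => B _; rewrite setUCA.
  over.
by rewrite !expectD !expectZ; ring.
Qed.

Definition depends_on (D : {set T}) f := forall A B : {set T}, A :&: D = B :&: D -> f A = f B.

(** The head of the list lies in at most one of [D] and [D'], so at least one factor ignores it. *)
Lemma expect_indep p l f g (D D' : {set T}) : [disjoint D & D'] -> depends_on D f -> depends_on D' g ->
  expect p l (fun S => f S * g S) = expect p l f * expect p l g.
Proof.
move=> dd; elim: l f g => [|e l IH] f g fD gD //=.
have shift (h : {set T} -> R) (X : {set T}) : depends_on X h -> depends_on X (fun S => h (e |: S)).
  by move=> hX A B AB; apply: hX; rewrite !setIUl AB.
have const (h : {set T} -> R) (X : {set T}) : depends_on X h -> e \notin X ->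
    expect p l (fun S => h (e |: S)) = expect p l h.
  move=> hX eX; apply: eq_expect => S _; apply: hX; rewrite setIUl.
  rewrite (_ : [set e] :&: X = set0) ?set0U //; apply: disjoint_setI0.
  by rewrite disjoints1.
rewrite (IH _ _ (shift _ _ fD) (shift _ _ gD)) (IH _ _ fD gD).
have [eD|eD] := boolP (e \in D).
  by rewrite (const g D' gD) ?(disjointFr dd eD) //; ring.
by rewrite (const f D fD eD); ring.
Qed.

Lemma expect_prod p l (I : eqType) (s : seq I) (D : I -> {set T}) (F : I -> {set T} -> R) :
  uniq s -> (forall i j, i \in s -> j \in s -> i != j -> [disjoint D i & D j]) ->
  (forall i, i \in s -> depends_on (D i) (F i)) ->
  expect p l (fun S => \prod_(i <- s) F i S) = \prod_(i <- s) expect p l (F i).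
Proof.
elim: s => [|i s IH] /=.
  move=> _ _ _; rewrite big_nil -[RHS](expect_cst p l); apply: eq_expect => S _; exact: big_nil.
case/andP=> iNs us dD FD; rewrite big_cons -IH //; last 2 first.
- by move=> j k js ks; apply: dD; rewrite inE ?js ?ks orbT.
- by move=> j js; apply: FD; rewrite inE js orbT.
have -> : expect p l (fun S => \prod_(j <- i :: s) F j S) =
    expect p l (fun S => F i S * \prod_(j <- s) F j S).
  by apply: eq_expect => S _; rewrite big_cons.
apply: (@expect_indep _ _ _ _ (D i) (\bigcup_(j <- s) D j)).
- rewrite disjoint_sym big_seq; elim/big_rec: _ => [|j X js IHX].
    by rewrite disjoints_subset sub0set.
  rewrite disjoints_subset subUset -!disjoints_subset IHX andbT.
  apply: dD; rewrite ?inE ?eqxx ?js ?orbT //.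
  by apply: contraNneq iNs => <-.
- by apply: FD; rewrite inE eqxx.
move=> A B AB; apply: eq_big_seq => j js; apply: FD; first by rewrite inE js orbT.
have Dj : D j \subset \bigcup_(j <- s) D j.
  by rewrite (big_rem j js) /= subsetUl.
by rewrite -(setIidPr Dj) !setIA AB.
Qed.

Lemma expect_mem p l e : uniq l -> e \in l -> expect p l (fun S => (e \in S)%:R) = p.
Proof.
elim: l => //= x l IH /andP[xl ul]; rewrite inE => /orP[/eqP ->|el].
  rewrite (_ : expect p l (fun S => (x \in x |: S)%:R) = 1); last first.
    by rewrite -[RHS](expect_cst p l); apply: eq_expect => S _; rewrite setU11.
  rewrite (_ : expect p l (fun S => (x \in S)%:R) = 0) ?mulr0 ?mulr1 ?addr0 //.
  rewrite -[RHS](expect_cst p l); apply: eq_expect => S /subsetP Sl.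
  by rewrite (_ : x \in S = false) //; apply: contraNF xl => /Sl; rewrite inE.
rewrite (_ : expect p l (fun S => (e \in x |: S)%:R) = expect p l (fun S => (e \in S)%:R)).
  by rewrite IH //; ring.
apply: eq_expect => S _; rewrite !inE.
by have -> : (e == x) = false by apply: contraNF xl => /eqP <-.
Qed.

Lemma expect_notin p l e : uniq l -> e \in l -> expect p l (fun S => (e \notin S)%:R) = 1 - p.
Proof.
move=> ul el; transitivity (expect p l (fun S => 1 + -1 * (e \in S)%:R)).
  by apply: eq_expect => S _; case: (e \in S); rewrite /= ?mulr1 ?mulr0 ?subrr ?addr0.
by rewrite expectD expectZ expect_cst expect_mem // mulN1r.
Qed.

Lemma prod_bool (I : Type) (s : seq I) (P : pred I) :
  \prod_(i <- s) (P i)%:R = (all P s)%:R :> R.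
Proof. by elim: s => [|i s IH]; rewrite ?big_nil ?big_cons //= IH; case: (P i); rewrite ?mul1r ?mul0r. Qed.

Lemma expect_all p l (h : T -> bool -> bool) (c : R) (D : {set T}) : uniq l -> D \subset [set x in l] ->
  (forall e, e \in l -> expect p l (fun S => (h e (e \in S))%:R) = c) ->
  expect p l (fun S => [forall e in D, h e (e \in S)]%:R) = c ^+ #|D|.
Proof.
move=> ul /subsetP Dl hc.
transitivity (expect p l (fun S => \prod_(e <- enum D) (h e (e \in S))%:R)).
  apply: eq_expect => S _; rewrite prod_bool; congr (nat_of_bool _)%:R.
  apply/forall_inP/allP => H e; first by rewrite mem_enum; exact: H.
  by move=> eD; apply: H; rewrite mem_enum.
rewrite (@expect_prod _ _ _ _ (fun e => [set e])) ?enum_uniq //; last 2 first.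
- by move=> i j _ _ ij; rewrite disjoints1 inE.
- by move=> i _ A B /setP/(_ i); rewrite !inE eqxx !andbT => ->.
rewrite (eq_big_seq (fun=> c)) ?big_const_seq ?count_predT -?cardE.
  by rewrite -Monoid.iteropE.
by move=> e; rewrite mem_enum => /Dl; rewrite inE; exact: hc.
Qed.

Lemma expect_subset p l (D : {set T}) : uniq l -> D \subset [set x in l] ->
  expect p l (fun S => (D \subset S)%:R) = p ^+ #|D|.
Proof.
move=> ul Dl; rewrite -(@expect_all p l (fun _ b => b) p D ul Dl).
  apply: eq_expect => S _; congr (nat_of_bool _)%:R.
  by apply/subsetP/forall_inP.
by move=> e; exact: expect_mem.
Qed.

Lemma expect_disjoint p l (D : {set T}) : uniq l -> D \subset [set x in l] ->
  expect p l (fun S => [disjoint D & S]%:R) = (1 - p) ^+ #|D|.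
Proof.
move=> ul Dl; rewrite -(@expect_all p l (fun _ b => ~~ b) (1 - p) D ul Dl).
  apply: eq_expect => S _; congr (nat_of_bool _)%:R.
  by rewrite disjoints_subset; apply/subsetP/forall_inP => H e /H; rewrite inE.
by move=> e; exact: expect_notin.
Qed.

Lemma expect_exists p l (I : finType) (P : pred I) (F : I -> {set T} -> bool) : 0 <= p <= 1 ->
  expect p l (fun S => [exists i, P i && F i S]%:R) <= \sum_(i | P i) expect p l (fun S => (F i S)%:R).
Proof.
move=> p01; rewrite -expect_bigsum; apply: le_expect => // S _.
case: existsP => [[i /andP[Pi Fi]]|_]; last by rewrite sumr_ge0.
by rewrite (bigD1 i) //= Fi lerDl sumr_ge0.
Qed.

End RandomSubset.

(** * Increasing events *)

Section IncreasingEvent.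
Variables (R : realFieldType) (T : finType) (l : seq T) (F : {set T} -> bool).
Hypothesis Fmono : forall A B : {set T}, A \subset B -> F A -> F B.

Definition prob (p : R) : R := expect p l (fun S => (F S)%:R).

Lemma prob_01 p : 0 <= p <= 1 -> 0 <= prob p <= 1.
Proof.
move=> p01; apply/andP; split; first by apply: expect_ge0 => // S; rewrite ler0n.
rewrite -[X in _ <= X](expect_cst p l); apply: le_expect => // S _.
by case: (F S); rewrite ?ler01.
Qed.

Lemma prob_union p1 p2 : 0 <= p1 <= 1 -> 0 <= p2 <= 1 ->
  prob p1 <= prob (p1 + p2 - p1 * p2) /\
  1 - prob (p1 + p2 - p1 * p2) <= (1 - prob p1) * (1 - prob p2).
Proof.
move=> p1_01 p2_01; rewrite /prob expect_union; split.
  apply: le_expect => // A _; rewrite -[X in X <= _](expect_cst p2 l); apply: le_expect => // B _.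
  by rewrite ler_nat; case FA: (F A) => //; rewrite (Fmono (subsetUl A B)).
have neg p f : 1 - expect p l f = expect p l (fun S => 1 - f S).
  transitivity (expect p l (fun S => 1 + -1 * f S)).
    by rewrite expectD expectZ expect_cst mulN1r.
  by apply: eq_expect => S _; rewrite mulN1r.
rewrite !neg mulrC -expectZ; apply: le_expect => // A _; rewrite neg mulrC -expectZ.
apply: le_expect => // B _.
case FA: (F A); first by rewrite (Fmono (subsetUl A B)) // !subrr mul0r.
case FB: (F B); first by rewrite (Fmono (subsetUr A B)) // !subrr mulr0.
by rewrite !subr0 mulr1 gerBl ler0n.
Qed.

(** The parameter [r] is chosen so that a [p]-random set united with an independent [r]-random set
    is [q]-random. *)
Lemma prob_le p q : 0 <= p -> p <= q -> q <= 1 -> prob p <= prob q.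
Proof.
move=> p0 pq q1; have [p1|p1] := ltP p 1; last first.
  by have -> : q = p by apply/le_anti; rewrite pq (le_trans q1).
pose r := (q - p) / (1 - p).
have p'0 : 0 < 1 - p by rewrite subr_gt0.
have r01 : 0 <= r <= 1.
  by rewrite divr_ge0 ?subr_ge0 // ?(ltW p1) //= ler_pdivrMr // mul1r lerD2r.
have -> : q = p + r - p * r.
  by rewrite /r; field; rewrite gt_eqF.
by apply: (prob_union _ r01).1; rewrite p0 ltW.
Qed.

(* [m] independent copies with parameter [p] together have parameter at most [m p]. *)
Lemma prob_multiple p q m : 0 <= p <= 1 -> m%:R * p <= q -> q <= 1 ->
  1 - prob q <= (1 - prob p) ^+ m.
Proof.
move=> p01 mpq q1; have [p0 p1] := andP p01.
suff [r r01 [rm fr]] : exists2 r, 0 <= r <= 1 & r <= m%:R * p /\ 1 - prob r <= (1 - prob p) ^+ m.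
  apply: le_trans fr; rewrite lerB // prob_le //; first by case/andP: r01.
  exact: le_trans mpq.
elim: m {q mpq q1} => [|m [r r01 [rm fr]]].
  exists 0; rewrite ?lexx ?ler01 // mul0r lexx expr0; split=> //.
  by rewrite gerBl; case/andP: (prob_01 (p := 0) ltac:(by rewrite lexx ler01)).
have [r0 r1] := andP r01.
have pr0 : 0 <= p * r by rewrite mulr_ge0.
have q1' : 0 <= (1 - p) * (1 - r) by rewrite mulr_ge0 // subr_ge0.
exists (p + r - p * r); last split.
- have pr1 : p * r <= p by rewrite -[X in _ <= X]mulr1 ler_wpM2l.
  move: q1' pr1 r0; rewrite mulrBl mul1r !mulrBr !mulr1; lra.
- by rewrite -natr1 mulrDl mul1r; lra.
rewrite exprS; apply: le_trans (prob_union p01 r01).2 _.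
by rewrite ler_wpM2l // subr_ge0; case/andP: (prob_01 p01).
Qed.

End IncreasingEvent.

(** * Sparsity below the threshold *)

Lemma bin_leq_expn n k : ('C(n, k) <= n ^ k)%N.
Proof.
have ff : (n ^_ k <= n ^ k)%N.
  elim: k => // k IH; rewrite ffactnSr expnSr; apply: leq_mul IH (leq_subr _ _).
by apply: leq_trans ff; rewrite -bin_ffact leq_pmulr // fact_gt0.
Qed.

Lemma sum_small_sets (R : realFieldType) (T : finType) (P : pred {set T}) (N : nat)
    (f : {set T} -> R) (c : nat -> R) :
  (forall S, P S -> (#|S| <= N)%N) -> (forall S, P S -> f S <= c #|S|) ->
  (forall k, 0 <= c k) ->
  \sum_(S | P S) f S <= \sum_(k < N.+1) #|T|%:R ^+ k * c k.
Proof.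
move=> PN fc c0.
rewrite (partition_big (fun S : {set T} => inord #|S| : 'I_N.+1) xpredT) //=.
apply: ler_sum => k _; apply: (@le_trans _ _ (\sum_(S : {set T} | #|S| == k) c k)).
  rewrite [X in X <= _]big_mkcond [X in _ <= X]big_mkcond /=; apply: ler_sum => S _.
  case: ifP => [/andP[PS /eqP <-]|_]; last by case: ifP.
  by rewrite inordK ?ltnS ?PN // eqxx fc.
rewrite sumr_const -[X in X <= _]mulr_natl ler_wpM2r //.
rewrite -natrX ler_nat.
by rewrite (eq_card (B := [set S : {set T} | #|S| == k])) ?card_draws ?bin_leq_expn // => S; rewrite inE.
Qed.

Definition all_pairs (V : finType) : {set {set V}} := [set e : {set V} | #|e| == 2].

Section SparseProbability.
Variables (R : realFieldType) (V : finType) (Rt : {set V}) (q J : nat).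
Hypothesis q0 : (0 < q)%N.
Hypothesis Vq : (#|V| <= 64 ^ J * q ^ (6 * J))%N.
Hypothesis Rt3 : (#|Rt| <= 3)%N.
Local Notation s := J.+1.

(** The least number of edges by which [k] vertices violate [sparse]; at [k = 0] a single edge
    between roots does. *)
Definition dense_threshold (k : nat) : nat :=
  if k == 0 then 1 else if (k < s)%N then uphalf (3 * k) else uphalf (3 * k).-1.

Definition has_dense (G : {set {set V}}) : bool :=
  [exists S : {set V}, (#|S| <= 3 * s)%N && (dense_threshold #|S| <= edge_count G (S :|: Rt))%N].

Lemma sparse_of_not_dense G : ~~ has_dense G -> sparse G Rt s.
Proof.
rewrite negb_exists => /forallP nd.
have lt (S : {set V}) : (#|S| <= 3 * s)%N -> (edge_count G (S :|: Rt) < dense_threshold #|S|)%N.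
  by move=> Ss; have := nd S; rewrite Ss /= -ltnNge.
split.
- have := lt set0; rewrite cards0 set0U => /(_ isT); rewrite ltnS leqn0 cards_eq0.
  by move/eqP.
- move=> S _ S0 Ss; have := lt S Ss; rewrite /dense_threshold cards_eq0 (negPf S0).
  have : (0 < #|S|)%N by rewrite card_gt0.
  move: (edge_count _ _) #|S| => a b; clear; case: ifP => _; lia.
- move=> S _ /andP[sS Ss]; have := lt S Ss; rewrite /dense_threshold.
  have -> : (#|S| < s)%N = false by apply/negbTE; rewrite -leqNgt.
  case: eqP => [S0|_]; first by rewrite S0 in sS.
  by move: (edge_count _ _) #|S| sS => a b; clear; lia.
Qed.

(** This makes the expected number of dense k-sets O(1/q). With the margin the requirement becomes
    (2J+1)(3k-1) >= 6Jk + 1, that is, 3k >= 2J + 2, and [s = J + 1] guarantees it. *)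
Lemma threshold_exponent k : (6 * J * k + 1 <= (4 * J + 2) * dense_threshold k)%N.
Proof.
rewrite /dense_threshold; case: eqP => [->|/eqP k0]; first by rewrite muln0 muln1; lia.
have E (m : nat) : ((4 * J + 2) * m = (2 * J + 1) * (2 * m))%N by rewrite mulnA; congr muln; lia.
have k1 : (0 < k)%N by rewrite lt0n.
case: ifP => ks; rewrite E.
  apply: (@leq_trans ((2 * J + 1) * (3 * k))); last by rewrite leq_mul2l; apply/orP; right; lia.
  by move: k1; clear; nia.
apply: (@leq_trans ((2 * J + 1) * (3 * k).-1)); last by rewrite leq_mul2l; apply/orP; right; lia.
have : (J < k)%N by move: ks; lia.
by case: k {k0 k1 ks} => // k; clear; nia.
Qed.

Let p : R := (q ^ (4 * J + 2))%:R^-1.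

Lemma p_01 : 0 <= p <= 1.
Proof.
by rewrite invr_ge0 ler0n invf_le1 ?ltr0n ?ler1n expn_gt0 q0.
Qed.

Lemma weight_bound k : #|V|%:R ^+ k * p ^+ dense_threshold k <= (64 ^ (J * k))%:R / q%:R.
Proof.
have qk j : 0 < q%:R ^+ j :> R by rewrite exprn_gt0 // ltr0n.
apply: (@le_trans _ _ ((64 ^ (J * k))%:R * q%:R ^+ (6 * J * k) * (q%:R ^+ (6 * J * k + 1))^-1)).
  apply: ler_pM; rewrite ?exprn_ge0 ?ler0n ?invr_ge0 //.
    rewrite -natrX -natrX -natrM ler_nat (expnM 64) (expnM q) -expnMn.
    by case: (posnP k) => [->|k0]; rewrite ?expn0 // leq_exp2r.
  rewrite /p exprVn natrX -exprM lef_pV2 ?posrE ?qk //.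
  by rewrite ler_weXn2l ?ler1n // threshold_exponent.
rewrite addn1 exprSr invfM mulrA -mulrA -[X in _ <= X]mulr1 -!mulrA ler_wpM2l ?ler0n //.
by rewrite mulrA mulfV ?mul1r ?mulr1 // gt_eqF.
Qed.

(** A union bound over [S] and over the edge sets inside [S] and the roots. The number of the latter
    is bounded in terms of [J] alone. *)
Lemma expect_has_dense :
  expect p (enum (all_pairs V)) (fun G => (has_dense G)%:R) <=
  ((3 * s).+1 * (2 ^ 2 ^ (3 * s + 3)) * 64 ^ (J * (3 * s)))%:R / q%:R.
Proof.
have p01 := p_01; have [p0 p1] := andP p01.
have enK : [set x in enum (all_pairs V)] = all_pairs V by apply/setP => x; rewrite inE mem_enum.
apply: le_trans (expect_exists _ _ _ p01) _.
pose D : R := (2 ^ 2 ^ (3 * s + 3))%:R.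
apply: (@le_trans _ _ (\sum_(k < (3 * s).+1) #|V|%:R ^+ k * (D * p ^+ dense_threshold k))).
  apply: (@sum_small_sets _ _ _ _ _ (fun k => D * p ^+ dense_threshold k)) => // [S Ss|k]; last by rewrite mulr_ge0 ?exprn_ge0 ?ler0n.
  set m := dense_threshold #|S|.
  pose Q (F : {set {set V}}) := [&& F \subset all_pairs V, F \subset powerset (S :|: Rt) & #|F| == m].
  apply: (@le_trans _ _ (expect p (enum (all_pairs V)) (fun G => [exists F, Q F && (F \subset G)]%:R))).
    apply: le_expect => // G; rewrite enK => GK; rewrite ler_nat.
    have [mG|] := boolP (m <= _)%N; last by [].
    have [F FG Fm] := subset_of_card mG.
    suff -> : [exists F, Q F && (F \subset G)] by [].
    apply/existsP; exists F; rewrite /Q Fm eqxx.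
    have FG' : F \subset G by apply: subset_trans FG _; apply/subsetP => e; rewrite inE => /andP[].
    rewrite (subset_trans FG' GK) FG' !andbT /=; apply/subsetP => e /(subsetP FG).
    by rewrite inE powersetE => /andP[].
  apply: le_trans (expect_exists _ _ _ p01) _.
  apply: (@le_trans _ _ (\sum_(F in powerset (powerset (S :|: Rt))) p ^+ m)).
    rewrite [X in X <= _]big_mkcond [X in _ <= X]big_mkcond /=; apply: ler_sum => F _.
    case: ifP => [/and3P[FK FS /eqP Fm]|_]; last by case: ifP => //; rewrite exprn_ge0.
    by rewrite powersetE FS expect_subset ?enum_uniq ?Fm // enK.
  rewrite sumr_const -mulr_natl ler_wpM2r ?exprn_ge0 // ler_nat !card_powerset.
  rewrite leq_exp2l // leq_exp2l //; apply: leq_trans (leq_card_setU _ _).1 _.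
  exact: leq_add.
apply: (@le_trans _ _ (\sum_(k < (3 * s).+1) (D * (64 ^ (J * (3 * s)))%:R / q%:R))).
  apply: ler_sum => k _; rewrite mulrCA -mulrA ler_wpM2l ?ler0n //.
  apply: le_trans (weight_bound k) _; rewrite ler_wpM2r ?invr_ge0 ?ler0n // ler_nat.
  by rewrite leq_exp2l // leq_mul2l -ltnS ltn_ord orbT.
by rewrite sumr_const card_ord -[X in X <= _]mulr_natl /D -!mulrA mulrA -natrM mulrA -natrM lexx.
Qed.

End SparseProbability.

(** * Expansion above the threshold *)

Lemma superset_of_card (T : finType) (A : {set T}) k : (#|A| <= k <= #|T|)%N ->
  exists2 B : {set T}, A \subset B & #|B| = k.
Proof.
case/andP=> Ak kT; have [|B BA Bk] := @subset_of_card _ (~: A) (#|T| - k)%N.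
  by have := cardsC A; clear -Ak kT; lia.
exists (~: B); first by rewrite -setCS setCK.
by have := cardsC B; rewrite Bk; clear -kT; lia.
Qed.

(** A block of [k] factors is at most one half, since (1 - x)^k (1 + x)^k <= 1 and (1 + x)^k >=
    2. *)
Lemma pow_half (R : realFieldType) (x : R) (k m N : nat) :
  0 <= x <= 1 -> 1 <= k%:R * x -> (k * m <= N)%N -> (1 - x) ^+ N <= 2^-1 ^+ m.
Proof.
case/andP=> x0 x1 kx kmN; have y0 : 0 <= 1 - x by rewrite subr_ge0.
have y1 : 1 - x <= 1 by rewrite lerBlDr lerDl.
apply: (@le_trans _ _ ((1 - x) ^+ (k * m))); first by rewrite ler_wiXn2l.
rewrite exprM lerXn2r ?nnegrE ?exprn_ge0 ?invr_ge0 //.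
have h1 : (1 - x) ^+ k * (1 + x) ^+ k <= 1 by apply: pow_subM_add_le1; rewrite x0.
have h2 : 2 <= (1 + x) ^+ k.
  by apply: le_trans (bernoulli_ge k x0); rewrite -[2%:R]/(1 + 1) lerD2l.
have h3 : (1 - x) ^+ k * 2 <= 1.
  by apply: le_trans h1; rewrite ler_wpM2l // exprn_ge0.
by rewrite -[X in _ <= X]mul1r ler_pdivlMr.
Qed.

Section Pairs.
Variable V : finType.
Implicit Types A B S W : {set V}.

Definition pairs A B : {set {set V}} := [set [set u.1; u.2] | u in setX A B].

Lemma card_pairs A B : [disjoint A & B] -> #|pairs A B| = (#|A| * #|B|)%N.
Proof.
move=> dAB.
have inj : {in setX A B &, injective (fun u : V * V => [set u.1; u.2])}; last first.
  by rewrite (card_in_imset inj) cardsX.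
move=> u w; case: u w => [x y] [x' y'].
rewrite !in_setX /= => /andP[xA yB] /andP[x'A y'B] /setP E.
have xx : x = x'.
  have := E x; rewrite !inE eqxx => /esym/orP[/eqP //|/eqP xy].
  by rewrite xy (disjointFl dAB y'B) in xA.
have := E y; rewrite -xx !inE eqxx orbT => /esym/orP[/eqP yx|/eqP -> //].
by rewrite yx (disjointFr dAB xA) in yB.
Qed.

Lemma pairs_all A B : [disjoint A & B] -> pairs A B \subset all_pairs V.
Proof.
move=> dAB; apply/subsetP => _ /imsetP[[x y] + ->]; rewrite in_setX /= => /andP[xA yB].
rewrite inE cards2 (_ : x != y) //; apply: contraTneq yB => <-.
by rewrite (disjointFr dAB xA).
Qed.

Lemma disjoint_nbrs (G : {set {set V}}) y A :
  [disjoint nbrs G y & A] = [disjoint pairs [set y] A & G].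
Proof.
apply/idP/idP => d.
  apply: disjoint_notin => _ /imsetP[[x z] + ->]; rewrite in_setX in_set1 /= => /andP[/eqP -> zA].
  by apply/negP => yz; have := disjointFl d zA; rewrite inE yz.
apply: disjoint_notin => z; rewrite inE => yz; apply/negP => zA.
suff : [set y; z] \in pairs [set y] A by move/(disjointFr d); rewrite yz.
by apply/imsetP; exists (y, z); rewrite // in_setX inE eqxx.
Qed.

Lemma boundary_pairs (G : {set {set V}}) A W : [disjoint W & A] ->
  [disjoint boundary G A & W] -> [disjoint pairs A W & G].
Proof.
move=> WA d; apply: disjoint_notin => _ /imsetP[[x y] + ->]; rewrite in_setX /= => /andP[xA yW].
apply: contraFN (disjointFl d yW) => xy; rewrite inE (disjointFr WA yW) /=.
by apply/pred0Pn; exists x; rewrite /= inE setUC xy.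
Qed.

Lemma disjoint_restrict (D D' G H : {set {set V}}) : D' \subset D -> G :&: D = H :&: D ->
  [disjoint D' & G] = [disjoint D' & H].
Proof.
move=> DD GH; rewrite -!setI_eq0.
by rewrite -(setIidPl DD) -!setIA ![D :&: _]setIC GH.
Qed.

Lemma pairsS A B W : A \subset B -> pairs W A \subset pairs W B.
Proof. by move=> AB; apply: imsetS; rewrite setXS. Qed.

Lemma disjoint_pairs1 A y y' : y \notin A -> y' \notin A -> y != y' ->
  [disjoint pairs [set y] A & pairs [set y'] A].
Proof.
move=> yA y'A yy; apply: disjoint_notin => _ /imsetP[[x z] + ->].
rewrite in_setX in_set1 /= => /andP[/eqP -> zA].
apply/negP => /imsetP[[x' z']]; rewrite in_setX in_set1 /= => /andP[/eqP -> z'A] /setP/(_ y).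
rewrite !inE eqxx (negPf yy) /= => /esym/eqP yz'.
by rewrite yz' z'A in yA.
Qed.

End Pairs.

Section ExpandingProbability.
Variables (R : realFieldType) (V : finType) (q J l : nat).
Hypothesis J0 : (0 < J)%N.
Hypothesis Vq : (q ^ (6 * J) <= #|V|)%N.
Hypothesis Vl : (#|V| < 2 ^ l)%N.
Hypothesis ql : (16 * l + 7 <= q)%N.

Local Notation P := (q ^ (4 * J - 2))%N.
Let p : R := P%:R^-1.
Local Notation pr F := (expect p (enum (all_pairs V)) (fun G => (F G)%:R)).

Lemma qpos : (0 < q)%N. Proof. by clear -ql; lia. Qed.

Lemma P_gt0 : (0 < P)%N. Proof. by rewrite expn_gt0 qpos. Qed.

Lemma hi_01 : 0 <= p <= 1.
Proof. by rewrite invr_ge0 ler0n invf_le1 ?ltr0n ?ler1n P_gt0. Qed.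

Lemma enum_pairs (D : {set {set V}}) : D \subset all_pairs V ->
  uniq (enum (all_pairs V)) /\ D \subset [set x in enum (all_pairs V)].
Proof.
by move=> DK; rewrite enum_uniq; split=> //; apply/subsetP => e /(subsetP DK); rewrite [in X in _ -> X]inE mem_enum.
Qed.

Lemma pr_no_pairs (A B : {set V}) : [disjoint A & B] ->
  pr (fun G => [disjoint pairs A B & G]) = (1 - p) ^+ (#|A| * #|B|).
Proof.
move=> dAB; have [u s] := enum_pairs (pairs_all dAB).
by rewrite expect_disjoint // card_pairs.
Qed.

Lemma union_bound (I : finType) (Q : pred I) (F : I -> {set {set V}} -> bool) c d m :
  (forall i, Q i -> pr (F i) <= 2^-1 ^+ m) -> (#|Q| <= 2 ^ c)%N -> (c + d <= m)%N ->
  pr (fun G => [exists i, Q i && F i G]) <= 2^-1 ^+ d.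
Proof.
move=> Fm Qc cdm; apply: le_trans (expect_exists _ _ _ hi_01) _.
apply: (@le_trans _ _ (\sum_(i | Q i) 2^-1 ^+ m)); first exact: ler_sum.
rewrite sumr_const -[X in X <= _]mulr_natl.
apply: (@le_trans _ _ (2 ^+ c * 2^-1 ^+ (c + d))).
  apply: ler_pM; rewrite ?exprn_ge0 ?invr_ge0 ?ler0n //; first by rewrite -natrX ler_nat.
  by rewrite ler_wiXn2l ?invr_ge0 ?invf_le1 // ler1n.
by rewrite exprD mulrA -exprMn mulfV ?pnatr_eq0 // expr1n mul1r.
Qed.

Lemma card_sets k : (#|[pred S : {set V} | #|S| == k]| <= 2 ^ (l * k))%N.
Proof.
rewrite (eq_card (B := [set S : {set V} | #|S| == k])) => [|S]; last by rewrite !inE.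
rewrite card_draws; apply: leq_trans (bin_leq_expn _ _) _; rewrite expnM.
by case: (posnP k) => [->|k0]; rewrite ?expn0 // leq_exp2r // ltnW.
Qed.

Lemma card_set_pairs i j :
  (#|[pred u : {set V} * {set V} | (#|u.1| == i) && (#|u.2| == j)]| <= 2 ^ (l * (i + j)))%N.
Proof.
rewrite mulnDr expnD; apply: leq_trans (leq_mul (card_sets i) (card_sets j)).
by rewrite -cardX; apply/eq_leq/eq_card => u; rewrite !inE.
Qed.

Lemma card_set_triples i j k :
  (#|[pred u : {set V} * {set V} * {set V} | [&& #|u.1.1| == i, #|u.1.2| == j & #|u.2| == k]]|
   <= 2 ^ (l * (i + j + k)))%N.
Proof.
rewrite mulnDr expnD; apply: leq_trans (leq_mul (card_set_pairs i j) (card_sets k)).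
by rewrite -cardX; apply/eq_leq/eq_card => u; rewrite !inE andbA.
Qed.

Local Notation h := (q ^ (4 * J).-1)%N.

Definition has_hole (G : {set {set V}}) : bool :=
  [exists u : {set V} * {set V}, [&& #|u.1| == h & #|u.2| == h] &&
    ([disjoint u.1 & u.2] && [disjoint pairs u.1 u.2 & G])].

(** As [h = q * P], two [h]-sets have no edge between them with probability at most 2^-(q h),
    against 2^(2 l h) pairs of sets. *)
Lemma pr_hole : pr has_hole <= 2^-1 ^+ (2 * l).
Proof.
have q0 := qpos; have hP : (h = q * P)%N by rewrite -expnS; congr expn; clear -J0; lia.
apply: (@union_bound _ _ _ (l * (h + h)) _ (q * h)).
- move=> [A B] /= /andP[/eqP Ah /eqP Bh].
  have [dAB|_] := boolP [disjoint A & B]; last first.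
    by rewrite expect_cst exprn_ge0 // invr_ge0.
  rewrite /= pr_no_pairs // Ah Bh; apply: (@pow_half _ _ P); first exact: hi_01.
    by rewrite divff // pnatr_eq0 -lt0n P_gt0.
  by rewrite mulnA (mulnC P) -hP leqnn.
- exact: card_set_pairs.
have h1 : (1 <= h)%N by rewrite expn_gt0 q0.
apply: (@leq_trans ((4 * l) * h)); last by rewrite leq_mul2r; apply/orP; right; clear -ql; lia.
by have : (l <= l * h)%N by [rewrite leq_pmulr]; clear; lia.
Qed.

(** [Y] stands for the boundary enlarged to an exact size, so that the event is just the absence of
    all edges from [S] to the rest. *)
Definition small_boundary_of s (G : {set {set V}}) : bool :=
  [exists u : {set V} * {set V}, [&& #|u.1| == s & #|u.2| == s * q ^ (2 * J + 1)]%N &&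
    [disjoint pairs u.1 (~: (u.1 :|: u.2)) & G]].

Lemma pr_small_boundary s : (0 < s <= q ^ (2 * J))%N -> pr (small_boundary_of s) <= 2^-1 ^+ (2 * l).
Proof.
case/andP=> s0 sq; have q0 := qpos.
set t := (s * q ^ (2 * J + 1))%N.
have t1 : (s <= t)%N by rewrite leq_pmulr // expn_gt0 q0.
have E : (P * q ^ (2 * J + 1) = q ^ (6 * J - 1))%N by rewrite -expnD; congr expn; clear -J0; lia.
have tq : (t <= q ^ (6 * J - 1))%N.
  apply: (@leq_trans (q ^ (2 * J) * q ^ (2 * J + 1))%N); first by rewrite leq_mul2r sq orbT.
  by rewrite -expnD leq_pexp2l //; clear -J0; lia.
have nq : (q * q ^ (6 * J - 1) <= #|V|)%N.
  by apply: leq_trans Vq; rewrite -expnS leq_pexp2l //; clear -J0; lia.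
apply: (@union_bound _ _ _ (l * (s + t)) _ (t * (q - 2))).
- move=> [S Y] /= /andP[/eqP Ss /eqP Yt].
  have dS : [disjoint S & ~: (S :|: Y)] by rewrite disjoints_subset setCK subsetUl.
  rewrite pr_no_pairs //; apply: (@pow_half _ _ P); first exact: hi_01.
    by rewrite divff // pnatr_eq0 -lt0n P_gt0.
  have -> : (P * (t * (q - 2)) = s * (q ^ (6 * J - 1) * (q - 2)))%N.
    by rewrite -E /t !mulnA (mulnC P s).
  rewrite Ss leq_mul2l; apply/orP; right.
  have := cardsC (S :|: Y); have := (leq_card_setU S Y).1; rewrite Ss Yt -/t mulnBr.
  by move: nq t1 tq; rewrite (mulnC q); clear; lia.
- exact: card_set_pairs.
have t0 : (0 < t)%N by apply: leq_trans t1.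
apply: (@leq_trans (t * (4 * l))); last by rewrite leq_mul2l; apply/orP; right; clear -ql; lia.
have : (l * s <= l * t)%N by rewrite leq_mul2l t1 orbT.
by have : (l <= l * t)%N by [rewrite leq_pmulr]; clear; lia.
Qed.

Definition few_common j (G : {set {set V}}) : bool :=
  let a := (q ^ (2 * J + 2 * j))%N in
  [exists u : {set V} * {set V} * {set V},
    [&& #|u.1.1| == a, #|u.1.2| == a & #|u.2| == q ^ (2 * J + 2 * j + 3)]%N &&
    ([disjoint u.1.1 & u.1.2] &&
     [forall y in ~: (u.1.1 :|: u.1.2 :|: u.2),
        [disjoint pairs [set y] u.1.1 & G] || [disjoint pairs [set y] u.1.2 & G]])].

(** With a p = 1/r, [y] has a neighbour in [A] with probability at least 1/(2r), because (1 - p)^a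
    <= 1/(1 + 1/r) <= 1 - 1/(2r). The same holds independently for [B], so both happen with
    probability at least 1/(4 r^2). *)
Lemma pr_vertex_misses (A B : {set V}) y a r : [disjoint A & B] -> y \notin A :|: B ->
  #|A| = a -> #|B| = a -> (a * r = P)%N ->
  pr (fun G => [disjoint pairs [set y] A & G] || [disjoint pairs [set y] B & G])
    <= 1 - (4 * r ^ 2)%:R^-1.
Proof.
move=> dAB; rewrite inE negb_or => /andP[yA yB] Aa Ba arP.
have [a0 r0] : (0 < a)%N /\ (0 < r)%N by apply/andP; rewrite -muln_gt0 arP P_gt0.
have dyA : [disjoint [set y] & A] by rewrite disjoints1.
have dyB : [disjoint [set y] & B] by rewrite disjoints1.
have p01 := hi_01; have [p0 p1] := andP p01.
set f : {set {set V}} -> R := fun G => 1 - [disjoint pairs [set y] A & G]%:R.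
set g : {set {set V}} -> R := fun G => 1 - [disjoint pairs [set y] B & G]%:R.
have -> : pr (fun G => [disjoint pairs [set y] A & G] || [disjoint pairs [set y] B & G]) =
    expect p (enum (all_pairs V)) (fun G => 1 + -1 * (f G * g G)).
  apply: eq_expect => G _; rewrite /f /g.
  by case: [disjoint _ & G]; case: [disjoint _ & G]; rewrite /=; ring.
have dD : [disjoint pairs [set y] A & pairs [set y] B].
  apply: disjoint_notin => _ /imsetP[[x z] + ->]; rewrite in_setX in_set1 /= => /andP[/eqP -> zA].
  apply/negP => /imsetP[[x' z']]; rewrite in_setX in_set1 /= => /andP[/eqP -> z'B] /set2_inj zz.
  by rewrite -zz (disjointFr dAB zA) in z'B.
rewrite expectD expectZ expect_cst (expect_indep p _ dD); last 2 first.
- by move=> G H GH; rewrite /f (disjoint_restrict (subxx _) GH).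
- by move=> G H GH; rewrite /g (disjoint_restrict (subxx _) GH).
have ef (X : {set V}) : [disjoint [set y] & X] -> #|X| = a ->
    expect p (enum (all_pairs V)) (fun G => 1 - [disjoint pairs [set y] X & G]%:R) = 1 - (1 - p) ^+ a.
  move=> dX Xa; have := pr_no_pairs dX; rewrite cards1 mul1n Xa => <-.
  transitivity (expect p (enum (all_pairs V)) (fun G => 1 + -1 * [disjoint pairs [set y] X & G]%:R)).
    by apply: eq_expect => G _; rewrite mulN1r.
  by rewrite expectD expectZ expect_cst mulN1r.
rewrite (ef _ dyA Aa) (ef _ dyB Ba) mulN1r lerD2l lerN2.
have r0R : 0 < r%:R :> R by rewrite ltr0n.
have ap : a%:R * p = r%:R^-1.
  rewrite /p -arP natrM invfM mulrA divff ?mul1r // pnatr_eq0 -lt0n //.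
suff le : (2 * r%:R)^-1 <= 1 - (1 - p) ^+ a.
  apply: (@le_trans _ _ ((2 * r%:R)^-1 * (2 * r%:R)^-1)).
    rewrite -invfM lef_pV2 ?posrE ?mulr_gt0 ?ltr0n ?muln_gt0 ?expn_gt0 ?r0 //.
    by rewrite natrM natrX expr2; lra.
  by apply: ler_pM; rewrite ?invr_ge0 ?mulr_ge0 ?ler0n.
have x0 : 0 <= r%:R^-1 :> R by rewrite invr_ge0 ler0n.
have x1 : r%:R^-1 <= 1 :> R by rewrite invf_le1 // ler1n.
have y0 : 0 <= (1 - p) ^+ a by rewrite exprn_ge0 // subr_ge0.
have h1 : (1 - p) ^+ a * (1 + p) ^+ a <= 1 by apply: pow_subM_add_le1.
have h2 : 1 + r%:R^-1 <= (1 + p) ^+ a by rewrite -ap; apply: bernoulli_ge.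
have h3 : (1 - p) ^+ a * (1 + r%:R^-1) <= 1.
  by apply: le_trans h1; rewrite ler_wpM2l.
rewrite invfM; move: (r%:R^-1) x0 x1 h3 y0 => x; move: ((1 - p) ^+ a) => z x0 x1 h3 z0.
have zx : z * (1 + x) * (1 - x / 2) <= 1 - x / 2.
  by rewrite -[X in _ <= X]mul1r ler_wpM2r // subr_ge0; lra.
have : z * 1 <= z * ((1 + x) * (1 - x / 2)).
  rewrite ler_wpM2l //; have : 0 <= x * (1 - x) by rewrite mulr_ge0 // subr_ge0.
  lra.
rewrite mulrA mulr1; lra.
Qed.

(** Different [y] involve disjoint sets of pairs. At least [4 * r ^ 2 * (t * g)] vertices must all
    miss, so the probability is at most 2^-(t g) with [g] about q/4, against 2^(l (2a + t))
    triples. *)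
Lemma pr_few_common j : (j < J)%N -> pr (few_common j) <= 2^-1 ^+ (2 * l).
Proof.
move=> jJ; have q0 := qpos.
pose a := (q ^ (2 * J + 2 * j))%N; pose t := (q ^ (2 * J + 2 * j + 3))%N.
pose r := (q ^ (2 * (J - 1 - j)))%N; pose g := ((q - 3) %/ 4)%N.
have arP : (a * r = P)%N by rewrite -expnD; congr expn; clear -jJ; lia.
have r0 : (0 < r)%N by rewrite expn_gt0 q0.
have at3 : (t = a * q ^ 3)%N by rewrite -expnD.
have t2a : (2 * a <= t)%N.
  rewrite at3 mulnC leq_mul2l; apply/orP; right; apply: (@leq_trans q); first by clear -ql; lia.
  by rewrite -[X in (X <= _)%N]expn1 leq_pexp2l.
have g4 : (4 * g <= q - 3)%N by rewrite mulnC leq_trunc_div.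
have gl : (4 * l <= g)%N by rewrite leq_divRL //; clear -ql; lia.
have nq : (r ^ 2 * t * q <= #|V|)%N.
  apply: leq_trans Vq; rewrite -expnM -expnD -expnSr leq_pexp2l //; clear -jJ; lia.
apply: (@union_bound _ _ _ (l * (a + a + t)) _ (t * g)).
- move=> [[A B] Y] /= /and3P[/eqP Aa /eqP Ba /eqP Yt].
  have [dAB|_] := boolP [disjoint A & B]; last by rewrite expect_cst exprn_ge0 // invr_ge0.
  set W := ~: (A :|: B :|: Y); set x : R := (4 * r ^ 2)%:R^-1.
  have r4 : (0 < 4 * r ^ 2)%N by rewrite muln_gt0 expn_gt0 r0.
  have x01 : 0 <= x <= 1 by rewrite invr_ge0 ler0n invf_le1 ?ltr0n ?ler1n.
  have cardW : ((4 * r ^ 2) * (t * g) <= #|W|)%N.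
    have : (#|A :|: B :|: Y| <= a + a + t)%N.
      apply: leq_trans (leq_card_setU _ _).1 _; rewrite Yt leq_add2r.
      by apply: leq_trans (leq_card_setU _ _).1 _; rewrite Aa Ba.
    have := cardsC (A :|: B :|: Y); rewrite -/W.
    have : ((4 * r ^ 2) * (t * g) <= (r ^ 2 * t) * (q - 3))%N.
      have -> : (4 * r ^ 2 * (t * g) = r ^ 2 * t * (4 * g))%N.
        by move: (r ^ 2)%N => r2; clear; lia.
      by rewrite leq_mul2l g4 orbT.
    have : (t <= r ^ 2 * t)%N by rewrite leq_pmull // expn_gt0 r0.
    by move: nq t2a; rewrite mulnBr; clear; lia.
  apply: le_trans (pow_half x01 _ cardW); last by rewrite divff // pnatr_eq0 -lt0n.
  have -> : pr (fun G => true && [forall y in W, [disjoint pairs [set y] A & G] || [disjoint pairs [set y] B & G]]) =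
     expect p (enum (all_pairs V)) (fun G => \prod_(y <- enum W)
       ([disjoint pairs [set y] A & G] || [disjoint pairs [set y] B & G])%:R).
    apply: eq_expect => G _; rewrite prod_bool; congr (nat_of_bool _)%:R.
    apply/forall_inP/allP => H y; first by rewrite mem_enum; exact: H.
    by move=> yW; apply: H; rewrite mem_enum.
  have yW y : y \in enum W -> y \notin A :|: B.
    by rewrite mem_enum !inE negb_or => /andP[].
  rewrite (@expect_prod _ _ _ _ _ _ (fun y => pairs [set y] (A :|: B))) ?enum_uniq //.
  + rewrite big_enum -prodr_const; apply: ler_prod => y yWi; apply/andP; split.
      by apply: expect_ge0 => [|G]; [exact: hi_01|exact: ler0n].
    by apply: (pr_vertex_misses dAB _ Aa Ba arP); apply: yW; rewrite mem_enum.
  + by move=> y y' /yW yAB /yW y'AB; apply: disjoint_pairs1.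
  + move=> y _ G H GH; congr (nat_of_bool (_ || _))%:R; apply: disjoint_restrict GH; apply: pairsS.
      exact: subsetUl.
    exact: subsetUr.
- exact: card_set_triples.
have t0 : (0 < t)%N by rewrite expn_gt0 q0.
apply: (@leq_trans (t * (4 * l))); last by rewrite leq_mul2l gl orbT.
have : (l * (a + a + t) <= l * (t + t))%N.
  by rewrite leq_mul2l; apply/orP; right; move: t2a; clear; lia.
have : (l <= l * t)%N by [rewrite leq_pmulr].
by rewrite mulnDr; clear; lia.
Qed.

Definition not_expanding (G : {set {set V}}) : bool :=
  [|| has_hole G, [exists s : 'I_(#|V|), (0 < s <= q ^ (2 * J))%N && small_boundary_of s G]
    | [exists j : 'I_J, few_common j G]].

Lemma pr_not_expanding : pr not_expanding <= (J + 2)%:R * 2^-1 ^+ l.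
Proof.
have p01 := hi_01.
have half k : 0 <= 2^-1 ^+ k :> R by rewrite exprn_ge0 // invr_ge0.
have le_half : 2^-1 ^+ (2 * l) <= 2^-1 ^+ l :> R.
  by rewrite ler_wiXn2l ?invr_ge0 ?invf_le1 // ?ler1n // leq_pmull.
apply: (@le_trans _ _ (pr has_hole +
    (\sum_(s < #|V| | (0 < s <= q ^ (2 * J))%N) pr (small_boundary_of s) +
     \sum_(j < J) pr (few_common j)))).
  have e1 := @expect_exists R _ p (enum (all_pairs V)) _ (fun s : 'I_(#|V|) => (0 < s <= q ^ (2 * J))%N)
    (fun s => small_boundary_of s) p01.
  have e2 := @expect_exists R _ p (enum (all_pairs V)) _ (fun j : 'I_J => true)
    (fun j => few_common j) p01.
  apply: le_trans (lerD (lexx (pr has_hole)) (lerD e1 e2)).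
  rewrite -!expectD; apply: le_expect => // G _; rewrite /not_expanding /= -!natrD ler_nat.
  by case: (has_hole G); do 2!case: [exists _, _].
have -> : (J + 2)%:R * 2^-1 ^+ l = 2^-1 ^+ l + (2^-1 ^+ l + J%:R * 2^-1 ^+ l) :> R.
  by rewrite natrD; ring.
apply: lerD; first exact: le_trans pr_hole le_half.
apply: lerD.
  apply: (@le_trans _ _ (\sum_(s < #|V|) 2^-1 ^+ (2 * l))).
    rewrite [X in X <= _]big_mkcond; apply: ler_sum => s _; case: ifP => // sq.
    exact: pr_small_boundary.
  rewrite sumr_const card_ord -[X in X <= _]mulr_natl mul2n -addnn exprD mulrA.
  rewrite -[X in _ <= X]mul1r ler_wpM2r //.
  apply: (@le_trans _ _ (2 ^+ l * 2^-1 ^+ l)).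
    by rewrite ler_wpM2r // -natrX ler_nat ltnW.
  by rewrite -exprMn mulfV ?expr1n // pnatr_eq0.
apply: (@le_trans _ _ (\sum_(j < J) 2^-1 ^+ l)).
  by apply: ler_sum => j _; apply: le_trans (pr_few_common (ltn_ord j)) le_half.
by rewrite sumr_const card_ord -[X in X <= _]mulr_natl.
Qed.

Lemma expanding_of_not (G : {set {set V}}) : ~~ not_expanding G -> expanding G q J.
Proof.
have q0 := qpos.
rewrite !negb_or !negb_exists => /and3P[/forallP hole /forallP sb /forallP fc].
have leV k : (k <= 6 * J)%N -> (q ^ k <= #|V|)%N by move=> kJ; apply: leq_trans Vq; rewrite leq_pexp2l.
split.
- move=> j A B jJ dAB Aa Ba; rewrite leqNgt; apply/negP => lt.
  have [|Y cY Yt] := @superset_of_card _ (common_nbrs G A B) (q ^ (2 * J + 2 * j + 3)).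
    by rewrite (ltnW lt) leV //; clear -jJ; lia.
  have := fc (Ordinal jJ); rewrite negb_exists => /forallP/(_ (A, B, Y)).
  rewrite /= Aa Ba Yt !eqxx dAB /= => /negP; apply; apply/forall_inP => y.
  rewrite -!disjoint_nbrs !in_setC !in_setU negb_or => /andP[yAB yY].
  apply: contraNT yY; rewrite negb_or => /andP[yA yB].
  by apply: (subsetP cY); rewrite inE in_setU yAB yA yB.
- move=> S /andP[S0 Sq]; rewrite leqNgt; apply/negP => lt.
  have tV : (#|S| * q ^ (2 * J + 1) <= #|V|)%N.
    apply: (@leq_trans (q ^ (2 * J) * q ^ (2 * J + 1))); first by rewrite leq_mul2r Sq orbT.
    by rewrite -expnD leV //; clear -J0; lia.
  have [|Y cY Yt] := @superset_of_card _ (boundary G S) (#|S| * q ^ (2 * J + 1)).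
    by rewrite (ltnW lt) tV.
  have SV : (#|S| < #|V|)%N.
    apply: leq_ltn_trans Sq _; apply: (@leq_trans (q ^ (2 * J).+1)); last by rewrite leV //; clear -J0; lia.
    by rewrite ltn_exp2l //; clear -ql; lia.
  have := sb (Ordinal SV); rewrite /= S0 Sq /= negb_exists => /forallP/(_ (S, Y)).
  rewrite /= Yt !eqxx /= => /negP; apply; apply: boundary_pairs.
    by rewrite disjoint_sym disjoints_subset setCK subsetUl.
  by rewrite disjoints_subset setCK (subset_trans cY) // subsetUr.
move=> A B dAB Ah Bh; apply/negP => d.
have := hole (A, B); rewrite /= Ah Bh !eqxx dAB /=.
by rewrite boundary_pairs // disjoint_sym.
Qed.

End ExpandingProbability.

From mathcomp Require Import all_classical all_reals all_analysis.
Import numFieldNormedType.Exports.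

(** * Thresholds *)

Section GnpExpect.
Variables (R : realType) (n : nat).

Local Notation E p f := (expect p (enum (all_pairs 'I_n)) f).

Lemma Gnp_prob_expect (p : R) (F : edges n -> Prop) :
  Gnp_prob p F = E p (fun G => `[< F G >]%:R).
Proof.
rewrite -expect_sum ?enum_uniq // /Gnp_prob /Gnp_weight.
have -> : [set x in enum (all_pairs 'I_n)]%SET = complete_graph n.
  by apply/finset.setP => x; rewrite inE mem_enum !inE.
rewrite big_mkcondr /=; apply: eq_bigr => G _; rewrite big_enum /=.
by case: `[< F G >]; rewrite ?mulr1 ?mulr0.
Qed.

Lemma enum_pairs_set : [set x in enum (all_pairs 'I_n)]%SET = all_pairs 'I_n.
Proof. by apply/finset.setP => x; rewrite inE mem_enum. Qed.

Lemma simple_sub (G : edges n) : G \subset all_pairs 'I_n -> simple_graph G.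
Proof. by move=> /fintype.subsetP GK e /GK; rewrite inE => /eqP. Qed.

Lemma Gnp_win_lo q J : (0 < q)%N -> (2 < n)%N -> (n <= 64 ^ J * q ^ (6 * J))%N ->
  Gnp_prob ((q ^ (4 * J + 2))%:R^-1 : R) (connector_wins 2 2 (n := n)) <=
  ((3 * J.+1).+1 * (2 ^ 2 ^ (3 * J.+1 + 3)) * 64 ^ (J * (3 * J.+1)))%:R / q%:R.
Proof.
move=> q0 n2 nq.
have n0 : (0 < n)%N by apply: leq_ltn_trans n2.
pose Rt := [set Ordinal n0; Ordinal (ltnW n2); Ordinal n2]%SET.
have Rt3 : #|Rt| = 3%N by rewrite /Rt finset.setUC finset.cardsU1 cards2 !inE.
have cI : (#|'I_n| <= 64 ^ J * q ^ (6 * J))%N by rewrite card_ord.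
have Rt3' : (#|Rt| <= 3)%N by rewrite Rt3.
apply: le_trans (expect_has_dense R q0 cI Rt3').
rewrite Gnp_prob_expect; apply: le_expect; first exact: p_01.
move=> G; rewrite enum_pairs_set => /simple_sub G2; rewrite ler_nat.
have [//|nd] := boolP (has_dense Rt J G); first by case: asbool.
have sp := sparse_of_not_dense nd.
suff -> : `[< connector_wins 2 2 G >] = false by [].
apply/asboolPn; apply: (trap_breaker_wins G2 n0) => b.
exact: (trap_exists G2 sp b (erefl _)).
Qed.

Lemma Gnp_win_hi q J l : (0 < J)%N -> (q ^ (6 * J) <= n)%N -> (n < 2 ^ l)%N -> (0 < n)%N ->
  (16 * (J + 2) * l + 35 * 2 ^ J + 2 * J + 40 <= q)%N ->
  1 - (J + 2)%:R * 2^-1 ^+ l <=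
  Gnp_prob ((q ^ (4 * J - 2))%:R^-1 : R) (connector_wins 2 2 (n := n)).
Proof.
move=> J0 qn nl n0 hq.
have ql : (16 * l + 7 <= q)%N.
  apply: leq_trans hq; have : (16 * l <= 16 * (J + 2) * l)%N by rewrite leq_mul2r leq_pmulr ?orbT // addn2.
  by clear; lia.
have cI : (q ^ (6 * J) <= #|'I_n|)%N by rewrite card_ord.
have cl : (#|'I_n| < 2 ^ l)%N by rewrite card_ord.
have p01 : 0 <= ((q ^ (4 * J - 2))%:R^-1 : R) <= 1 by apply: (hi_01 _ J ql).
have := pr_not_expanding R J0 cI cl ql.
set p := _^-1 in p01 *; move=> ne; rewrite Gnp_prob_expect lerBlDr.
apply: le_trans (lerD (lexx _) ne); rewrite -expectD -[X in X <= _](expect_cst p (enum (all_pairs 'I_n))).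
apply: le_expect => // G; rewrite enum_pairs_set => /simple_sub G2.
have [nG|eG] := boolP (not_expanding q J G); first by rewrite lerDr ler0n.
rewrite addr0; suff -> : `[< connector_wins 2 2 G >] = true by [].
apply/asboolP; have exG := expanding_of_not J0 cI ql eG.
have hq' : (2 * (8 * (J + 2) * l) + 35 * 2 ^ J + 2 * J + 40 <= q)%N by rewrite !mulnA.
exact: (forces_connector_wins (connect_all R G2 exG J0 cl hq' (Ordinal n0))).
Qed.

End GnpExpect.

Section WinProbability.
Variable R : realType.

Definition win_prob (n : nat) (p : R) : R := Gnp_prob p (connector_wins 2 2 (n := n)).

Lemma win_prob_expect n p :
  win_prob n p = prob (enum (all_pairs 'I_n)) (fun G => `[< connector_wins 2 2 G >]) p.
Proof. exact: Gnp_prob_expect. Qed.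

Lemma wins_mono n (G G' : edges n) : G \subset G' ->
  `[< connector_wins 2 2 G >] -> `[< connector_wins 2 2 G' >].
Proof. by move=> GG /asboolP w; apply/asboolP; apply: connector_wins_mono w. Qed.

Lemma win_prob_01 n p : 0 <= p <= 1 -> 0 <= win_prob n p <= 1.
Proof. by rewrite win_prob_expect; apply: prob_01. Qed.

Lemma win_prob_le n p q : 0 <= p -> p <= q -> q <= 1 -> win_prob n p <= win_prob n q.
Proof. by rewrite !win_prob_expect; apply: prob_le; apply: wins_mono. Qed.

Lemma win_prob_multiple n p q m : 0 <= p <= 1 -> m%:R * p <= q -> q <= 1 ->
  1 - win_prob n q <= (1 - win_prob n p) ^+ m.
Proof. by rewrite !win_prob_expect; apply: prob_multiple; apply: wins_mono. Qed.

Definition hi (J n : nat) : R := (floor_root J n ^ (4 * J - 2))%:R^-1.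
Definition lo (J n : nat) : R := (floor_root J n ^ (4 * J + 2))%:R^-1.

Lemma natV_01 (k : nat) : 0 <= (k%:R^-1 : R) <= 1.
Proof.
rewrite invr_ge0 ler0n /=; case: k => [|k]; first by rewrite invr0 ler01.
by rewrite invf_le1 ?ltr0n // ler1n.
Qed.

Lemma win_prob_hi J e : (0 < J)%N -> 0 < e ->
  exists N, forall n, (N <= n)%N -> 1 - e <= win_prob n (hi J n).
Proof.
move=> J0 e0; have [N1 growth] := floor_root_growth (35 * 2 ^ J + 2 * J + 40) (16 * (J + 2)) J0.
pose N2 := Num.bound ((J + 2)%:R / e).
exists (maxn 1 (maxn N1 N2)) => n; rewrite !geq_max => /and3P[n0 n1 n2].
have hq : (16 * (J + 2) * lg n + 35 * 2 ^ J + 2 * J + 40 <= floor_root J n)%N.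
  by have := growth n n1; clear; lia.
apply: le_trans (Gnp_win_hi R J0 (floor_root_le n J0) (lg_gt n) n0 hq).
rewrite lerD2l lerN2 exprVn.
have n0R : 0 < n%:R :> R by rewrite ltr0n.
have bnd : (J + 2)%:R / e < n%:R.
  apply: (@lt_le_trans _ _ N2%:R); last by rewrite ler_nat.
  by apply: archi_boundP; rewrite divr_ge0 ?ler0n // ltW.
apply: (@le_trans _ _ ((J + 2)%:R / n%:R)); last first.
  by rewrite ler_pdivrMr // mulrC -ler_pdivrMr // ltW.
rewrite ler_wpM2l ?ler0n // lef_pV2 ?posrE ?exprn_gt0 //.
by rewrite -natrX ler_nat ltnW // lg_gt.
Qed.

Lemma win_prob_lo J e : (0 < J)%N -> 0 < e ->
  exists N, forall n, (N <= n)%N -> win_prob n (lo J n) <= e.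
Proof.
move=> J0 e0.
pose K : nat := ((3 * J.+1).+1 * (2 ^ 2 ^ (3 * J.+1 + 3)) * 64 ^ (J * (3 * J.+1)))%N.
have [N1 growth] := floor_root_growth (Num.bound (K%:R / e : R)) 0 J0.
exists (maxn 3 N1) => n; rewrite geq_max => /andP[n3 n1].
have n0 : (0 < n)%N by apply: leq_trans n3.
have q0 := floor_root_gt0 J0 n0.
apply: le_trans (Gnp_win_lo R q0 n3 (floor_root_upper J0 n0)) _; rewrite -/K.
have bnd : K%:R / e < (floor_root J n)%:R.
  apply: (@lt_le_trans _ _ (Num.bound (K%:R / e : R))%:R).
    by apply: archi_boundP; rewrite divr_ge0 ?ler0n // ltW.
  by rewrite ler_nat; have := growth n n1; rewrite mul0n addn0.
by rewrite ler_pdivrMr ?ltr0n // mulrC -ler_pdivrMr // ltW.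
Qed.

End WinProbability.

(** * Existence of a threshold *)

Section Thresholds.
Variable R : realType.
Local Notation W := (@win_prob R).
Local Open Scope classical_set_scope.

Definition low_probs (n : nat) : set R := [set p | 0 <= p <= 1 /\ W n p <= 1 / 2].

Definition half_point (n : nat) : R := sup (low_probs n).

Lemma low_probs_sup n : low_probs n !=set0 -> has_sup (low_probs n).
Proof. by move=> ne; split=> //; exists 1 => p [/andP[]]. Qed.

Lemma half_point_01 n : 0 <= half_point n <= 1.
Proof.
have [[p pA]|A0] := pselect (low_probs n !=set0); last first.
  by rewrite /half_point sup_out ?lexx ?ler01 // => -[].
have hs := low_probs_sup (ex_intro _ p pA); apply/andP; split.
  apply: le_trans (ub_le_sup hs.2 pA); by case: pA => /andP[].
by apply: ge_sup; [exists p|move=> x [/andP[]]].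
Qed.

Lemma half_point_gt n p : 0 <= p <= 1 -> half_point n < p -> 1 / 2 < W n p.
Proof.
move=> p01 hp; rewrite ltNge; apply/negP => Wp.
have pA : low_probs n p by [].
have := ub_le_sup (low_probs_sup (ex_intro _ p pA)).2 pA.
by rewrite leNgt hp.
Qed.

Lemma half_point_lt n p : 0 <= p -> p < half_point n -> W n p <= 1 / 2.
Proof.
move=> p0 hp.
have [ne|A0] := pselect (low_probs n !=set0); last first.
  by move: hp; rewrite /half_point sup_out ?ltNge ?p0 // => -[].
have [q [/andP[q0 q1] Wq] pq] := sup_gt ne hp.
by apply: le_trans Wq; apply: win_prob_le => //; apply: ltW.
Qed.

Lemma half_point_gt0 : exists N, forall n, (N <= n)%N -> 0 < half_point n.
Proof.
have [N HN] := @win_prob_lo R 1 (1 / 2) isT ltac:(lra).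
exists (maxn N 1) => n; rewrite geq_max => /andP[Nn n0].
have loA : low_probs n (lo R 1 n) by split; [exact: natV_01|exact: HN].
apply: (@lt_le_trans _ _ (lo R 1 n)).
  by rewrite invr_gt0 ltr0n expn_gt0 floor_root_gt0.
exact: (ub_le_sup (low_probs_sup (ex_intro _ _ loA)).2 loA).
Qed.

Lemma eventually_near (P : nat -> Prop) : (exists N, forall n, (N <= n)%N -> P n) ->
  \forall n \near \oo, P n.
Proof. by case=> N HN; exists N. Qed.

(** Take m > 1/e. Below, [m * p] is less than the half point, so (1 - w)^m >= 1/2; w > e would make
    (1 + w)^m > 2, against (1 - w)^m (1 + w)^m <= 1. Above, p/m exceeds the half point, and m copies
    all fail with probability at most 2^-m. *)
Lemma half_point_threshold : is_threshold (R := R) (connector_wins 2 2) half_point.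
Proof.
split; first exact: half_point_01.
- move=> p p01 /eqoP po; apply/cvgrPdist_le => e e0.
  pose m := (Num.bound (1 / e)).+1.
  have m0 : 0 < m%:R :> R by rewrite ltr0n.
  have me : 1 < m%:R * e.
    rewrite -ltr_pdivrMr //; apply: (@lt_trans _ _ (Num.bound (1 / e))%:R).
      by apply: archi_boundP; rewrite divr_ge0 // ltW.
    by rewrite ltr_nat.
  have h2 : 0 < (2 * m%:R)^-1 :> R by rewrite invr_gt0 mulr_gt0.
  near=> n.
  have hp0 : 0 < half_point n by near: n; apply: eventually_near; exact: half_point_gt0.
  have pn : `|p n| <= (2 * m%:R)^-1 * `|half_point n| by near: n; exact: po.
  have /andP[pn0 pn1] := p01 n; have /andP[h0 h1] := half_point_01 n.
  have /andP[W0 W1] := win_prob_01 n (p01 n).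
  rewrite sub0r normrN -/(win_prob n (p n)) ger0_norm //.
  rewrite !ger0_norm // in pn.
  have mp : m%:R * p n < half_point n.
    apply: (@le_lt_trans _ _ (half_point n / 2)); last by lra.
    by move: pn; rewrite ler_pdivlMl ?mulr_gt0 // => pn; lra.
  have mp0 : 0 <= m%:R * p n by rewrite mulr_ge0 // ltW.
  have := win_prob_multiple n (p01 n) (lexx _) (le_trans (ltW mp) h1).
  have := half_point_lt mp0 mp.
  set w := win_prob n (p n) in W0 W1 *; set z := W n _ => z2 zw.
  rewrite leNgt; apply/negP => ew.
  have y0 : 0 <= 1 - w by rewrite subr_ge0.
  have yz : 1 / 2 <= (1 - w) ^+ m by apply: le_trans zw; lra.
  have h5 : (1 - w) ^+ m * (1 + w) ^+ m <= 1 by apply: pow_subM_add_le1; rewrite W0.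
  have h3 : 1 + m%:R * w <= (1 + w) ^+ m by apply: bernoulli_ge.
  have mw : 1 < m%:R * w by apply: lt_le_trans me _; rewrite ler_wpM2l // ltW.
  have h4 : 2 < (1 + w) ^+ m by apply: lt_le_trans h3; lra.
  have : 1 / 2 * (1 + w) ^+ m <= (1 - w) ^+ m * (1 + w) ^+ m.
    by rewrite ler_wpM2r // exprn_ge0 // addr_ge0.
  by move/le_trans/(_ h5); move: h4; move: ((1 + w) ^+ m) => x; clear; lra.
move=> p p01 /eqoP po; apply/cvgrPdist_le => e e0.
pose m := (Num.bound (1 / e)).+1.
have m0 : 0 < m%:R :> R by rewrite ltr0n.
have me : 1 / e < m%:R.
  apply: (@lt_trans _ _ (Num.bound (1 / e))%:R); last by rewrite ltr_nat.
  by apply: archi_boundP; rewrite divr_ge0 // ltW.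
have h2 : 0 < (2 * m%:R)^-1 :> R by rewrite invr_gt0 mulr_gt0.
near=> n.
have hp0 : 0 < half_point n by near: n; apply: eventually_near; exact: half_point_gt0.
have pn : `|half_point n| <= (2 * m%:R)^-1 * `|p n| by near: n; exact: po.
have /andP[pn0 pn1] := p01 n; have /andP[h0 h1] := half_point_01 n.
have /andP[W0 W1] := win_prob_01 n (p01 n).
rewrite -/(win_prob n (p n)) ger0_norm ?subr_ge0 //.
rewrite !ger0_norm // ler_pdivlMl ?mulr_gt0 // in pn.
have pm : half_point n < p n / m%:R by rewrite ltr_pdivlMr // mulrC; nra.
have pm01 : 0 <= p n / m%:R <= 1.
  rewrite divr_ge0 ?ler0n //= ler_pdivrMr // mul1r (le_trans pn1) //.
  by rewrite ler1n.
have half := half_point_gt pm01 pm.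
have mpp : m%:R * (p n / m%:R) <= p n by rewrite mulrC divfK // gt_eqF.
apply: le_trans (win_prob_multiple n pm01 mpp pn1) _.
have /andP[v0 v1] := win_prob_01 n pm01.
apply: (@le_trans _ _ (2^-1 ^+ m)).
  rewrite lerXn2r ?nnegrE ?invr_ge0 ?subr_ge0 //; lra.
apply: (@le_trans _ _ m%:R^-1).
  rewrite exprVn lef_pV2 ?posrE ?exprn_gt0 // -natrX ler_nat ltnW // ltn_expl //.
by rewrite -[e]invrK lef_pV2 ?posrE ?invr_gt0 // ltW // -div1r.
Unshelve. all: by end_near.
Qed.

End Thresholds.

(** * The exponent of an arbitrary threshold *)

Section Sandwich.
Variables (R : realType) (pstar : nat -> R).
Hypothesis thr : is_threshold (connector_wins 2 2) pstar.
Local Notation W := (@win_prob R).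
Local Notation q J n := ((floor_root J n)%:R : R).
Local Open Scope classical_set_scope.

Lemma pstar_01 n : 0 <= pstar n <= 1.
Proof. by case: thr. Qed.

Lemma floor_root_large J e : (0 < J)%N -> 0 < e -> \forall n \near \oo, 0 < q J n /\ (q J n)^-1 <= e.
Proof.
move=> J0 e0; have [N growth] := floor_root_growth (Num.bound (1 / e)).+1 0 J0.
apply: eventually_near; exists N => n /growth; rewrite mul0n addn0 => qn.
have q0 : 0 < q J n by rewrite ltr0n; apply: leq_trans qn.
split=> //; rewrite -[e]invrK lef_pV2 ?posrE ?invr_gt0 // -div1r.
apply: (@le_trans _ _ (Num.bound (1 / e))%:R); last by rewrite ler_nat ltnW.
by apply/ltW/archi_boundP; rewrite divr_ge0 // ltW.
Qed.

Lemma cvg_win_lt (p : nat -> R) : Gnp_prob (p n) (@connector_wins 2 2 n) @[n --> \oo] --> (0 : R) ->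
  \forall n \near \oo, W n (p n) < 1 / 2.
Proof.
have h : (0 : R) < 1 / 2 by lra.
move=> /cvgrPdist_lt/(_ _ h); apply: filterS => n; rewrite -/(win_prob n (p n)) sub0r normrN.
by move=> /ltr_normlW.
Qed.

Lemma cvg_win_gt (p : nat -> R) : Gnp_prob (p n) (@connector_wins 2 2 n) @[n --> \oo] --> (1 : R) ->
  \forall n \near \oo, 1 / 2 < W n (p n).
Proof.
have h : (0 : R) < 1 / 2 by lra.
move=> /cvgrPdist_lt/(_ _ h); apply: filterS => n; rewrite -/(win_prob n (p n)).
by move=> /ltr_normlW; lra.
Qed.

(** Let [p] be [hi] where the bound fails and 0 elsewhere. Then [p = o(pstar)], so the winning
    probability tends to 0 along [p] but to 1 along [hi]; the bound can fail only finitely often. *)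
Lemma threshold_le_hi J : (0 < J)%N -> \forall n \near \oo, pstar n <= q J n * hi R J n.
Proof.
move=> J0; case: thr => _ thr0 _.
pose p n := if q J n * hi R J n < pstar n then hi R J n else 0.
have hi01 n : 0 <= hi R J n <= 1 by exact: natV_01.
have p01 : probability_sequence p.
  by move=> n; rewrite /p; case: ifP => _; [exact: hi01|rewrite lexx ler01].
have po : p =o_\oo pstar.
  apply/eqoP => e e0; near=> n.
  have [q0 qe] : 0 < q J n /\ (q J n)^-1 <= e by near: n; exact: floor_root_large.
  have /andP[ps0 _] := pstar_01 n; have /andP[h0 _] := hi01 n.
  rewrite /p; case: ifP => lt; last by rewrite normr0 mulr_ge0 // ltW.
  rewrite !ger0_norm //; apply: (@le_trans _ _ ((q J n)^-1 * pstar n)).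
    by rewrite ler_pdivlMl // ltW.
  by rewrite ler_wpM2r.
have lo_p := cvg_win_lt (thr0 p p01 po).
have [N HN] := @win_prob_hi R J (1 / 4) J0 ltac:(lra).
near=> n; rewrite leNgt; apply/negP => lt.
have : W n (p n) < 1 / 2 by near: n; exact: lo_p.
have : 1 - 1 / 4 <= W n (hi R J n).
  by near: n; apply: eventually_near; exists N.
by rewrite /p lt; lra.
Unshelve. all: by end_near.
Qed.

Lemma threshold_ge_lo J : (0 < J)%N -> \forall n \near \oo, lo R J n / q J n <= pstar n.
Proof.
move=> J0; case: thr => _ _ thr1.
(* Where the bound holds, [p] must dominate [pstar] all the same. Since [pstar] is eventually at
   most [q * hi], a further factor [q] suffices, and that is [r]. *)
pose r n : R := (floor_root J n ^ (4 * J - 4))%:R^-1.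
pose p n := if pstar n < lo R J n / q J n then lo R J n else r n.
have lo01 n : 0 <= lo R J n <= 1 by exact: natV_01.
have r01 n : 0 <= r n <= 1 by exact: natV_01.
have p01 : probability_sequence p.
  by move=> n; rewrite /p; case: ifP => _; [exact: lo01|exact: r01].
have po : pstar =o_\oo p.
  apply/eqoP => e e0; near=> n.
  have [q0 qe] : 0 < q J n /\ (q J n)^-1 <= e by near: n; exact: floor_root_large.
  have le_hi : pstar n <= q J n * hi R J n by near: n; exact: threshold_le_hi.
  have /andP[ps0 _] := pstar_01 n; have /andP[h0 _] := lo01 n; have /andP[r0 _] := r01 n.
  rewrite /p; case: ifP => lt; rewrite !ger0_norm //.
    apply: le_trans (ltW lt) _; rewrite mulrC; exact: ler_wpM2r.
  apply: le_trans le_hi _; apply: (@le_trans _ _ ((q J n)^-1 * r n)); last exact: ler_wpM2r.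
  rewrite /hi /r !natrX -invfM -exprS.
  have -> : (4 * J - 2 = (4 * J - 4).+2)%N by clear -J0; lia.
  by rewrite exprS invfM mulrA mulfV ?mul1r // gt_eqF.
have hi_p := cvg_win_gt (thr1 p p01 po).
have [N HN] := @win_prob_lo R J (1 / 4) J0 ltac:(lra).
near=> n; rewrite leNgt; apply/negP => lt.
have : 1 / 2 < W n (p n) by near: n; exact: hi_p.
have : W n (lo R J n) <= 1 / 4.
  by near: n; apply: eventually_near; exists N.
by rewrite /p lt; lra.
Unshelve. all: by end_near.
Qed.

Lemma ln_bounds J : (0 < J)%N -> \forall n \near \oo,
  [/\ 0 < pstar n, - (4 * J + 3)%:R * ln (q J n) <= ln (pstar n),
      ln (pstar n) <= - (4 * J - 3)%:R * ln (q J n),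
      (6 * J)%:R * ln (q J n) <= ln n%:R & ln n%:R <= (6 * J)%:R * (ln 2 + ln (q J n))].
Proof.
move=> J0; near=> n.
have [q0 _] : 0 < q J n /\ (q J n)^-1 <= 1 by near: n; apply: floor_root_large.
have n0 : (0 < n)%N by near: n; exists 1%N.
have q0n : (0 < floor_root J n)%N by rewrite -(ltr0n R).
have le_hi : pstar n <= q J n * hi R J n by near: n; exact: threshold_le_hi.
have ge_lo : lo R J n / q J n <= pstar n by near: n; exact: threshold_ge_lo.
have loE : lo R J n / q J n = (q J n ^+ (4 * J + 3))^-1.
  by rewrite /lo natrX -invfM -exprSr -addnS.
have hiE : q J n * hi R J n = (q J n ^+ (4 * J - 3))^-1.
  rewrite /hi natrX (_ : (4 * J - 2 = (4 * J - 3).+1)%N); last by clear -J0; lia.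
  by rewrite exprS invfM mulVKf // gt_eqF.
have p0 : 0 < pstar n by apply: lt_le_trans ge_lo; rewrite loE invr_gt0 exprn_gt0.
have lnX k : ln (q J n ^+ k) = k%:R * ln (q J n) by rewrite lnXn // mulr_natl.
split=> //.
- rewrite mulNr -lnX -lnV ?posrE ?exprn_gt0 // ler_ln ?posrE ?invr_gt0 ?exprn_gt0 //.
  by rewrite -loE.
- rewrite mulNr -lnX -lnV ?posrE ?exprn_gt0 // ler_ln ?posrE ?invr_gt0 ?exprn_gt0 //.
  by rewrite -hiE.
- by rewrite -lnX ler_ln ?posrE ?exprn_gt0 ?ltr0n // -natrX ler_nat floor_root_le.
rewrite -lnM ?posrE // mulr_natl -lnXn ?mulr_gt0 // ler_ln ?posrE ?exprn_gt0 ?mulr_gt0 ?ltr0n //.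
rewrite -natrM -natrX ler_nat expnMn expnM; exact: floor_root_upper.
Unshelve. all: by end_near.
Qed.

(** Here x = ln n, y = ln pstar, z = ln q and t = ln 2. Without rounding z = x/(6j), which puts y/x
    within 3/(6j) = 1/(2j) of -2/3. Rounding adds at most 4 j t / x, which is at most 1/(2j) because
    8 j^2 t <= x. *)
Lemma exponent_bound (j x y z t : R) : 1 <= j -> 0 < x -> 0 <= t -> 8 * j ^+ 2 * t <= x ->
  - (4 * j + 3) * z <= y -> y <= - (4 * j - 3) * z -> 6 * j * z <= x -> x <= 6 * j * (t + z) ->
  `|y / x + 2 / 3| <= j^-1.
Proof.
move=> j1 x0 t0 jx lo_y y_hi zx xz; have j0 : 0 < j by apply: lt_le_trans j1.
have up : 6 * j * y <= - (4 * j - 3) * (6 * j * z).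
  rewrite [X in _ <= X]mulrCA ler_wpM2l //; lra.
have down : - (4 * j + 3) * (6 * j * z) <= 6 * j * y.
  rewrite [X in X <= _]mulrCA ler_wpM2l //; lra.
have up2 : (4 * j - 3) * (x - 6 * j * t) <= (4 * j - 3) * (6 * j * z).
  rewrite ler_wpM2l; lra.
have down2 : (4 * j + 3) * (6 * j * z) <= (4 * j + 3) * x by rewrite ler_wpM2l //; lra.
have jt : 0 <= j * t by rewrite mulr_ge0 // ltW.
have -> : y / x + 2 / 3 = (3 * y + 2 * x) / (3 * x) by field; rewrite gt_eqF.
rewrite normf_div (ger0_norm (_ : 0 <= 3 * x)) ?ler_pdivrMr ?mulr_gt0 //; last by rewrite mulr_ge0 // ltW.
rewrite ler_pdivlMl // -(ger0_norm (ltW j0)) -normrM ler_norml; apply/andP; split; nra.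
Qed.

Lemma threshold_power_growth : power_growth pstar (- (2 / 3)).
Proof.
have ln2 : 0 < ln (2 : R) by rewrite ln_gt0 // ltr1n.
have lnn (k : nat) : \forall n \near \oo, k%:R * ln 2 <= ln (n%:R : R).
  exists (2 ^ k)%N => // n /= kn; rewrite mulr_natl -lnXn // -natrX.
  have k0 : (0 < 2 ^ k)%N by rewrite expn_gt0.
  by rewrite ler_ln ?posrE ?ltr0n ?ler_nat // (leq_trans k0).
exists (fun n => ln (pstar n) / ln n%:R + 2 / 3); last first.
  have bounds := @ln_bounds 1 isT; near=> n.
  have [p0 _ _ _ _] : [/\ 0 < pstar n, - (4 * 1 + 3)%:R * ln (q 1 n) <= ln (pstar n),
      ln (pstar n) <= - (4 * 1 - 3)%:R * ln (q 1 n),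
      (6 * 1)%:R * ln (q 1 n) <= ln n%:R & ln n%:R <= (6 * 1)%:R * (ln 2 + ln (q 1 n))].
    by near: n; exact: bounds.
  have x0 : 0 < ln (n%:R : R).
    apply: (@lt_le_trans _ _ (1%:R * ln 2)); first by rewrite mul1r.
    by near: n; exact: lnn.
  have n0 : n%:R != 0 :> R.
    by apply: contraTneq x0 => ->; rewrite ln0 ?ltxx.
  rewrite /powR (negPf n0) (_ : _ * ln n%:R = ln (pstar n)) ?lnK ?posrE //.
  by field; rewrite gt_eqF.
(* Every [J] gives bounds for the same [pstar], so [J] may depend on the tolerance [e]. *)
apply/cvgrPdist_le => e e0; pose J := (Num.bound (1 / e)).+1.
have Je : (J%:R : R)^-1 <= e.
  rewrite -[e]invrK lef_pV2 ?posrE ?invr_gt0 ?ltr0n // -div1r.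
  apply: (@le_trans _ _ (Num.bound (1 / e))%:R); last by rewrite ler_nat.
  by apply/ltW/archi_boundP; rewrite divr_ge0 // ltW.
have bounds := @ln_bounds J isT; near=> n.
have [p0 b1 b2 b3 b4] : [/\ 0 < pstar n, - (4 * J + 3)%:R * ln (q J n) <= ln (pstar n),
    ln (pstar n) <= - (4 * J - 3)%:R * ln (q J n),
    (6 * J)%:R * ln (q J n) <= ln n%:R & ln n%:R <= (6 * J)%:R * (ln 2 + ln (q J n))].
  by near: n; exact: bounds.
have xJ : (8 * J ^ 2)%:R * ln 2 <= ln (n%:R : R) by near: n; exact: lnn.
have J1 : 1 <= J%:R :> R by rewrite ler1n.
have x0 : 0 < ln (n%:R : R).
  by apply: lt_le_trans xJ; rewrite mulr_gt0 // ltr0n.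
rewrite sub0r normrN; apply: le_trans Je.
rewrite natrM natrX in xJ; rewrite natrD natrM in b1.
rewrite natrB ?natrM in b2; last by rewrite /J; clear; lia.
rewrite natrM in b3; rewrite natrM in b4.
exact: exponent_bound (ltW ln2) xJ b1 b2 b3 b4.
Unshelve. all: by end_near.
Qed.

End Sandwich.

Theorem theorem1p3 (R : realType) :
  (exists pstar : nat -> R, is_threshold (connector_wins 2 2) pstar) /\
  (forall pstar : nat -> R,
     is_threshold (connector_wins 2 2) pstar ->
     power_growth pstar (- (2 / 3))).
Proof.
split; first by exists (@half_point R); exact: half_point_threshold.
by move=> pstar; exact: threshold_power_growth.
Qed.
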